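(* Let $\overline{H}$ be an H-cyclic minor of a digraph $\overline{G}$. If $\overline{G}$ has an embedding in $\mathbb{R}^3$ in which no pair of disjoint consistently oriented cycles has non-zero linking number, then $\overline{H}$ has an embedding in $\mathbb{R}^3$ in which no pair of disjoint consistently oriented cycles has non-zero linking number.
   Context: All digraphs are finite and embeddings are (tame) embeddings in $\mathbb{R}^3$. A cycle in a digraph is consistently oriented if it is a directed cycle (a pair of oppositely directed edges $uv$, $vu$ counts as a consistently oriented 2-cycle). Let $\overline{H}$ be a digraph with vertex set $\{w_0, w_1, \ldots, w_r\}$. $\overline{H}$ is an H-cyclic minor (or H-cyclic subcontraction) of a digraph $\overline{G}$ if there is a partition $V_0, V_1, \ldots, V_r$ of the vertices of $\overline{G}$ such that: (i) whenever $w_iw_j$ is an edge of $\overline{H}$ (directed from $w_i$ to $w_j$), there exist $v_{ik}\in V_i$ and $v_{jl}\in V_j$ such that $v_{ik}v_{jl}$ is an edge of $\overline{G}$; and (ii) for every $i$, the induced subdigraph $\overline{G(V_i)}$ contains a consistently oriented Hamiltonian cycle. By convention condition (ii) is regarded as satisfied when $V_i$ consists of a single vertex. *)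

(* Defs.v *)
From HB Require Import structures.
From mathcomp Require Import all_boot all_order all_algebra.
From mathcomp Require Import all_classical all_reals all_analysis.
Set Implicit Arguments.
Unset Strict Implicit.
Unset Printing Implicit Defensive.
Import Order.TTheory GRing.Theory Num.Theory.
Import numFieldNormedType.Exports.
Local Open Scope classical_set_scope.
Local Open Scope ring_scope.

(** * Digraphs *)

(* Finite, loopless, at most one edge per ordered pair of vertices; u v and v u
   may both be edges, and are then two different edges. *)
Record digraph := Digraph {
  vertex :> finType;
  edge : rel vertex;
  edge_irr : irreflexive edge }.

(* The list [:: v0; ...; vn] stands for the cycle v0 -> ... -> vn -> v0.  As
   there are no loops it has length at least 2; length 2 is a pair of oppositely
   directed edges. *)
Definition dicycle (G : digraph) (c : seq G) : bool :=
  [&& c != [::], uniq c & cycle (@edge G) c].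

Definition disjoint_cycles (G : digraph) (c d : seq G) : bool :=
  [disjoint c & d].

Section Induced.
Variables (G : digraph) (A : {set G}).
Let iedge : rel {x : G | x \in A} := fun x y => edge (val x) (val y).
Let iedge_irr : irreflexive iedge.
Proof. by move=> x; apply: edge_irr. Qed.
Definition induced : digraph := Digraph iedge_irr.
End Induced.

Definition hamiltonian (G : digraph) : Prop :=
  exists c : seq G, dicycle c /\ (forall x : G, x \in c).

Definition Hcyclic_minor (H G : digraph) : Prop :=
  exists V : H -> {set G},
    [/\ injective V,
        finset.partition [set V i | i : H] [set: G],
        forall i j : H, edge i j ->
          exists x y : G, [/\ x \in V i, y \in V j & edge x y]
      & forall i : H, #|V i| = 1%N \/ hamiltonian (induced (V i))].

(** * Polygons and linking numbers *)

Notation space3 R := ('rV[R]_3).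

Section Linking.
Variable R : realType.
Implicit Types (u x y : space3 R) (e f : space3 R * space3 R) (P Q : seq (space3 R)).

Definition det3 x y z : R :=
  \det (col_mx x (col_mx y z) : 'M[R]_3).

Definition on_segment e (t : R) : space3 R := (1 - t) *: e.1 + t *: e.2.

Definition closed_segment e : set (space3 R) := on_segment e @` `[0, 1].

(* A list P stands for the closed polygon through its points, in cyclic order. *)
Definition sides P : seq (space3 R * space3 R) := zip P (rot 1 P).

(* x and y have the same image under the projection along u. *)
Definition same_shadow u x y : Prop := exists l : R, x = y + l *: u.

(* Regularity of the projection along u, for crossings between P and Q: no
   vertex of one polygon projects into a side of the other.  The sides of P and
   Q then project either to disjoint sets or to segments crossing transversally
   at one interior point. *)
Definition regular_direction u P Q : Prop :=
  [/\ u != 0,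
      forall x f y, x \in P -> f \in sides Q -> closed_segment f y ->
        ~ same_shadow u x y
    & forall x e y, x \in Q -> e \in sides P -> closed_segment e y ->
        ~ same_shadow u x y].

(* Seen by a viewer at infinity in the direction u, e crosses over f. *)
Definition passes_over u e f : Prop :=
  exists s t l : R, [/\ 0 < s < 1, 0 < t < 1, 0 < l
    & on_segment e s = on_segment f t + l *: u].

(* +1 when, for that viewer, the overstrand is turned counterclockwise to get
   the direction of the understrand. *)
Definition crossing_sign u (over under : space3 R * space3 R) : int :=
  sgz (det3 (over.2 - over.1) (under.2 - under.1) u).

Definition crossing_contribution u e f : int :=
  (if `[< passes_over u e f >] then crossing_sign u e f else 0)
  + (if `[< passes_over u f e >] then crossing_sign u f e else 0).

Definition crossing_sum u P Q : int :=
  \sum_(e <- sides P) \sum_(f <- sides Q) crossing_contribution u e f.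

(* s subdivides [0, 1] with all steps smaller than eps; its head is the first
   subdivision point after 0. *)
Definition fine_subdivision (eps : R) (s : seq R) : Prop :=
  itv_partition 0 1 s /\ path (fun a b : R => b - a < eps) 0 s.

(* Two disjoint closed curves c, d, parametrized by [0, 1], have linking number
   k when k is half the sum of the signs of the crossings between p and q, for
   all sufficiently fine polygons p, q inscribed in c, d and all regular
   projections.  As c 0 = c 1, the point c 0 occurs once in [map c s]. *)
Definition linking_number (c d : R -> space3 R) (k : int) : Prop :=
  exists2 eps : R, 0 < eps &
    forall s t : seq R, fine_subdivision eps s -> fine_subdivision eps t ->
    forall u, regular_direction u (map c s) (map d t) ->
      crossing_sum u (map c s) (map d t) = k *+ 2.

Definition nonzero_linking (c d : R -> space3 R) : Prop :=
  exists2 k : int, k != 0 & linking_number c d k.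

End Linking.

(** * Embeddings of digraphs in R^3 *)

Section Embedding.
Variables (R : realType) (G : digraph).

(* A continuous injection of the geometric realization of G, which is compact.
   The values of arc u v are irrelevant when u v is not an edge. *)
Record embedding := Embedding {
  pos : G -> space3 R;
  arc : G -> G -> R -> space3 R;
  arc_continuous : forall u v, edge u v ->
    {within `[0, 1], continuous (arc u v)};
  arc0 : forall u v, edge u v -> arc u v 0 = pos u;
  arc1 : forall u v, edge u v -> arc u v 1 = pos v;
  pos_inj : injective pos;
  arc_pos : forall u v w (s : R), edge u v -> 0 < s < 1 ->
    arc u v s <> pos w;
  arc_inj : forall u v u' v' (s s' : R), edge u v -> edge u' v' ->
    0 < s < 1 -> 0 < s' < 1 -> arc u v s = arc u' v' s' ->
    [/\ u = u', v = v' & s = s'] }.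

Variable phi : embedding.

Definition graph_image : set (space3 R) :=
  [set x | (exists v, x = pos phi v) \/
           (exists u v, edge u v /\ (arc phi u v @` `[0, 1]) x)].

(* Some homeomorphism of R^3 carries the image to a finite union of segments. *)
Definition tame : Prop :=
  exists h g : space3 R -> space3 R,
    [/\ continuous h, continuous g, cancel h g, cancel g h
      & exists es : seq (space3 R * space3 R),
          h @` graph_image = [set x | exists2 e, e \in es & closed_segment e x]].

(* The closed curve, parametrized by [0, 1], tracing the image of the cycle
   c = [:: v0; ...; v(n-1)]: on [i/n, (i+1)/n] it is the arc from v(i) to its
   successor.  At 1 the index wraps around to 0. *)
Definition cycle_curve (c : seq G) (t : R) : space3 R :=
  if c is v0 :: _ then
    let n := size c in
    let i := Num.truncn (t * n%:R) in
    let v := nth v0 c (i %% n) in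
    arc phi v (next c v) (t * n%:R - i%:R)
  else 0.

Definition no_linked_dicycles : Prop :=
  forall c d : seq G, dicycle c -> dicycle d -> disjoint_cycles c d ->
    ~ nonzero_linking (cycle_curve c) (cycle_curve d).

End Embedding.

(* Main.v *)
(* Polygons are treated as lists of oriented segments.  For a generic direction u,
   count with signs the crossings in which a segment of E passes over one of F.  For
   closed E and F this count does not depend on u, and it does not change when a
   side of E is pushed across a triangle missing F: in both cases the solutions of
   the crossing equation form a segment in a polytope, whose two ends lie on faces
   of opposite signs, and the contributions of the faces telescope.  Hence the
   linking number of disjoint closed curves exists, and it is half the crossing
   sum, i.e. the count of a single fine inscribed polygon.

   Given an embedding of G, represent an edge ij of H by the walk in G that runs
   from a root of V i forward along the Hamiltonian cycle of V i to an edge leading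
   to V j, and then forward along the cycle of V j to its root.  Sampling the arcs
   of these walks and moving the sample points to general position gives a polygonal,
   hence tame, embedding of H.  A directed cycle of H becomes a closed directed walk
   of G, that is a directed cycle of G plus some of the Hamiltonian cycles.  Disjoint
   cycles of H give disjoint cycles of G, so by bilinearity their linking number is
   a sum of linking numbers of disjoint directed cycles of G, all of which vanish. *)
Require Import Defs.
From mathcomp Require Import all_boot all_order all_algebra.
From mathcomp Require Import all_classical all_reals all_analysis.
From mathcomp Require Import ring lra zify.
Set Implicit Arguments.
Unset Strict Implicit.
Unset Printing Implicit Defensive.
Import Order.TTheory GRing.Theory Num.Theory.
Import numFieldNormedType.Exports Defs.
Local Open Scope classical_set_scope.
Local Open Scope ring_scope.

(** * Signed counts of crossings *)

(** [linking_number] speaks only of sufficiently fine inscribed polygons and regular projections, so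
    G and H need opposite facts. For G the number must be shown to exist: only then does the
    hypothesis force the count of one sampled polygon to vanish. For H it must be shown to be
    unique, and this requires exhibiting arbitrarily fine subdivisions and a regular direction.

    All edges of H at a vertex meet in one point, which is why every walk passes through a root of
    its class.

    The polygons traced by the walks are not embedded, since walks share arcs of the Hamiltonian
    cycles; hence the perturbation. Linking involves only cycles without a common class, whose arcs
    in G are at least 20 r apart. Sampling costs r and the perturbation another r, so every segment
    stays within 2 r of a point of an arc of G. Segments then have diameter below 4 r, and 20 r - 4
    r exceeds the 8 r required when curves are compared at scale 4 r. *)

Section AffineOnLine.
Variables (R : realType) (I : finType).
Implicit Types p q : I -> R.

Definition feasible p q (t : R) : Prop := forall j, 0 <= p j + q j * t.

Definition face p q i : Prop := exists2 t, feasible p q t & p i + q i * t = 0.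

(** The lower end of the feasible set is the largest zero [- p i / q i] over the increasing
    functions; the other functions only gain on the way down from a feasible point. An increasing
    function that vanishes at a feasible point must vanish at this end, and [gen] allows only one to
    do so. *)
Lemma lower_faces p q t :
  (forall t, feasible p q t -> forall i j,
     p i + q i * t = 0 -> p j + q j * t = 0 -> i = j) ->
  (exists i, 0 < q i) -> feasible p q t ->
  \sum_(i | 0 < q i) (`[< face p q i >] : nat)%:Z = 1.
Proof.
move=> gen [i1 qi1] ft.
pose i0 := [arg max_(i > i1 | 0 < q i) (- p i / q i)]%O.
have [qi0 i0max] : 0 < q i0 /\ forall j, 0 < q j -> - p j / q j <= - p i0 / q i0.
  by rewrite /i0; case: arg_maxP => // i qi imax; split.
pose t0 := - p i0 / q i0.
have w0 : p i0 + q i0 * t0 = 0 by rewrite /t0; field; lra.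
have t0t : t0 <= t.
  have := ft i0; rewrite /t0 ler_pdivrMr //; lra.
have ft0 : feasible p q t0.
  move=> j; have [qj|qj] := ltP 0 (q j).
    have := i0max j qj; rewrite -/t0 ler_pdivrMr //; lra.
  have := ft j; nra.
rewrite (bigD1 i0) //= big1 ?addr0; first by case: asboolP => // -[]; exists t0.
move=> i /andP[qi /negP ii0]; case: asboolP => // -[t1 ft1 wi]; case: ii0.
have t10 : t1 = t0.
  apply/eqP; rewrite eq_le; apply/andP; split.
    have := i0max i qi; rewrite -/t0 ler_pdivrMr // => h.
    have : q i * (t1 - t0) <= 0 by lra.
    by rewrite pmulr_rle0 // subr_le0.
  have := ft1 i0; have : p i0 = - q i0 * t0 by lra.
  move=> -> h; have : 0 <= q i0 * (t1 - t0) by lra.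
  by rewrite pmulr_rge0 // subr_ge0.
by apply/eqP; apply: (gen t0) => //; rewrite -t10.
Qed.

(* The feasible set is empty or a segment, whose two ends lie on one face each
   and count with opposite signs. *)
Lemma faces_cancel p q :
  (forall t, feasible p q t -> forall i j,
     p i + q i * t = 0 -> p j + q j * t = 0 -> i = j) ->
  (exists i, 0 < q i) -> (exists i, q i < 0) ->
  \sum_i sgz (q i) * (`[< face p q i >] : nat)%:Z = 0.
Proof.
move=> gen pos neg.
have [[t ft]|nof] := pselect (exists t, feasible p q t); last first.
  rewrite big1 // => i _; case: asboolP => [[t ft _]|]; last by rewrite mulr0.
  by case: nof; exists t.
have e1 := lower_faces gen pos ft.
(* Reversing the line turns its upper end into a lower end. *)
have fN s : feasible p (fun i => - q i) s <-> feasible p q (- s).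
  by split=> h j; have := h j; rewrite mulrN mulNr.
have faceN i : face p (fun i => - q i) i <-> face p q i.
  split=> -[s fs ws]; exists (- s); rewrite ?mulrN ?mulNr ?opprK //.
  - exact/fN.
  - by rewrite -mulNr.
  - by apply/fN; rewrite opprK.
have e2 : \sum_(i | q i < 0) (`[< face p q i >] : nat)%:Z = 1.
  have := @lower_faces p (fun i => - q i) (- t).
  under eq_bigl do rewrite oppr_gt0.
  under eq_bigr => i _ do rewrite (asbool_equiv_eq (faceN i)).
  apply.
  - move=> s /fN fs i j; rewrite !mulNr -!mulrN; exact: gen.
  - by case: neg => i qi; exists i; rewrite oppr_gt0.
  - by apply/fN; rewrite opprK.
rewrite (bigID (fun i => 0 < q i)) /= (eq_bigr (fun i => (`[< face p q i >] : nat)%:Z)); last first.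
  by move=> i qi; rewrite gtr0_sgz ?mul1r.
rewrite e1 (bigID (fun i => q i < 0)) /= addrC.
rewrite [X in _ + X + _]big1 ?addr0; last first.
  by move=> i /andP[]; rewrite -!leNgt => h1 h2; rewrite (@le_anti _ _ (q i) 0) ?h1 // sgz0 mul0r.
rewrite (eq_bigl (fun i => q i < 0)); last first.
  by move=> i; rewrite -leNgt; case: ltrgtP.
rewrite (eq_bigr (fun i => - (`[< face p q i >] : nat)%:Z)); last first.
  by move=> i qi; rewrite ltr0_sgz // mulN1r.
by rewrite sumrN e2.
Qed.
End AffineOnLine.

(** * Cramer's rule in dimension three *)

Section Det3.
Variable R : realType.
Implicit Types x y z v w : space3 R.

Definition ord3_0 : 'I_3 := @Ordinal 3 0 isT.
Definition ord3_1 : 'I_3 := @Ordinal 3 1 isT.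
Definition ord3_2 : 'I_3 := @Ordinal 3 2 isT.

Notation "x .[0]" := (x ord0 ord3_0) (at level 2, format "x .[0]").
Notation "x .[1]" := (x ord0 ord3_1) (at level 2, format "x .[1]").
Notation "x .[2]" := (x ord0 ord3_2) (at level 2, format "x .[2]").

Lemma space3P x y : x = y <-> [/\ x.[0] = y.[0], x.[1] = y.[1] & x.[2] = y.[2]].
Proof.
split=> [->//|[h0 h1 h2]]; apply/rowP => -[[|[|[|//]]] h].
- by rewrite (_ : Ordinal h = ord3_0) //; apply: val_inj.
- by rewrite (_ : Ordinal h = ord3_1) //; apply: val_inj.
- by rewrite (_ : Ordinal h = ord3_2) //; apply: val_inj.
Qed.

Lemma det_mx33 (f : nat -> nat -> R) :
  \det (\matrix_(i < 3, j < 3) f i j) =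
  f 0%N 0%N * (f 1%N 1%N * f 2%N 2%N - f 1%N 2%N * f 2%N 1%N)
  - f 0%N 1%N * (f 1%N 0%N * f 2%N 2%N - f 1%N 2%N * f 2%N 0%N)
  + f 0%N 2%N * (f 1%N 0%N * f 2%N 1%N - f 1%N 1%N * f 2%N 0%N).
Proof.
rewrite (expand_det_row _ ord0) !big_ord_recl big_ord0 /cofactor.
rewrite !(expand_det_row _ ord0) !big_ord_recl !big_ord0 /cofactor !det_mx11.
by rewrite !mxE /= /bump /= !expr0 !expr1 ?expr2; ring.
Qed.

Lemma det3E x y z : det3 x y z =
  x.[0] * (y.[1] * z.[2] - y.[2] * z.[1])
  - x.[1] * (y.[0] * z.[2] - y.[2] * z.[0])
  + x.[2] * (y.[0] * z.[1] - y.[1] * z.[0]).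
Proof.
pose f (i j : nat) : R :=
  if i == 0%N then x ord0 (inord j) else if i == 1%N then y ord0 (inord j)
  else z ord0 (inord j).
have e0 : inord 0 = ord3_0 by apply: val_inj; rewrite /= inordK.
have e1 : inord 1 = ord3_1 by apply: val_inj; rewrite /= inordK.
have e2 : inord 2 = ord3_2 by apply: val_inj; rewrite /= inordK.
rewrite /det3.
have -> : col_mx x (col_mx y z) = \matrix_(i < 3, j < 3) f i j :> 'M[R]_(1 + (1 + 1), 3).
  apply/matrixP => i j; rewrite mxE [RHS]mxE /f inord_val.
  case: splitP => k /= ->; first by rewrite ord1.
  by rewrite mxE; case: splitP => k' /= ->; rewrite ord1.
by rewrite det_mx33 /f /= e0 e1 e2.
Qed.

(** Each coordinate is the expansion of a 4 x 4 determinant in which one coordinate occurs twice. *)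
Lemma det3_kernel v1 v2 v3 v4 :
  det3 v2 v3 v4 *: v1 - det3 v1 v3 v4 *: v2 + det3 v1 v2 v4 *: v3
  - det3 v1 v2 v3 *: v4 = 0.
Proof. by apply/space3P; split; rewrite !det3E !mxE; ring. Qed.

Lemma det3_span v1 v2 v3 w : det3 v1 v2 v3 != 0 ->
  exists a b c, w = a *: v1 + b *: v2 + c *: v3.
Proof.
move=> d0; have /eqP := det3_kernel v1 v2 v3 w.
rewrite subr_eq0 => /eqP e.
exists (det3 v2 v3 w / det3 v1 v2 v3), (- det3 v1 v3 w / det3 v1 v2 v3),
  (det3 v1 v2 w / det3 v1 v2 v3).
apply: (scalerI d0); rewrite -e !scalerDr !scalerA -scaleNr.
by congr (_ *: _ + _ *: _ + _ *: _); field.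
Qed.

Lemma det3_free v1 v2 v3 a b c : det3 v1 v2 v3 != 0 ->
  a *: v1 + b *: v2 + c *: v3 = 0 -> [/\ a = 0, b = 0 & c = 0].
Proof.
move=> d0 /space3P[]; rewrite !mxE => e0 e1 e2.
have ha : a * det3 v1 v2 v3 = 0.
  transitivity (det3 (a *: v1 + b *: v2 + c *: v3) v2 v3).
    by rewrite !det3E !mxE; ring.
  by rewrite !det3E !mxE e0 e1 e2; ring.
have hb : b * det3 v1 v2 v3 = 0.
  transitivity (det3 v1 (a *: v1 + b *: v2 + c *: v3) v3).
    by rewrite !det3E !mxE; ring.
  by rewrite !det3E !mxE e0 e1 e2; ring.
have hc : c * det3 v1 v2 v3 = 0.
  transitivity (det3 v1 v2 (a *: v1 + b *: v2 + c *: v3)).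
    by rewrite !det3E !mxE; ring.
  by rewrite !det3E !mxE e0 e1 e2; ring.
by split; apply/eqP; rewrite -(mulIr_eq0 _ (mulIf d0)) ?ha ?hb ?hc.
Qed.

(* The solutions z of z1 v1 + z2 v2 + z3 v3 + z4 v4 = w form a line directed by
   the vector of signed 3 x 3 minors, when that vector is nonzero. *)
Lemma minors_line v1 v2 v3 v4 w :
  let q1 := det3 v2 v3 v4 in let q2 := - det3 v1 v3 v4 in
  let q3 := det3 v1 v2 v4 in let q4 := - det3 v1 v2 v3 in
  [\/ q1 != 0, q2 != 0, q3 != 0 | q4 != 0] ->
  exists p1 p2 p3 p4 : R, forall z1 z2 z3 z4 : R,
    z1 *: v1 + z2 *: v2 + z3 *: v3 + z4 *: v4 = w <->
    exists t, [/\ z1 = p1 + q1 * t, z2 = p2 + q2 * t,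
                  z3 = p3 + q3 * t & z4 = p4 + q4 * t].
Proof.
move=> q1 q2 q3 q4 nz.
have ker : q1 *: v1 + q2 *: v2 + q3 *: v3 + q4 *: v4 = 0.
  by rewrite /q2 /q4 !scaleNr; exact: det3_kernel.
have d1 : q1 = det3 v2 v3 v4 by [].
have d2 : - q2 = det3 v1 v3 v4 by rewrite opprK.
have d3 : q3 = det3 v1 v2 v4 by [].
have d4 : - q4 = det3 v1 v2 v3 by rewrite opprK.
have [p1 [p2 [p3 [p4 ep]]]] : exists p1 p2 p3 p4 : R,
    w = p1 *: v1 + p2 *: v2 + p3 *: v3 + p4 *: v4.
  move: nz; rewrite /q1 /q2 /q3 /q4 !oppr_eq0.
  by case=> d; have [a [b [c ->]]] := det3_span w d;
    [exists 0, a, b, c | exists a, 0, b, c | exists a, b, 0, c | exists a, b, c, 0];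
    rewrite scale0r ?(add0r, addr0).
clearbody q1 q2 q3 q4.
have inj k1 k2 k3 k4 : k1 *: v1 + k2 *: v2 + k3 *: v3 + k4 *: v4 = 0 ->
    exists t, [/\ k1 = q1 * t, k2 = q2 * t, k3 = q3 * t & k4 = q4 * t].
  move=> ek.
  have comb t : (k1 - q1 * t) *: v1 + (k2 - q2 * t) *: v2 + (k3 - q3 * t) *: v3 +
      (k4 - q4 * t) *: v4 = 0.
    transitivity ((k1 *: v1 + k2 *: v2 + k3 *: v3 + k4 *: v4) -
      t *: (q1 *: v1 + q2 *: v2 + q3 *: v3 + q4 *: v4)).
      by apply/space3P; split; rewrite !mxE; ring.
    by rewrite ek ker scaler0 subr0.
  (* Subtracting the multiple of the minors that cancels a coordinate with nonzero minor leaves a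
     relation among three independent vectors. *)
  case: nz => qi.
  - exists (k1 / q1); move: (comb (k1 / q1)).
    rewrite (_ : k1 - _ = 0) ?scale0r ?add0r; last by field.
    rewrite d1 in qi; move/(det3_free qi) => [*]; rewrite -d1 in qi.
    by split; [field|lra|lra|lra].
  - exists (k2 / q2); move: (comb (k2 / q2)).
    rewrite (_ : k2 - _ = 0) ?scale0r ?addr0; last by field.
    move: (qi); rewrite -oppr_eq0 d2 => d /(det3_free d) [*].
    by split; [lra|field|lra|lra].
  - exists (k3 / q3); move: (comb (k3 / q3)).
    rewrite (_ : k3 - _ = 0) ?scale0r ?addr0; last by field.
    rewrite d3 in qi; move/(det3_free qi) => [*]; rewrite -d3 in qi.
    by split; [lra|lra|field|lra].
  - exists (k4 / q4); move: (comb (k4 / q4)).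
    rewrite (_ : k4 - _ = 0) ?scale0r ?addr0; last by field.
    move: (qi); rewrite -oppr_eq0 d4 => d /(det3_free d) [*].
    by split; [lra|lra|lra|field].
exists p1, p2, p3, p4 => z1 z2 z3 z4; split.
  move=> ez; have /inj[t [*]] : (z1 - p1) *: v1 + (z2 - p2) *: v2 + (z3 - p3) *: v3 +
      (z4 - p4) *: v4 = 0.
    rewrite -(subrr w) -{1}ez ep; apply/space3P; split; rewrite !mxE; ring.
  by exists t; split; lra.
move=> [t [-> -> -> ->]]; rewrite ep.
transitivity ((p1 *: v1 + p2 *: v2 + p3 *: v3 + p4 *: v4) +
  t *: (q1 *: v1 + q2 *: v2 + q3 *: v3 + q4 *: v4)).
  by apply/space3P; split; rewrite !mxE; ring.
by rewrite ker scaler0 addr0.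
Qed.
End Det3.

Section Degree.
Variable R : realType.
Implicit Types v w : space3 R.

(** The affine functions [W i], with linear parts [L i], cut out a polytope in the space of the
    unknowns. Restricting them to the solution line, directed by the minors, gives the situation of
    [faces_cancel]: the second hypothesis makes the line leave the polytope on both sides, the third
    keeps solutions off the intersections of faces. If all minors vanish, so do all the weights. *)
Lemma sum_faces_eq0 (I : finType) (W L : I -> R -> R -> R -> R -> R) v1 v2 v3 v4 w :
  (forall i p1 p2 p3 p4 q1 q2 q3 q4 t,
     W i (p1 + q1 * t) (p2 + q2 * t) (p3 + q3 * t) (p4 + q4 * t) =
     W i p1 p2 p3 p4 + L i q1 q2 q3 q4 * t) ->
  (forall q1 q2 q3 q4 : R, q1 *: v1 + q2 *: v2 + q3 *: v3 + q4 *: v4 = 0 ->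
     [\/ q1 != 0, q2 != 0, q3 != 0 | q4 != 0] ->
     (exists i, 0 < L i q1 q2 q3 q4) /\ (exists i, L i q1 q2 q3 q4 < 0)) ->
  (forall z1 z2 z3 z4 : R, z1 *: v1 + z2 *: v2 + z3 *: v3 + z4 *: v4 = w ->
     (forall j, 0 <= W j z1 z2 z3 z4) ->
     forall i j, W i z1 z2 z3 z4 = 0 -> W j z1 z2 z3 z4 = 0 -> i = j) ->
  \sum_i sgz (L i (det3 v2 v3 v4) (- det3 v1 v3 v4) (det3 v1 v2 v4) (- det3 v1 v2 v3)) *
    (`[< exists z1 z2 z3 z4, [/\ z1 *: v1 + z2 *: v2 + z3 *: v3 + z4 *: v4 = w,
          forall j, 0 <= W j z1 z2 z3 z4 & W i z1 z2 z3 z4 = 0] >] : nat)%:Z = 0.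
Proof.
move=> aff bnd gen.
have := @minors_line R v1 v2 v3 v4 w.
have := det3_kernel v1 v2 v3 v4; rewrite -!scaleNr.
move: (det3 v2 v3 v4) (- det3 v1 v3 v4) (det3 v1 v2 v4) (- det3 v1 v2 v3).
move=> q1 q2 q3 q4 ker /=.
have [nz|z0] := pselect ([\/ q1 != 0, q2 != 0, q3 != 0 | q4 != 0]); last first.
  move=> _; rewrite big1 // => i _.
  have [-> -> -> ->] : [/\ q1 = 0, q2 = 0, q3 = 0 & q4 = 0].
    by split; apply/eqP/negPn/negP => h; apply: z0;
      first [exact: Or41|exact: Or42|exact: Or43|exact: Or44].
  have := aff i 0 0 0 0 0 0 0 0 1; rewrite !mul0r !addr0 mulr1.
  move=> e; have -> : L i 0 0 0 0 = 0 by lra.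
  by rewrite sgz0 mul0r.
move=> /(_ nz) [p1 [p2 [p3 [p4 line]]]].
have [pos neg] := bnd _ _ _ _ ker nz.
have key := @faces_cancel R I (fun i => W i p1 p2 p3 p4) (fun i => L i q1 q2 q3 q4).
rewrite -[RHS]key //.
  apply: eq_bigr => i _; congr (_ * (nat_of_bool _)%:Z); apply: asbool_equiv_eq; split.
    move=> [z1 [z2 [z3 [z4 [/line[t [-> -> -> ->]] fz wz]]]]]; exists t.
      by move=> j; have := fz j; rewrite aff.
    by rewrite -aff.
  move=> [t ft wt]; exists (p1 + q1 * t), (p2 + q2 * t), (p3 + q3 * t), (p4 + q4 * t).
  split; first by apply/line; exists t.
    by move=> j; rewrite aff; exact: ft.
  by rewrite aff.
move=> t ft i j; rewrite -!aff; apply: gen.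
  by apply/line; exists t.
by move=> k; rewrite aff; exact: ft.
Qed.
End Degree.

(** * Dependence of the crossing count on the direction of projection *)

Section Local.
Variable R : realType.
Notation V := (space3 R).
Implicit Types (u v w x y a b : V) (e f : V * V).

(* Only the crossings in which e is the overstrand are counted: the crossing sum
   in direction u is the sum of these counts for u and for - u. *)
Definition over u e f : int := if `[< passes_over u e f >] then crossing_sign u e f else 0.

Definition seg_regular u e f : Prop := forall t l : R, 0 <= t <= 1 ->
  [/\ e.1 <> on_segment f t + l *: u, e.2 <> on_segment f t + l *: u,
      f.1 <> on_segment e t + l *: u & f.2 <> on_segment e t + l *: u].

Definition seg_disjoint e f : Prop := forall s t : R, 0 <= s <= 1 -> 0 <= t <= 1 ->
  on_segment e s <> on_segment f t.

Lemma overE u e f : over u e f =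
  sgz (det3 (e.2 - e.1) (f.2 - f.1) u) * (`[< passes_over u e f >] : nat)%:Z.
Proof. by rewrite /over /crossing_sign; case: asboolP => _; rewrite ?mulr1 ?mulr0. Qed.

Lemma on_segment0 e : on_segment e 0 = e.1.
Proof. by rewrite /on_segment subr0 scale1r scale0r addr0. Qed.

Lemma on_segment1 e : on_segment e 1 = e.2.
Proof. by rewrite /on_segment subrr scale1r scale0r add0r. Qed.

(** Signed incidence of a point with the region swept by f along the cone of u and u'. It involves
    one end of the other segment only, so it telescopes along a closed chain. *)
Definition cone_face u u' x f : int :=
  sgz (det3 (f.2 - f.1) u u') *
  (`[< exists t l l' : R, [/\ 0 <= t <= 1, 0 <= l, 0 <= l' &
         x = on_segment f t + l *: u + l' *: u'] >] : nat)%:Z.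

Lemma det3N1 v1 v2 v3 : det3 (- v1) v2 v3 = - det3 v1 v2 v3.
Proof. by rewrite !det3E !mxE; ring. Qed.
Lemma det3N2 v1 v2 v3 : det3 v1 (- v2) v3 = - det3 v1 v2 v3.
Proof. by rewrite !det3E !mxE; ring. Qed.
Lemma det3N3 v1 v2 v3 : det3 v1 v2 (- v3) = - det3 v1 v2 v3.
Proof. by rewrite !det3E !mxE; ring. Qed.

Lemma balance6 (p1 p2 p3 p4 p5 p6 : int) :
  - p1 + (p2 + (- p3 + (p4 + (p5 - p6)))) = 0 -> p5 - p6 = p1 - p2 + (p3 - p4).
Proof. lia. Qed.

(* The points (s, t, l, l') with e(s) = f(t) + l u + l' u' form a segment in
   [0, 1]^2 x R+^2, with one end on each of two faces. *)
Lemma over_change u u' e f :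
  seg_disjoint e f -> seg_regular u e f -> seg_regular u' e f ->
  det3 (e.1 - f.1) u u' != 0 -> det3 (e.1 - f.2) u u' != 0 ->
  det3 (e.2 - f.1) u u' != 0 -> det3 (e.2 - f.2) u u' != 0 ->
  over u' e f - over u e f =
    (cone_face u u' e.1 f - cone_face u u' e.2 f) +
    (cone_face (- u) (- u') f.1 e - cone_face (- u) (- u') f.2 e).
Proof.
move=> disj reg reg' d11 d12 d21 d22.
(* The faces of s and t give the four cone terms; the faces of l and l' give the crossings in
   directions u' and u. *)
pose W (i : 'I_6) (s t l l' : R) := nth 0 [:: s; 1 - s; t; 1 - t; l; l'] i.
pose L (i : 'I_6) (s t l l' : R) := nth 0 [:: s; - s; t; - t; l; l'] i.
pose v1 := e.2 - e.1; pose v2 := - (f.2 - f.1).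
have solE (s t l l' : R) : s *: v1 + t *: v2 + l *: (- u) + l' *: (- u') = f.1 - e.1 <->
    on_segment e s = on_segment f t + l *: u + l' *: u'.
  rewrite /v1 /v2 /on_segment; split=> /space3P[]; rewrite !mxE => h0 h1 h2;
  by apply/space3P; split; rewrite !mxE; lra.
have solW (s t l l' : R) : (forall j, 0 <= W j s t l l') <->
    [/\ 0 <= s <= 1, 0 <= t <= 1, 0 <= l & 0 <= l'].
  split=> [h|[h1 h2 h3 h4] [[|[|[|[|[|[|//]]]]]]] h]; rewrite /W /=; try lra.
  have := h (@Ordinal 6 0 isT); have := h (@Ordinal 6 1 isT).
  have := h (@Ordinal 6 2 isT); have := h (@Ordinal 6 3 isT).
  have := h (@Ordinal 6 4 isT); have := h (@Ordinal 6 5 isT).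
  by rewrite /W /= => *; split; lra.
have cone0 x y (l l' : R) : det3 (x - y) u u' != 0 -> x <> y + l *: u + l' *: u'.
  by move=> /eqP d ev; apply: d; rewrite ev !det3E !mxE; ring.
(* No solution lies on two faces: two ends are excluded by the determinants, an end with l or l'
   zero by regularity, and l = l' = 0 by disjointness. *)
have corner (s t l l' : R) : 0 <= s <= 1 -> 0 <= t <= 1 ->
    on_segment e s = on_segment f t + l *: u + l' *: u' ->
    [/\ s * (1 - s) = 0 -> t * (1 - t) = 0 -> False,
        s * (1 - s) = 0 -> l * l' = 0 -> False,
        t * (1 - t) = 0 -> l * l' = 0 -> False & l = 0 -> l' = 0 -> False].
  move=> hs ht.
  have prod0 (a b : R) : a * b = 0 -> a = 0 \/ b = 0.
    by move/eqP; rewrite mulf_eq0 => /orP[] /eqP; auto.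
  have one (a : R) : 1 - a = 0 -> a = 1 by move=> ?; lra.
  have flip a b v (k : R) : a = b + k *: v -> b = a + (- k) *: v.
    by move=> ->; rewrite scaleNr addrK.
  move=> est; split.
  - by move=> /prod0[|/one] es /prod0[|/one] et; move: est;
      rewrite es et ?on_segment0 ?on_segment1; apply: cone0.
  - by move=> /prod0[|/one] es /prod0[] el; move: est;
      rewrite es el ?on_segment0 ?on_segment1 scale0r addr0;
      [have [] := reg' t l' ht|have [] := reg t l ht
      |have [] := reg' t l' ht|have [] := reg t l ht].
  - by move=> /prod0[|/one] et /prod0[] el; move: est;
      rewrite et el ?on_segment0 ?on_segment1 scale0r addr0 => /flip;
      [have [] := reg' s (- l') hs|have [] := reg s (- l) hs
      |have [] := reg' s (- l') hs|have [] := reg s (- l) hs].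
  - by move=> l0 l0'; move: est; rewrite l0 l0' !scale0r !addr0; apply: disj.
have aff (i : 'I_6) (p1 p2 p3 p4 q1 q2 q3 q4 t : R) :
    W i (p1 + q1 * t) (p2 + q2 * t) (p3 + q3 * t) (p4 + q4 * t) =
    W i p1 p2 p3 p4 + L i q1 q2 q3 q4 * t.
  by case: i => -[|[|[|[|[|[|//]]]]]] h; rewrite /W /L /=; ring.
have bnd (q1 q2 q3 q4 : R) : q1 *: v1 + q2 *: v2 + q3 *: (- u) + q4 *: (- u') = 0 ->
    [\/ q1 != 0, q2 != 0, q3 != 0 | q4 != 0] ->
    (exists i, 0 < L i q1 q2 q3 q4) /\ (exists i, L i q1 q2 q3 q4 < 0).
  move=> ker nz.
  have [q1p|q1n|q10] := ltrgtP q1 0.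
  - by split; [exists (@Ordinal 6 1 isT)|exists (@Ordinal 6 0 isT)]; rewrite /L /= ?oppr_gt0.
  - by split; [exists (@Ordinal 6 0 isT)|exists (@Ordinal 6 1 isT)]; rewrite /L /= ?oppr_lt0.
  have [q2p|q2n|q20] := ltrgtP q2 0.
  - by split; [exists (@Ordinal 6 3 isT)|exists (@Ordinal 6 2 isT)]; rewrite /L /= ?oppr_gt0.
  - by split; [exists (@Ordinal 6 2 isT)|exists (@Ordinal 6 3 isT)]; rewrite /L /= ?oppr_lt0.
  (* A kernel vector that fixes s and t would make u and u' dependent, against [d11]. *)
  have [] := @det3_free R _ _ _ 0 (- q3) (- q4) d11.
    by rewrite -[RHS]ker q10 q20 !scale0r !scalerN !scaleNr !add0r.
  move=> _ q30 q40; case: nz; rewrite ?q10 ?q20 ?eqxx //.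
    by move/eqP; case; lra.
  by move/eqP; case; lra.
have gen (s t l l' : R) : s *: v1 + t *: v2 + l *: (- u) + l' *: (- u') = f.1 - e.1 ->
    (forall j, 0 <= W j s t l l') -> forall i j, W i s t l l' = 0 -> W j s t l l' = 0 -> i = j.
  move=> /solE est /solW[hs ht _ _].
  have [c1 c2 c3 c4] := corner _ _ _ _ hs ht est.
  by case=> [[|[|[|[|[|[|//]]]]]] hi] [[|[|[|[|[|[|//]]]]]] hj]; rewrite /W /= => e1 e2;
    first [exact: val_inj | exfalso; clear -e1 e2; lra
    | exfalso; apply: c1; rewrite ?e1 ?e2 ?mul0r ?mulr0 //; fail
    | exfalso; apply: c2; rewrite ?e1 ?e2 ?mul0r ?mulr0 //; fail
    | exfalso; apply: c3; rewrite ?e1 ?e2 ?mul0r ?mulr0 //; fail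
    | exfalso; apply: c4; rewrite ?e1 ?e2 ?mul0r ?mulr0 //; fail].
have := sum_faces_eq0 aff bnd gen.
pose F i := exists s t l l' : R, [/\ s *: v1 + t *: v2 + l *: (- u) + l' *: (- u') = f.1 - e.1,
  forall j, 0 <= W j s t l l' & W i s t l l' = 0].
rewrite (eq_bigr (fun i => sgz (L i (det3 v2 (- u) (- u')) (- det3 v1 (- u) (- u'))
   (det3 v1 v2 (- u')) (- det3 v1 v2 (- u))) * (`[< F i >] : nat)%:Z)) //.
rewrite !big_ord_recl big_ord0 addr0 /L /= => key.
have FP i : F i <-> exists s t l l' : R, [/\ on_segment e s = on_segment f t + l *: u + l' *: u',
    [/\ 0 <= s <= 1, 0 <= t <= 1, 0 <= l & 0 <= l'] & W i s t l l' = 0].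
  split=> -[s [t [l [l' [h1 h2 h3]]]]]; exists s, t, l, l'.
    by split=> //; [apply/solE|apply/solW].
  by split=> //; [apply/solE|apply/solW].
have flip2 x y (l l' : R) : x = y + l *: u + l' *: u' <-> y = x + l *: (- u) + l' *: (- u').
  by split=> ->; rewrite !scalerN; apply/space3P; split; rewrite !mxE; ring.
have sE (a : R) : 1 - a = 0 -> a = 1 by move=> ?; lra.
have strict (a : R) : 0 <= a <= 1 -> a * (1 - a) <> 0 -> 0 < a < 1.
  move=> /andP[a0 a1] /eqP; rewrite mulf_eq0 negb_or subr_eq0 => /andP[a0' a1'].
  by rewrite !lt_neqAle a0 a1 eq_sym a0' eq_sym a1'.
have weak (a : R) : 0 < a < 1 -> 0 <= a <= 1 by lra.
have F0 : `[< F ord0 >] = `[< exists t l l' : R, [/\ 0 <= t <= 1, 0 <= l, 0 <= l' &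
    e.1 = on_segment f t + l *: u + l' *: u'] >].
  apply: asbool_equiv_eq; rewrite FP; split.
    move=> [s [t [l [l' [h1 [hs ht hl hl'] h3]]]]]; exists t, l, l'; split=> //.
    by rewrite -h1 [s]h3 on_segment0.
  move=> [t [l [l' [ht hl hl' h]]]]; exists 0, t, l, l'; rewrite on_segment0.
  by split=> //; split=> //; rewrite lexx ler01.
have F1 : `[< F (lift ord0 ord0) >] = `[< exists t l l' : R, [/\ 0 <= t <= 1, 0 <= l, 0 <= l' &
    e.2 = on_segment f t + l *: u + l' *: u'] >].
  apply: asbool_equiv_eq; rewrite FP; split.
    move=> [s [t [l [l' [h1 [hs ht hl hl'] h3]]]]]; exists t, l, l'; split=> //.
    by rewrite -h1 (sE _ h3) on_segment1.
  move=> [t [l [l' [ht hl hl' h]]]]; exists 1, t, l, l'; rewrite on_segment1.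
  by split=> //; [split=> //; rewrite lexx ler01|exact: subrr].
have F2 : `[< F (lift ord0 (lift ord0 ord0)) >] = `[< exists t l l' : R, [/\ 0 <= t <= 1, 0 <= l, 0 <= l' &
    f.1 = on_segment e t + l *: (- u) + l' *: (- u')] >].
  apply: asbool_equiv_eq; rewrite FP; split.
    move=> [s [t [l [l' [h1 [hs ht hl hl'] h3]]]]]; exists s, l, l'; split=> //.
    by apply/flip2; rewrite h1 [t]h3 on_segment0.
  move=> [s [l [l' [ht hl hl' /flip2 h]]]]; exists s, 0, l, l'; rewrite on_segment0.
  by split=> //; split=> //; rewrite lexx ler01.
have F3 : `[< F (lift ord0 (lift ord0 (lift ord0 ord0))) >] = `[< exists t l l' : R, [/\ 0 <= t <= 1, 0 <= l, 0 <= l' &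
    f.2 = on_segment e t + l *: (- u) + l' *: (- u')] >].
  apply: asbool_equiv_eq; rewrite FP; split.
    move=> [s [t [l [l' [h1 [hs ht hl hl'] h3]]]]]; exists s, l, l'; split=> //.
    by apply/flip2; rewrite h1 (sE _ h3) on_segment1.
  move=> [s [l [l' [ht hl hl' /flip2 h]]]]; exists s, 1, l, l'; rewrite on_segment1.
  by split=> //; [split=> //; rewrite lexx ler01|exact: subrr].
(* On this face only u' remains, and [corner] turns the weak inequalities into the strict ones of
   [passes_over]. *)
have F4 : `[< F (lift ord0 (lift ord0 (lift ord0 (lift ord0 ord0)))) >] = `[< passes_over u' e f >].
  apply: asbool_equiv_eq; rewrite FP; split.
    move=> [s [t [l [l' [h1 [hs ht hl hl'] h3]]]]].
    have [c1 c2 c3 c4] := corner _ _ _ _ hs ht h1.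
    rewrite /W /= in h3; subst l; exists s, t, l'; split; [| | |by rewrite h1 scale0r addr0].
    - by apply: strict => // /c2; rewrite mul0r; apply.
    - by apply: strict => // /c3; rewrite mul0r; apply.
    - by rewrite lt_neqAle hl' andbT; apply/eqP => /esym /c4; apply.
  move=> [s [t [l [hs ht hl h]]]]; exists s, t, 0, l; rewrite scale0r addr0.
  by split=> //; split=> //; [exact: weak|exact: weak|exact: ltW].
have F5 : `[< F (lift ord0 (lift ord0 (lift ord0 (lift ord0 (lift ord0 ord0))))) >] = `[< passes_over u e f >].
  apply: asbool_equiv_eq; rewrite FP; split.
    move=> [s [t [l [l' [h1 [hs ht hl hl'] h3]]]]].
    have [c1 c2 c3 c4] := corner _ _ _ _ hs ht h1.
    rewrite /W /= in h3; subst l'; exists s, t, l; split; [| | |by rewrite h1 scale0r addr0].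
    - by apply: strict => // /c2; rewrite mulr0; apply.
    - by apply: strict => // /c3; rewrite mulr0; apply.
    - by rewrite lt_neqAle hl andbT; apply/eqP => /esym /c4; apply.
  move=> [s [t [l [hs ht hl h]]]]; exists s, t, l, 0; rewrite scale0r addr0.
  by split=> //; split=> //; [exact: weak|exact: weak|exact: ltW].
move: key; rewrite F0 F1 F2 F3 F4 F5 !overE /cone_face /v2 !(det3N1, det3N2, det3N3) ?opprK.
rewrite !sgzN -/v1 !mulNr.
exact: balance6.
Qed.
End Local.

(** * Crossings with the boundary of a triangle *)

Section Triangle.
Variable R : realType.
Notation V := (space3 R).
Implicit Types (u v w x y a b : V) (e f : V * V).

Definition triangle_point a x b (s t : R) : V := a + s *: (x - a) + t *: (b - a).

Definition triangle_disjoint a x b f : Prop := forall s t r : R,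
  0 <= s -> 0 <= t -> s + t <= 1 -> 0 <= r <= 1 ->
  triangle_point a x b s t <> on_segment f r.

(** Signed incidence of the triangle with the ray from y along u. It depends on one end of f, and so
    telescopes over a closed chain. *)
Definition triangle_face u a x b y : int :=
  sgz (det3 (x - a) (b - a) u) *
  (`[< exists s t l : R, [/\ 0 <= s, 0 <= t, s + t <= 1, 0 <= l &
         triangle_point a x b s t = y + l *: u] >] : nat)%:Z.

Lemma balance5 (p1 p2 p3 p4 p5 : int) :
  - p1 + (p2 + (- p3 + (- p4 + (p5 + 0)))) = 0 -> p3 + p1 + - p2 = p5 - p4.
Proof. lia. Qed.

(* Same argument as over_change, for the points of the triangle, of f and of the
   ray of u: the face where f meets the triangle is empty. *)
Lemma over_triangle u a x b f : u != 0 -> triangle_disjoint a x b f ->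
  seg_regular u (a, x) f -> seg_regular u (x, b) f -> seg_regular u (b, a) f ->
  over u (a, x) f + over u (x, b) f + over u (b, a) f =
  triangle_face u a x b f.2 - triangle_face u a x b f.1.
Proof.
move=> u0 disj rax rxb rba.
(* Three barycentric coordinates for the sides of the triangle, two inequalities for the ends of f,
   one for the ray. *)
pose W (i : 'I_6) (s t r l : R) := nth 0 [:: 1 - s - t; s; t; r; 1 - r; l] i.
pose L (i : 'I_6) (s t r l : R) := nth 0 [:: - s - t; s; t; r; - r; l] i.
pose v1 := x - a; pose v2 := b - a; pose v3 := - (f.2 - f.1).
have solE (s t r l : R) : s *: v1 + t *: v2 + r *: v3 + l *: (- u) = f.1 - a <->
    triangle_point a x b s t = on_segment f r + l *: u.
  rewrite /v1 /v2 /v3 /on_segment /triangle_point; split=> /space3P[]; rewrite !mxE => h0 h1 h2;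
  by apply/space3P; split; rewrite !mxE; lra.
have solW (s t r l : R) : (forall j, 0 <= W j s t r l) <->
    [/\ 0 <= s, 0 <= t, s + t <= 1, 0 <= r <= 1 & 0 <= l].
  split=> [h|[h1 h2 h3 h4 h5] [[|[|[|[|[|[|//]]]]]]] h]; rewrite /W /=; try lra.
  have := h (@Ordinal 6 0 isT); have := h (@Ordinal 6 1 isT).
  have := h (@Ordinal 6 2 isT); have := h (@Ordinal 6 3 isT).
  have := h (@Ordinal 6 4 isT); have := h (@Ordinal 6 5 isT).
  by rewrite /W /= => *; split; lra.
have flip y y' v (k : R) : y = y' + k *: v -> y' = y + (- k) *: v.
  by move=> ->; rewrite scaleNr addrK.
have sE (r : R) : 1 - r = 0 -> r = 1 by move=> ?; lra.
have edge_ax (s : R) : triangle_point a x b s 0 = on_segment (a, x) s.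
  by apply/space3P; split; rewrite !mxE /=; ring.
have edge_xb (s t : R) : 1 - s - t = 0 -> triangle_point a x b s t = on_segment (x, b) t.
  by move=> h; rewrite (_ : s = 1 - t); [apply/space3P; split; rewrite !mxE /=; ring|lra].
have edge_ba (t : R) : triangle_point a x b 0 t = on_segment (b, a) (1 - t).
  by apply/space3P; split; rewrite !mxE /=; ring.
have corner (s t r l : R) : 0 <= s -> 0 <= t -> s + t <= 1 -> 0 <= r <= 1 ->
    triangle_point a x b s t = on_segment f r + l *: u ->
    [/\ l <> 0, (s = 0 -> t <> 0), (s = 0 -> 1 - s - t <> 0), (t = 0 -> 1 - s - t <> 0) &
      r * (1 - r) = 0 -> [/\ s <> 0, t <> 0 & 1 - s - t <> 0]].
  move=> hs ht hst hr est; split.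
  - by move=> l0; move: est; rewrite l0 scale0r addr0; apply: disj.
  - move=> s0 t0; move: est; rewrite s0 t0 edge_ax on_segment0.
    by have [] := rax r l hr.
  - move=> s0 /[dup] t0 /edge_xb e; move: est; rewrite e (_ : t = 1); last by lra.
    by rewrite on_segment1; have [] := rxb r l hr.
  - move=> s0 /[dup] t0 /edge_xb e; move: est; rewrite e s0.
    by rewrite on_segment0; have [] := rxb r l hr.
  - move=> /eqP; rewrite mulf_eq0 => /orP[/eqP r0|/eqP/sE r0]; move: est;
      rewrite r0 ?on_segment0 ?on_segment1 => /flip est.
    + split=> [h|h|/edge_xb h]; move: est.
      * by rewrite h edge_ba; have [] := rba (1 - t) (- l) ltac:(lra).
      * by rewrite h edge_ax; have [] := rax s (- l) ltac:(lra).
      * by rewrite h; have [] := rxb t (- l) ltac:(lra).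
    + split=> [h|h|/edge_xb h]; move: est.
      * by rewrite h edge_ba; have [] := rba (1 - t) (- l) ltac:(lra).
      * by rewrite h edge_ax; have [] := rax s (- l) ltac:(lra).
      * by rewrite h; have [] := rxb t (- l) ltac:(lra).
have aff (i : 'I_6) (p1 p2 p3 p4 q1 q2 q3 q4 t : R) :
    W i (p1 + q1 * t) (p2 + q2 * t) (p3 + q3 * t) (p4 + q4 * t) =
    W i p1 p2 p3 p4 + L i q1 q2 q3 q4 * t.
  by case: i => -[|[|[|[|[|[|//]]]]]] h; rewrite /W /L /=; ring.
have bnd (q1 q2 q3 q4 : R) : q1 *: v1 + q2 *: v2 + q3 *: v3 + q4 *: (- u) = 0 ->
    [\/ q1 != 0, q2 != 0, q3 != 0 | q4 != 0] ->
    (exists i, 0 < L i q1 q2 q3 q4) /\ (exists i, L i q1 q2 q3 q4 < 0).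
  move=> ker nz.
  pose o0 := @Ordinal 6 0 isT; pose o1 := @Ordinal 6 1 isT; pose o2 := @Ordinal 6 2 isT.
  have [q3p|q3n|q30] := ltrgtP q3 0.
  - by split; [exists (@Ordinal 6 4 isT)|exists (@Ordinal 6 3 isT)]; rewrite /L /= ?oppr_gt0.
  - by split; [exists (@Ordinal 6 3 isT)|exists (@Ordinal 6 4 isT)]; rewrite /L /= ?oppr_lt0.
  (* The slopes of the barycentric coordinates sum to 0, so both signs occur unless all of them
     vanish. *)
  have [q1p|q1n|q10] := ltrgtP q1 0.
  - split; last by exists o1.
    have [q2p|q2n] := ltP 0 q2; first by exists o2.
    by exists o0; rewrite /L /=; lra.
  - split; first by exists o1.
    have [q2p|q2n] := ltP q2 0; first by exists o2.
    by exists o0; rewrite /L /=; lra.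
  have [q2p|q2n|q20] := ltrgtP q2 0.
  - by split; [exists o0|exists o2]; rewrite /L /=; lra.
  - by split; [exists o2|exists o0]; rewrite /L /=; lra.
  move: ker; rewrite q10 q20 q30 !scale0r !add0r scalerN => /eqP.
  rewrite oppr_eq0 scaler_eq0 (negbTE u0) orbF => /eqP q40.
  by case: nz; rewrite ?q10 ?q20 ?q30 ?q40 eqxx.
have gen (s t r l : R) : s *: v1 + t *: v2 + r *: v3 + l *: (- u) = f.1 - a ->
    (forall j, 0 <= W j s t r l) -> forall i j, W i s t r l = 0 -> W j s t r l = 0 -> i = j.
  move=> /solE est /solW[hs ht hst hr _].
  have [c1 c2 c3 c4 c5] := corner _ _ _ _ hs ht hst hr est.
  have c6 : r = 0 -> [/\ s <> 0, t <> 0 & 1 - s - t <> 0].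
    by move=> r0; apply: c5; rewrite r0 mul0r.
  have c7 : 1 - r = 0 -> [/\ s <> 0, t <> 0 & 1 - s - t <> 0].
    by move=> r0; apply: c5; rewrite r0 mulr0.
  by case=> [[|[|[|[|[|[|//]]]]]] hi] [[|[|[|[|[|[|//]]]]]] hj]; rewrite /W /= => e1 e2;
    first [exact: val_inj | exfalso; clear -e1 e2; lra
      | by case: c1 | by case: (c2 e1) | by case: (c2 e2) | by case: (c3 e1)
      | by case: (c3 e2) | by case: (c4 e1) | by case: (c4 e2) | by case: (c6 e1)
      | by case: (c6 e2) | by case: (c7 e1) | by case: (c7 e2)].
have := sum_faces_eq0 aff bnd gen.
pose F i := exists s t r l : R, [/\ s *: v1 + t *: v2 + r *: v3 + l *: (- u) = f.1 - a,
  forall j, 0 <= W j s t r l & W i s t r l = 0].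
rewrite (eq_bigr (fun i => sgz (L i (det3 v2 v3 (- u)) (- det3 v1 v3 (- u))
   (det3 v1 v2 (- u)) (- det3 v1 v2 v3)) * (`[< F i >] : nat)%:Z)) //.
rewrite !big_ord_recl big_ord0 addr0 /L /= => key.
have FP i : F i <-> exists s t r l : R, [/\ triangle_point a x b s t = on_segment f r + l *: u,
    [/\ 0 <= s, 0 <= t, s + t <= 1, 0 <= r <= 1 & 0 <= l] & W i s t r l = 0].
  by split=> -[s [t [r [l [h1 h2 h3]]]]]; exists s, t, r, l;
    split=> //; first [exact/solE|exact/solW].
have strict (r : R) : 0 <= r <= 1 -> r * (1 - r) <> 0 -> 0 < r < 1.
  move=> /andP[a0 a1] /eqP; rewrite mulf_eq0 negb_or subr_eq0 => /andP[a0' a1'].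
  by rewrite !lt_neqAle a0 a1 eq_sym a0' eq_sym a1'.
have pos (r : R) : 0 <= r -> r <> 0 -> 0 < r.
  by move=> r0 /eqP r0'; rewrite lt_neqAle eq_sym r0'.
have F0 : `[< F ord0 >] = `[< passes_over u (x, b) f >].
  apply: asbool_equiv_eq; rewrite FP; split.
    move=> [s [t [r [l [h1 [hs ht hst hr hl] h3]]]]]; have h3' : 1 - s - t = 0 := h3.
    have [c1 c2 c3 c4 c5] := corner _ _ _ _ hs ht hst hr h1.
    exists t, r, l; split; [|apply: strict => // /c5[]; tauto|exact: pos|by rewrite -h1 edge_xb].
    have : 0 < s by apply: pos => // /c3.
    have : 0 < t by apply: pos => // /c4.
    by lra.
  move=> [t [r [l [ht hr hl h]]]]; exists (1 - t), t, r, l.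
  by rewrite edge_xb ?h; [split=> //; [split; lra|rewrite /W /=; ring]|ring].
have F1 : `[< F (lift ord0 ord0) >] = `[< passes_over u (b, a) f >].
  apply: asbool_equiv_eq; rewrite FP; split.
    move=> [s [t [r [l [h1 [hs ht hst hr hl] h3]]]]]; have h3' : s = 0 := h3.
    have [c1 c2 c3 c4 c5] := corner _ _ _ _ hs ht hst hr h1.
    exists (1 - t), r, l; split; [|apply: strict => // /c5[]; tauto|exact: pos|by rewrite -h1 h3' edge_ba].
    have : 0 < t by apply: pos => // /c2; apply.
    have : 0 < 1 - s - t by apply: pos; [lra|exact: c3].
    by lra.
  move=> [t [r [l [ht hr hl h]]]]; exists 0, (1 - t), r, l.
  by rewrite edge_ba subKr h; split=> //; split; lra.
have F2 : `[< F (lift ord0 (lift ord0 ord0)) >] = `[< passes_over u (a, x) f >].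
  apply: asbool_equiv_eq; rewrite FP; split.
    move=> [s [t [r [l [h1 [hs ht hst hr hl] h3]]]]]; have h3' : t = 0 := h3.
    have [c1 c2 c3 c4 c5] := corner _ _ _ _ hs ht hst hr h1.
    exists s, r, l; split; [|apply: strict => // /c5[]; tauto|exact: pos|by rewrite -h1 h3' edge_ax].
    have : 0 < s by apply: pos => // /c2.
    have : 0 < 1 - s - t by apply: pos; [lra|exact: c4].
    by lra.
  move=> [s [r [l [ht hr hl h]]]]; exists s, 0, r, l.
  by rewrite edge_ax h; split=> //; split; lra.
have F3 : `[< F (lift ord0 (lift ord0 (lift ord0 ord0))) >] =
   `[< exists s t l : R, [/\ 0 <= s, 0 <= t, s + t <= 1, 0 <= l &
         triangle_point a x b s t = f.1 + l *: u] >].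
  apply: asbool_equiv_eq; rewrite FP; split.
    move=> [s [t [r [l [h1 [hs ht hst hr hl] h3]]]]]; have h3' : r = 0 := h3.
    by exists s, t, l; split=> //; rewrite h1 h3' on_segment0.
  move=> [s [t [l [hs ht hst hl h]]]]; exists s, t, 0, l; rewrite on_segment0.
  by split=> //; split=> //; rewrite lexx ler01.
have F4 : `[< F (lift ord0 (lift ord0 (lift ord0 (lift ord0 ord0)))) >] =
   `[< exists s t l : R, [/\ 0 <= s, 0 <= t, s + t <= 1, 0 <= l &
         triangle_point a x b s t = f.2 + l *: u] >].
  apply: asbool_equiv_eq; rewrite FP; split.
    move=> [s [t [r [l [h1 [hs ht hst hr hl] h3]]]]]; have /sE h3' : 1 - r = 0 := h3.
    by exists s, t, l; split=> //; rewrite h1 h3' on_segment1.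
  move=> [s [t [l [hs ht hst hl h]]]]; exists s, t, 1, l; rewrite on_segment1.
  by split=> //; [split=> //; rewrite lexx ler01|exact: subrr].
have F5 : `[< F (lift ord0 (lift ord0 (lift ord0 (lift ord0 (lift ord0 ord0))))) >] = false.
  apply/asboolP => /FP[s [t [r [l [h1 [hs ht hst hr hl] h3]]]]].
  have [c1 _ _ _ _] := corner _ _ _ _ hs ht hst hr h1.
  exact: c1.
move: key; rewrite F0 F1 F2 F3 F4 F5 !overE /triangle_face /v3 !(det3N1, det3N2, det3N3) ?opprK /= mulr0.
have -> : det3 (b - x) (f.2 - f.1) u = det3 v2 (f.2 - f.1) u - det3 v1 (f.2 - f.1) u.
  by rewrite !det3E !mxE; ring.
have -> : det3 (a - b) (f.2 - f.1) u = - det3 v2 (f.2 - f.1) u.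
  by rewrite !det3E !mxE; ring.
rewrite (_ : - det3 v2 _ _ + _ = - (det3 v2 (f.2 - f.1) u - det3 v1 (f.2 - f.1) u)); last by ring.
rewrite !sgzN -/v1 -/v2 !mulNr.
exact: balance5.
Qed.
End Triangle.

(** * Independence of the direction and the linking number of chains *)

Section GenericDirection.
Variable R : realType.
Notation V := (space3 R).
Implicit Types (u v w x y : V) (e f : V * V) (E F : seq (V * V)).

Lemma nonroot (p : {poly R}) (g : nat -> R) : injective g -> p != 0 ->
  exists k, ~~ root p (g k).
Proof.
move=> ginj p0; apply: contrapT => noroot.
have := @max_poly_roots _ p [seq g k | k <- iota 0 (size p)] p0.
rewrite size_map size_iota ltnn => bad; apply: notF; apply: bad; last first.
  by rewrite map_inj_uniq ?iota_uniq.
apply/allP => _ /mapP[k _ ->]; apply/negPn/negP => h; apply: noroot; by exists k.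
Qed.

Definition dot x y : R := x ord0 ord3_0 * y ord0 ord3_0 + x ord0 ord3_1 * y ord0 ord3_1
  + x ord0 ord3_2 * y ord0 ord3_2.

Definition cross x y : V := \row_(j < 3) nth 0
  [:: x ord0 ord3_1 * y ord0 ord3_2 - x ord0 ord3_2 * y ord0 ord3_1;
      x ord0 ord3_2 * y ord0 ord3_0 - x ord0 ord3_0 * y ord0 ord3_2;
      x ord0 ord3_0 * y ord0 ord3_1 - x ord0 ord3_1 * y ord0 ord3_0] j.

Lemma dot_cross x y z : dot (cross x y) z = det3 x y z.
Proof. by rewrite det3E /dot !mxE /=; ring. Qed.

Lemma cross_eq0 x y : y != 0 -> cross x y = 0 -> exists l : R, x = l *: y.
Proof.
move=> y0 /space3P[]; rewrite !mxE /= => h0 h1 h2.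
have [i yi] : exists i, y ord0 i != 0 by apply/rV0Pn.
exists (x ord0 i / y ord0 i); apply/space3P; rewrite !mxE.
case: i yi => -[|[|[|//]]] hi.
- rewrite (_ : Ordinal hi = ord3_0); last exact: val_inj.
  by move=> yi; split; apply: (mulIf yi); rewrite mulrAC divfK //; lra.
- rewrite (_ : Ordinal hi = ord3_1); last exact: val_inj.
  by move=> yi; split; apply: (mulIf yi); rewrite mulrAC divfK //; lra.
- rewrite (_ : Ordinal hi = ord3_2); last exact: val_inj.
  by move=> yi; split; apply: (mulIf yi); rewrite mulrAC divfK //; lra.
Qed.

(* The curve (1, s, s^2) meets each plane through 0 finitely often. *)
Lemma avoid_planes (N : seq V) : (forall n, n \in N -> n != 0) ->
  exists u, forall n, n \in N -> dot n u != 0.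
Proof.
move=> N0.
pose P (n : V) := Poly [:: n ord0 ord3_0; n ord0 ord3_1; n ord0 ord3_2].
have P0 n : n \in N -> P n != 0.
  move=> /N0; apply: contraNneq => Pn0; apply/eqP/space3P; rewrite !mxE.
  have c i : nth 0 [:: n ord0 ord3_0; n ord0 ord3_1; n ord0 ord3_2] i = 0.
    by rewrite -coef_Poly -/(P n) Pn0 coef0.
  by split; [exact: (c 0%N)|exact: (c 1%N)|exact: (c 2%N)].
have prodN0 : \prod_(n <- N) P n != 0.
  rewrite prodf_seq_neq0; apply/allP => n nN; exact: P0.
have [k kP] := nonroot (g := fun k => k%:R) (@mulrIn _ 1 (oner_neq0 R)) prodN0.
exists (\row_(j < 3) k%:R ^+ j) => n nN.
move: kP; rewrite /root horner_prod prodf_seq_neq0 => /allP /(_ _ nN).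
rewrite horner_Poly /dot !mxE /=; apply: contraNneq => d0; rewrite -[X in _ == X]d0.
by apply/eqP; rewrite expr0 expr1 expr2; ring.
Qed.

(** The cross product would be zero for dependent x and y; the kernel of a 3 x 2 matrix is never
    trivial. *)
Lemma common_normal x y : exists2 n : V, n != 0 & dot n x = 0 /\ dot n y = 0.
Proof.
pose M : 'M[R]_(3, 1 + 1) := row_mx x^T y^T.
have : kermx M != 0.
  rewrite -mxrank_eq0 mxrank_ker -lt0n subn_gt0.
  exact: (leq_ltn_trans (rank_leq_col M)).
rewrite -nz_row_eq0 => n0; exists (nz_row (kermx M)) => //.
have /sub_kermxP : (nz_row (kermx M) <= kermx M)%MS by exact: nz_row_sub.
rewrite mul_mx_row => /eqP; rewrite row_mx_eq0 => /andP[/eqP e1 /eqP e2].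
have dotE v : dot (nz_row (kermx M)) v = (nz_row (kermx M) *m v^T) ord0 ord0.
  rewrite mxE !big_ord_recl big_ord0 addr0 /dot !mxE addrA.
  by congr (_ * _ + _ * _ + _ * _); congr (_ _ _); apply: val_inj.
by rewrite !dotE e1 e2 !mxE.
Qed.
End GenericDirection.

Section Chains.
Variable R : realType.
Notation V := (space3 R).
Implicit Types (u v w x y : V) (e f : V * V) (E F : seq (V * V)).

(** Vanishing boundary of a 1-chain, tested against every integer function on the points: this is
    the form in which sums over faces telescope. *)
Definition closed_chain (T : Type) (E : seq (T * T)) : Prop :=
  forall g : T -> int, \sum_(e <- E) g e.1 = \sum_(e <- E) g e.2.

Definition over_sum u E F : int := \sum_(e <- E) \sum_(f <- F) over u e f.

Definition regular u E F : Prop :=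
  u != 0 /\ forall e f, e \in E -> f \in F -> seg_regular u e f.

Definition apart E F : Prop := forall e f, e \in E -> f \in F -> seg_disjoint e f.

Lemma dotD n x y : dot n (x + y) = dot n x + dot n y :> R.
Proof. by rewrite /dot !mxE; ring. Qed.
Lemma dotZ n x (l : R) : dot n (l *: x) = l * dot n x.
Proof. by rewrite /dot !mxE; ring. Qed.

(** For every end x of one chain and segment f of the other, u is kept off a plane parallel to x -
    f.1 and f.2 - f.1. If x = f(t) + l u, pairing with the normal gives l = 0, so x would lie on f,
    against [apart]. The list N admits further constraints on u. *)
Lemma generic_direction E F (N : seq V) : apart E F -> (forall n, n \in N -> n != 0) ->
  exists2 u, regular u E F & forall n, n \in N -> dot n u != 0.
Proof.
move=> EF N0.
have normal x f : {n : V | n != 0 /\ dot n (x - f.1) = 0 /\ dot n (f.2 - f.1) = 0}.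
  by apply: cid; have [n n0 h] := common_normal (x - f.1) (f.2 - f.1); exists n.
pose M := [seq sval (normal ef.1.1 ef.2) | ef <- allpairs pair E F] ++
  [seq sval (normal ef.1.2 ef.2) | ef <- allpairs pair E F] ++
  [seq sval (normal ef.2.1 ef.1) | ef <- allpairs pair E F] ++
  [seq sval (normal ef.2.2 ef.1) | ef <- allpairs pair E F].
(* The unit vector in the list makes u nonzero even when there is no other constraint. *)
have [u uP] : exists u, forall n, n \in (delta_mx 0 0 :: M ++ N) -> dot n u != 0.
  apply: avoid_planes => n; rewrite inE mem_cat => /orP[/eqP ->|/orP[|/N0//]].
    by apply/eqP => /matrixP/(_ ord0 ord0) /eqP; rewrite !mxE eqxx oner_eq0.
  rewrite /M !mem_cat => /or4P[] /mapP[ef _ ->]; by case: (normal _ _) => m [].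
exists u; last by move=> n nN; apply: uP; rewrite inE mem_cat nN !orbT.
split.
  apply/eqP => u0; have := uP (delta_mx 0 0); rewrite inE eqxx => /(_ isT).
  by rewrite u0 /dot !mxE !mulr0 !addr0 eqxx.
have noshadow x f (t l : R) : sval (normal x f) \in M -> x = on_segment f t + l *: u ->
    x = on_segment f t.
  move=> nM ex; case: (normal x f) nM => n [n0 [d1 d2]] /= nM.
  have dn : l * dot n u = 0.
    move: d1; rewrite ex (_ : _ - _ = t *: (f.2 - f.1) + l *: u).
      by rewrite dotD !dotZ d2 mulr0 add0r.
    by apply/space3P; split; rewrite !mxE; ring.
  move/eqP: dn; rewrite mulf_eq0 => /orP[/eqP l0|]; first by rewrite ex l0 scale0r addr0.
  by rewrite (negbTE (uP n _)) // inE mem_cat nM orbT.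
move=> e f eE fF t l ht.
have efp : (e, f) \in allpairs pair E F by apply: allpairs_f.
have inM n : [\/ n = sval (normal e.1 f), n = sval (normal e.2 f),
    n = sval (normal f.1 e) | n = sval (normal f.2 e)] -> n \in M.
  rewrite /M !mem_cat => -[] ->; apply/or4P;
    [apply: Or41|apply: Or42|apply: Or43|apply: Or44];
    by apply/mapP; exists (e, f).
have i0 : 0 <= (0 : R) <= 1 by rewrite lexx ler01.
have i1 : 0 <= (1 : R) <= 1 by rewrite lexx ler01.
have ef s r hs hr : on_segment e s <> on_segment f r := EF e f eE fF s r hs hr.
split.
- move=> /(noshadow _ _ _ _ (inM _ (Or41 _ _ _ erefl))) h.
  by apply: (ef 0 t) => //; rewrite on_segment0.
- move=> /(noshadow _ _ _ _ (inM _ (Or42 _ _ _ erefl))) h.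
  by apply: (ef 1 t) => //; rewrite on_segment1.
- move=> /(noshadow _ _ _ _ (inM _ (Or43 _ _ _ erefl))) h.
  by apply: (ef t 0) => //; rewrite on_segment0.
- move=> /(noshadow _ _ _ _ (inM _ (Or44 _ _ _ erefl))) h.
  by apply: (ef t 1) => //; rewrite on_segment1.
Qed.

Lemma telescope_closed (E : seq (V * V)) (g : V -> int) : closed_chain E ->
  \sum_(e <- E) (g e.1 - g e.2) = 0.
Proof. by move=> cE; rewrite sumrB (cE g) subrr. Qed.

Lemma over_sum_transverse u u' E F : closed_chain E -> closed_chain F -> apart E F ->
  regular u E F -> regular u' E F ->
  (forall e f, e \in E -> f \in F ->
     [/\ det3 (e.1 - f.1) u u' != 0, det3 (e.1 - f.2) u u' != 0,
         det3 (e.2 - f.1) u u' != 0 & det3 (e.2 - f.2) u u' != 0]) ->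
  over_sum u E F = over_sum u' E F.
Proof.
move=> cE cF EF [u0 ru] [u0' ru'] gen; apply/esym/eqP; rewrite -subr_eq0; apply/eqP.
rewrite /over_sum -sumrB.
transitivity (\sum_(e <- E) \sum_(f <- F)
    ((cone_face u u' e.1 f - cone_face u u' e.2 f) +
     (cone_face (- u) (- u') f.1 e - cone_face (- u) (- u') f.2 e))).
  rewrite big_seq [RHS]big_seq; apply: eq_bigr => e eE.
  rewrite -sumrB big_seq [RHS]big_seq; apply: eq_bigr => f fF.
  have [d11 d12 d21 d22] := gen e f eE fF.
  by apply: over_change => //; [exact: EF|exact: ru|exact: ru'].
under eq_bigr => e _ do rewrite big_split /=.
rewrite big_split /= exchange_big /= [X in X + _]big1 ?add0r.
  by apply: big1 => e _; exact: (telescope_closed (fun y => cone_face (- u) (- u') y e) cF).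
by move=> f _; exact: (telescope_closed (fun y => cone_face u u' y f) cE).
Qed.

(** Two regular directions may span a plane containing a difference of ends, where [over_change]
    does not apply. They are compared through a third direction v that avoids these planes for both;
    the normals in [N w] are nonzero because w is regular. *)
Lemma over_sum_direction u u' E F : closed_chain E -> closed_chain F -> apart E F ->
  regular u E F -> regular u' E F -> over_sum u E F = over_sum u' E F.
Proof.
move=> cE cF EF ru ru'.
pose ends (G : seq (V * V)) := [seq e.1 | e <- G] ++ [seq e.2 | e <- G].
pose N w := [seq cross (xy.1 - xy.2) w | xy <- allpairs pair (ends E) (ends F)].
have in1 (G : seq (V * V)) e : e \in G -> e.1 \in ends G.
  by move=> eG; rewrite mem_cat map_f.
have in2 (G : seq (V * V)) e : e \in G -> e.2 \in ends G.
  by move=> eG; rewrite mem_cat orbC map_f.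
have endsP (G : seq (V * V)) x : x \in ends G -> exists2 e, e \in G & x = e.1 \/ x = e.2.
  by rewrite mem_cat => /orP[] /mapP[e eG ->]; exists e; auto.
have i0 : 0 <= (0 : R) <= 1 by rewrite lexx ler01.
have i1 : 0 <= (1 : R) <= 1 by rewrite lexx ler01.
have N0 w : regular w E F -> forall n, n \in N w -> n != 0.
  move=> [w0 rw] n /mapP[[x y] /allpairsP[[x' y'] /= [xE yF exy']] ->] /=.
  case: exy' => ? ?; subst x' y'.
  apply/eqP => /(cross_eq0 w0)[l] /eqP; rewrite subr_eq addrC => /eqP exy.
  have [e eE ex] := endsP _ _ xE; have [f fF fy] := endsP _ _ yF.
  have [r1 r2 _ _] := rw e f eE fF 0 l i0; have [r3 r4 _ _] := rw e f eE fF 1 l i1.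
  rewrite on_segment0 in r1 r2; rewrite on_segment1 in r3 r4.
  by case: ex fy => ex [] fy; rewrite ex fy in exy.
have [|v rv vN] := @generic_direction E F (N u ++ N u') EF.
  by move=> n; rewrite mem_cat => /orP[]; apply: N0.
have vgen w : {subset N w <= N u ++ N u'} -> forall x y, x \in ends E -> y \in ends F ->
    det3 (x - y) w v != 0.
  move=> sub x y xE yF; rewrite -dot_cross; apply/vN/sub/mapP; exists (x, y) => //.
  exact: allpairs_f.
have su : {subset N u <= N u ++ N u'} by move=> n nN; rewrite mem_cat nN.
have su' : {subset N u' <= N u ++ N u'} by move=> n nN; rewrite mem_cat nN orbT.
rewrite (over_sum_transverse cE cF EF ru rv); last first.
  by move=> e f eE fF; split; apply: (vgen u) => //; auto.
rewrite (over_sum_transverse cE cF EF ru' rv) //.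
by move=> e f eE fF; split; apply: (vgen u') => //; auto.
Qed.
End Chains.

(** * The linking number of closed chains and its invariance *)

Section LinkingOfChains.
Variable R : realType.
Notation V := (space3 R).
Implicit Types (u v w x y a b : V) (e f : V * V) (E F : seq (V * V)).

(* The direction 0 used when no direction is regular is junk; otherwise the choice
   is irrelevant by over_sum_direction. *)
Definition lk E F : int := over_sum (xget 0 [set u | regular u E F]) E F.

Lemma regular_exists E F : apart E F -> exists u, regular u E F.
Proof. by move=> EF; have [|u ru _] := generic_direction (N := [::]) EF; [|exists u]. Qed.

Lemma lkE u E F : closed_chain E -> closed_chain F -> apart E F ->
  regular u E F -> lk E F = over_sum u E F.
Proof.
move=> cE cF EF ru; apply: over_sum_direction => //.
by case: xgetP => [w -> //|/(_ u) /(_ ru)].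
Qed.

Lemma on_segment_rev a b (t : R) : on_segment (b, a) t = on_segment (a, b) (1 - t).
Proof. by rewrite /on_segment /= subKr addrC. Qed.

Lemma over_rev u a b f : over u (b, a) f = - over u (a, b) f.
Proof.
rewrite !overE /= (_ : det3 (a - b) _ _ = - det3 (b - a) (f.2 - f.1) u); last first.
  by rewrite -det3N1 opprB.
rewrite sgzN mulNr; congr (- (_ * (nat_of_bool _)%:Z)); apply: asbool_equiv_eq.
have flip (s : R) : 0 < s < 1 -> 0 < 1 - s < 1 by lra.
split=> -[s [t [l [hs ht hl h]]]]; exists (1 - s), t, l; split; rewrite ?flip //.
  by rewrite -on_segment_rev.
by rewrite on_segment_rev subKr.
Qed.

(** Makes it possible to pad polygons with repeated points. *)
Lemma over_diag u a f : over u (a, a) f = 0.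
Proof. by rewrite overE /= subrr det3E !mxE !mul0r !subr0 addr0 sgz0 mul0r. Qed.

(** Seen from the opposite side, over and under are exchanged. The sign survives: swapping two
    columns and reversing u compensate. *)
Lemma overN u e f : over (- u) e f = over u f e.
Proof.
rewrite !overE (_ : det3 _ _ (- u) = det3 (f.2 - f.1) (e.2 - e.1) u); last first.
  by rewrite !det3E !mxE; ring.
congr (_ * (nat_of_bool _)%:Z); apply: asbool_equiv_eq.
by split=> -[s [t [l [hs ht hl h]]]]; exists t, s, l; split=> //; rewrite h scalerN ?subrK ?addrK.
Qed.

Lemma seg_regularC u e f : seg_regular u e f -> seg_regular u f e.
Proof. by move=> r t l /(r t l)[]. Qed.

Lemma seg_regularN u e f : seg_regular u e f -> seg_regular (- u) e f.
Proof. by move=> r t l ht; rewrite !scalerN -!scaleNr; exact: r. Qed.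

Lemma regularC u E F : regular u E F -> regular u F E.
Proof. by case=> u0 r; split=> // f e fF eE; exact/seg_regularC/r. Qed.

Lemma regularN u E F : regular u E F -> regular (- u) E F.
Proof. by case=> u0 r; rewrite /regular oppr_eq0; split=> // e f eE fF; exact/seg_regularN/r. Qed.

Lemma apartC E F : apart E F -> apart F E.
Proof. by move=> EF f e fF eE s t hs ht /esym; exact: EF. Qed.

Lemma apart_sub E E' F F' : {subset E' <= E} -> {subset F' <= F} -> apart E F -> apart E' F'.
Proof. by move=> sE sF EF e f /sE eE /sF fF; exact: EF. Qed.

Lemma regular_sub u E E' F F' : {subset E' <= E} -> {subset F' <= F} ->
  regular u E F -> regular u E' F'.
Proof. by move=> sE sF [u0 r]; split=> // e f /sE eE /sF fF; exact: r. Qed.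

Lemma over_sumC u E F : over_sum (- u) E F = over_sum u F E.
Proof.
rewrite /over_sum exchange_big; apply: eq_bigr => f _; apply: eq_bigr => e _.
exact: overN.
Qed.

(** By independence of the direction one may use u on one side and [- u] on the other. *)
Lemma lkC E F : closed_chain E -> closed_chain F -> apart E F -> lk E F = lk F E.
Proof.
move=> cE cF EF; have [u ru] := regular_exists EF.
rewrite (lkE cE cF EF (regularN ru)) over_sumC.
by rewrite (lkE cF cE (apartC EF) (regularC ru)).
Qed.

Lemma over_sum_cat u E E' F : over_sum u (E ++ E') F = over_sum u E F + over_sum u E' F.
Proof. exact: big_cat. Qed.

Lemma over_sum_cons u e E F : over_sum u (e :: E) F = over_sum u [:: e] F + over_sum u E F.
Proof. exact: (over_sum_cat u [:: e]). Qed.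

(* A need not be closed: it only makes the direction u more generic. *)
Lemma eq_lk (A : seq (V * V)) E E' F : closed_chain E -> closed_chain E' -> closed_chain F ->
  {subset E <= A} -> {subset E' <= A} -> apart A F ->
  (forall u, regular u A F -> over_sum u E F = over_sum u E' F) -> lk E F = lk E' F.
Proof.
move=> cE cE' cF sE sE' AF h.
have [u ru] := regular_exists AF.
rewrite (@lkE u E F) ?(@lkE u E' F) ?h //.
- exact: apart_sub AF.
- exact: regular_sub ru.
- exact: apart_sub AF.
- exact: regular_sub ru.
Qed.

Lemma perm_lk E E' F : perm_eq E E' -> closed_chain E -> closed_chain F -> apart E F ->
  lk E F = lk E' F.
Proof.
move=> EE' cE cF EF; apply: (@eq_lk E) => //.
- by move=> g; rewrite -!(perm_big _ EE') /= cE.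
- by move=> e; rewrite (perm_mem EE').
- by move=> u ru; exact: perm_big.
Qed.

(** The crossings of F over E seen along u are those of E over F seen along [- u], so each kind
    contributes [lk E F]. *)
Lemma crossing_sumE u P Q : let E := sides P in let F := sides Q in
  closed_chain E -> closed_chain F -> apart E F -> regular u E F ->
  crossing_sum u P Q = lk E F *+ 2.
Proof.
move=> E F cE cF EF ru.
rewrite mulr2n {1}(lkE cE cF EF ru) (lkE cE cF EF (regularN ru)) over_sumC /over_sum.
rewrite [X in _ = _ + X]exchange_big -big_split; apply: eq_bigr => e _.
by rewrite -big_split.
Qed.

Lemma triangle_edges a x b f : triangle_disjoint a x b f ->
  [/\ seg_disjoint (a, x) f, seg_disjoint (x, b) f & seg_disjoint (b, a) f].
Proof.
move=> d; split=> s t hs ht.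
- by have := d s 0 t; rewrite (_ : triangle_point _ _ _ _ _ = on_segment (a, x) s);
    [apply; lra|apply/space3P; split; rewrite !mxE /=; ring].
- by have := d (1 - s) s t; rewrite (_ : triangle_point _ _ _ _ _ = on_segment (x, b) s);
    [apply; lra|apply/space3P; split; rewrite !mxE /=; ring].
- by have := d 0 (1 - s) t; rewrite (_ : triangle_point _ _ _ _ _ = on_segment (b, a) s);
    [apply; lra|apply/space3P; split; rewrite !mxE /=; ring].
Qed.

Lemma over_sum_triangle u a x b F : closed_chain F ->
  (forall f, f \in F -> triangle_disjoint a x b f) ->
  regular u [:: (a, x); (x, b); (b, a)] F ->
  over_sum u [:: (a, x)] F + over_sum u [:: (x, b)] F + over_sum u [:: (b, a)] F = 0.
Proof.
move=> cF d [u0 ru]; rewrite /over_sum !big_seq1 -!big_split /=.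
transitivity (\sum_(f <- F) (triangle_face u a x b f.2 - triangle_face u a x b f.1)).
  rewrite big_seq [RHS]big_seq; apply: eq_bigr => f fF.
  by apply: over_triangle => //; [exact: d|..]; apply: ru => //; rewrite !inE eqxx ?orbT.
by rewrite sumrB (cF (triangle_face u a x b)) subrr.
Qed.

Lemma over_sum_rev u a b F : over_sum u [:: (b, a)] F = - over_sum u [:: (a, b)] F.
Proof. by rewrite /over_sum !big_seq1 -sumrN; apply: eq_bigr => f _; exact: over_rev. Qed.

Lemma seg_disjoint_rev a b f : seg_disjoint (a, b) f -> seg_disjoint (b, a) f.
Proof. by move=> d s t hs ht; rewrite on_segment_rev; apply: d => //; lra. Qed.

Lemma lk_insert E E' a x b F :
  closed_chain (E ++ (a, b) :: E') -> closed_chain F ->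
  apart (E ++ (a, b) :: E') F -> (forall f, f \in F -> triangle_disjoint a x b f) ->
  lk (E ++ (a, b) :: E') F = lk (E ++ (a, x) :: (x, b) :: E') F.
Proof.
move=> cE cF EF d.
(* The third side is included so that u is regular for the whole triangle. *)
apply: (@eq_lk ((E ++ (a, b) :: E') ++ [:: (a, x); (x, b); (b, a)])) => //.
- by move=> g; have := cE g; rewrite !big_cat !big_cons /=; lia.
- by move=> e eE; rewrite mem_cat eE.
- move=> e; rewrite !(mem_cat, inE) => /or4P[|||] ->; rewrite ?orbT //.
- move=> e f; rewrite mem_cat => /orP[eE|eT] fF; first exact: EF.
  have [d1 d2 d3] := triangle_edges (d f fF).
  by move: eT; rewrite !inE => /or3P[] /eqP ->.
move=> u ru; rewrite !over_sum_cat over_sum_cons [in RHS]over_sum_cons.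
rewrite [in X in _ = _ + (_ + X)]over_sum_cons.
have /(over_sum_triangle cF d) : regular u [:: (a, x); (x, b); (b, a)] F.
  by apply: regular_sub ru => // e eT; rewrite mem_cat eT orbT.
rewrite [over_sum u [:: (b, a)] F]over_sum_rev; lia.
Qed.

(* Each side p k, p l of the first polygon is moved to p' k, p' l across two triangles. *)
Lemma lk_homotopy (K : eqType) (N : seq (K * K)) (p p' : K -> V) F :
  closed_chain N -> closed_chain F ->
  (forall k f, k \in N -> f \in F ->
     triangle_disjoint (p k.1) (p k.2) (p' k.2) f /\
     triangle_disjoint (p k.1) (p' k.2) (p' k.1) f) ->
  lk [seq (p k.1, p k.2) | k <- N] F = lk [seq (p' k.1, p' k.2) | k <- N] F.
Proof.
move=> cN cF d.
pose A := flatten [seq [:: (p k.1, p k.2); (p k.2, p' k.2); (p' k.2, p k.1);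
  (p k.1, p' k.2); (p' k.2, p' k.1); (p' k.1, p k.1); (p' k.1, p' k.2)] | k <- N].
have inA k e : k \in N -> e \in [:: (p k.1, p k.2); (p k.2, p' k.2); (p' k.2, p k.1);
    (p k.1, p' k.2); (p' k.2, p' k.1); (p' k.1, p k.1); (p' k.1, p' k.2)] -> e \in A.
  by move=> kN ek; apply/flatten_mapP; exists k.
have cmap (q : K -> V) : closed_chain [seq (q k.1, q k.2) | k <- N].
  by move=> g; rewrite !big_map; exact: (cN (g \o q)).
apply: (@eq_lk A) => //.
- by move=> e /mapP[k kN ->]; apply: (inA k); rewrite // inE eqxx.
- by move=> e /mapP[k kN ->]; apply: (inA k); rewrite // !inE eqxx !orbT.
- move=> e f /flatten_mapP[k kN ek] fF.
  have [t1 t2] := d k f kN fF.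
  have [d1 d2 d3] := triangle_edges t1; have [d4 d5 d6] := triangle_edges t2.
  move: ek; rewrite !inE; do 6![case/orP; first by move=> /eqP ->].
  by move=> /eqP ->; exact: seg_disjoint_rev.
move=> u ru; rewrite /over_sum !big_map.
(* The count of the track of one vertex. A side and its displaced copy differ by [g k.1 - g k.2],
   which cancels around the closed chain. *)
pose g k := over_sum u [:: (p k, p' k)] F.
apply/eqP; rewrite -subr_eq0 -sumrB; apply/eqP.
transitivity (\sum_(k <- N) (g k.1 - g k.2)); last by rewrite sumrB (cN g) subrr.
rewrite big_seq [RHS]big_seq; apply: eq_bigr => k kN.
have r1 : regular u [:: (p k.1, p k.2); (p k.2, p' k.2); (p' k.2, p k.1)] F.
  by apply: regular_sub ru => // e eT; apply: (inA k) => //; move: eT; rewrite !inE => /or3P[] ->; rewrite ?orbT.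
have r2 : regular u [:: (p k.1, p' k.2); (p' k.2, p' k.1); (p' k.1, p k.1)] F.
  by apply: regular_sub ru => // e eT; apply: (inA k) => //; move: eT; rewrite !inE => /or3P[] ->; rewrite ?orbT.
have e1 := over_sum_triangle cF (fun f fF => (d k f kN fF).1) r1.
have e2 := over_sum_triangle cF (fun f fF => (d k f kN fF).2) r2.
have s1 a b : \sum_(f <- F) over u (a, b) f = over_sum u [:: (a, b)] F by rewrite /over_sum big_seq1.
rewrite !s1 /g; move: e1 e2.
rewrite (over_sum_rev _ (p k.1) (p' k.2)) (over_sum_rev _ (p' k.1) (p' k.2)) (over_sum_rev _ (p k.1) (p' k.1)).
lia.
Qed.
End LinkingOfChains.

(** * Inscribed polygons *)

Section Steps.
Variable T : Type.
Implicit Types (x y : T) (s : seq T).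

Lemma zip_rot1 x s : zip (x :: s) (rot 1 (x :: s)) = pairmap pair x (rcons s x).
Proof.
rewrite rot1_cons; move: {2 4}x => y.
by elim: s x => //= z s IH x; congr (_ :: _); exact: IH.
Qed.

Lemma sum_steps (g : T -> int) x s :
  \sum_(e <- pairmap pair x s) g e.1 + g (last x s) =
  g x + \sum_(e <- pairmap pair x s) g e.2.
Proof.
by elim: s x => [|y s IH] x /=; rewrite ?big_nil ?big_cons /= ?add0r ?addr0 // -addrA IH.
Qed.
End Steps.

Lemma mem_steps (T : eqType) (x : T) s e : e \in pairmap pair x s ->
  e.1 \in x :: s /\ e.2 \in s.
Proof.
elim: s x => //= y s IH x; rewrite inE => /predU1P[->|/IH[h1 h2]] /=.
  by rewrite !inE !eqxx.
by rewrite !inE in h1 h2 *; rewrite h1 h2 !orbT.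
Qed.

Section Near.
Variable R : realType.
Notation V := (space3 R).
Implicit Types (x a b p : V) (e f : V * V) (r : R).

Lemma near_segment e p r (t : R) : 0 <= t <= 1 -> `|e.1 - p| < r -> `|e.2 - p| < r ->
  `|on_segment e t - p| < r.
Proof.
move=> /andP[t0 t1] h1 h2.
have -> : on_segment e t - p = (1 - t) *: (e.1 - p) + t *: (e.2 - p).
  by apply/space3P; split; rewrite !mxE; ring.
apply: le_lt_trans (ler_normD _ _) _; rewrite !normrZ !ger0_norm ?subr_ge0 //.
have [/eqP ->|tn] := boolP (t == 0); first by rewrite subr0 mul1r mul0r addr0.
have : t * `|e.2 - p| < t * r by rewrite ltr_pM2l // lt_neqAle eq_sym tn.
have : (1 - t) * `|e.1 - p| <= (1 - t) * r by rewrite ler_wpM2l ?subr_ge0 // ltW.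
lra.
Qed.

Lemma near_triangle a x b p r (s t : R) : 0 <= s -> 0 <= t -> s + t <= 1 ->
  `|a - p| < r -> `|x - p| < r -> `|b - p| < r -> `|triangle_point a x b s t - p| < r.
Proof.
move=> s0 t0 st ha hx hb.
(* If s + t = 0 the quotient is 0 by convention and the point is a. *)
have -> : triangle_point a x b s t = on_segment (a, on_segment (x, b) (t / (s + t))) (s + t).
  have [z|nz] := eqVneq (s + t) 0.
    have [-> ->] : s = 0 /\ t = 0 by lra.
    by apply/space3P; split; rewrite !mxE addr0; ring.
  by apply/space3P; split; rewrite !mxE /=; field.
apply: near_segment => /=; [lra|done|].
apply: near_segment => //=; have [z|nz] := eqVneq (s + t) 0.
  by rewrite z invr0 mulr0 lexx ler01.
have st0 : 0 < s + t by rewrite lt_neqAle eq_sym nz addr_ge0.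
by rewrite divr_ge0 ?addr_ge0 // ler_pdivrMr // mul1r lerDr.
Qed.
End Near.

(** * Comparison of the polygons inscribed in a closed curve *)

Section Curves.
Variable R : realType.
Notation V := (space3 R).
Implicit Types (c d : R -> V) (s t : seq R) (F : seq (V * V)).

Definition inscribed c s : seq (V * V) := [seq (c e.1, c e.2) | e <- pairmap pair 0 s].

(** A bound on the whole arc over each step, not just on its ends, so that every refinement inherits
    it. *)
Definition small_arcs c (r : R) s : Prop := forall e, e \in pairmap pair 0 s ->
  forall a b, e.1 <= a <= e.2 -> e.1 <= b <= e.2 -> `|c a - c b| < r.

Definition far c (r : R) F : Prop := forall (a t : R) f, 0 <= a <= 1 -> f \in F ->
  0 <= t <= 1 -> r <= `|c a - on_segment f t|.

Lemma path_lt_last (x : R) s : path <%R x s -> x <= last x s.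
Proof.
by elim: s x => //= y s IH x /andP[xy /IH]; apply: le_trans (ltW xy).
Qed.

Lemma steps_bounds x s e : path <%R x s -> e \in pairmap pair x s ->
  [/\ x <= e.1, e.1 < e.2 & e.2 <= last x s].
Proof.
elim: s x => //= y s IH x /andP[xy ys]; rewrite inE => /predU1P[->|/(IH y ys)[h1 h2 h3]] /=.
  by rewrite lexx xy path_lt_last.
by rewrite (le_trans (ltW xy) h1).
Qed.

Lemma inscribed_closed c s : c 0 = c 1 -> itv_partition 0 1 s ->
  closed_chain (inscribed c s).
Proof.
move=> c01 [_ /eqP s1] g; have := sum_steps (g \o c) 0 s.
by rewrite s1 /= -c01 addrC => /addrI; rewrite /inscribed !big_map.
Qed.

Lemma inscribed_apart c r s F : itv_partition 0 1 s -> small_arcs c r s -> far c r F ->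
  apart (inscribed c s) F.
Proof.
move=> [ps /eqP s1] fine cF _ f /mapP[e es ->] fF a b ha hb ab.
have [e0 e12 e1] := steps_bounds ps es; rewrite s1 in e1.
have : `|on_segment (c e.1, c e.2) a - c e.1| < r.
  by apply: near_segment => //=; apply: (fine e) => //; rewrite ?lexx ?(ltW e12).
have : r <= `|c e.1 - on_segment f b| by apply: cF => //; rewrite e0 (le_trans (ltW e12)).
by rewrite ab distrC ltNge => ->.
Qed.

(** The old side and the new vertex span a triangle within r of a point of the curve, while F is at
    distance at least r from the curve. *)
Lemma inscribed_insert c r s1 (x b : R) s2 F : c 0 = c 1 ->
  itv_partition 0 1 (s1 ++ b :: s2) -> last 0 s1 < x < b ->
  small_arcs c r (s1 ++ b :: s2) -> closed_chain F -> far c r F ->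
  [/\ itv_partition 0 1 (s1 ++ x :: b :: s2), small_arcs c r (s1 ++ x :: b :: s2) &
      lk (inscribed c (s1 ++ b :: s2)) F = lk (inscribed c (s1 ++ x :: b :: s2)) F].
Proof.
move=> c01 ps /andP[ax xb] fine cF cfar.
have lb : (last 0 s1, b) \in pairmap pair 0 (s1 ++ b :: s2).
  by rewrite pairmap_cat mem_cat /= !inE eqxx orbT.
split.
- case: ps; rewrite cat_path last_cat /= => /and3P[h1 _ bs2] s21; split.
    by rewrite cat_path h1 /= ax xb bs2.
  by rewrite last_cat.
- move=> e; rewrite pairmap_cat mem_cat /= !inE => /or4P[es1|/eqP ->|/eqP ->|es2] y z /= hy hz.
  + by apply: (fine e) => //; rewrite pairmap_cat mem_cat es1.
  + by apply: (fine _ lb) => /=; lra.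
  + by apply: (fine _ lb) => /=; lra.
  + by apply: (fine e) => //; rewrite pairmap_cat mem_cat /= inE es2 !orbT.
have iE : inscribed c (s1 ++ b :: s2) =
    inscribed c s1 ++ (c (last 0 s1), c b) :: [seq (c e.1, c e.2) | e <- pairmap pair b s2].
  by rewrite /inscribed pairmap_cat map_cat.
have -> : inscribed c (s1 ++ x :: b :: s2) = inscribed c s1 ++ (c (last 0 s1), c x) ::
    (c x, c b) :: [seq (c e.1, c e.2) | e <- pairmap pair b s2].
  by rewrite /inscribed pairmap_cat map_cat.
rewrite iE; apply: lk_insert => //; rewrite -?iE.
- exact: inscribed_closed.
- exact: inscribed_apart cfar.
move=> f fF y z t y0 z0 yz ht eyz.
have [l0 l1 b1] := steps_bounds ps.1 lb.
case: (ps) => _ /eqP s1E; rewrite s1E /= in b1 l0 l1.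
have hab : last 0 s1 < b by rewrite (lt_trans ax).
have : `|triangle_point (c (last 0 s1)) (c x) (c b) y z - c (last 0 s1)| < r.
  by apply: near_triangle => //; apply: (fine _ lb) => /=; lra.
rewrite eyz distrC ltNge; move/negP; apply; apply: cfar => //.
by clear -l0 hab b1; lra.
Qed.

Lemma split_at (y x : R) s : path <%R y s -> y < x < last y s -> x \notin s ->
  exists s1 b s2, s = s1 ++ b :: s2 /\ last y s1 < x < b.
Proof.
elim: s y => [|z s IH] y /=; first by move=> _ /andP[h1 h2]; have := lt_trans h1 h2; rewrite ltxx.
move=> /andP[yz zs] /andP[yx xl]; rewrite inE negb_or => /andP[xz xs].
have [xz'|zx|/eqP] := ltgtP x z; last by rewrite (negbTE xz).
  by exists [::], z, s; rewrite yx xz'.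
have [|s1 [b [s2 [-> h]]]] := IH z zs _ xs; first by rewrite zx.
by exists (z :: s1), b, s2.
Qed.

Lemma inscribed_merge c r s F (q : seq R) : c 0 = c 1 -> itv_partition 0 1 s ->
  small_arcs c r s -> closed_chain F -> far c r F -> (forall x, x \in q -> 0 < x <= 1) ->
  exists s', [/\ itv_partition 0 1 s', small_arcs c r s', s' =i q ++ s &
      lk (inscribed c s) F = lk (inscribed c s') F].
Proof.
move=> c01 ps fine cF cfar.
elim: q => [|x q IH] q01; first by exists s.
have [|s' [ps' fine' s'E ->]] := IH; first by move=> y yq; apply: q01; rewrite inE yq orbT.
have [xs'|xs'] := boolP (x \in s').
  by exists s'; split=> // y; rewrite inE -s'E; case: eqP => [->|].
have /andP[x0 x1] : 0 < x <= 1 by apply: q01; rewrite inE eqxx.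
have l1 : last 0 s' = 1 by apply/eqP; case: ps'.
have x1' : x < 1.
  rewrite lt_neqAle x1 andbT; apply: contraNneq xs' => ->.
  case: s' l1 {ps' fine' s'E} => [/= /esym/eqP|y s' /= <-]; first by rewrite oner_eq0.
  exact: mem_last.
have [|s1 [b [s2 [s'E2 h]]]] := split_at ps'.1 _ xs'; first by rewrite x0 l1.
subst s'; have [p1 p2 p3] := inscribed_insert c01 ps' h fine' cF cfar.
exists (s1 ++ x :: b :: s2); split=> // y.
by rewrite inE -s'E !mem_cat !inE orbCA.
Qed.

Lemma path_lt_bounds (z x : R) s : path <%R z s -> x \in s -> z < x <= last z s.
Proof.
elim: s z => //= y s IH z /andP[zy ys]; rewrite inE => /predU1P[->|xs].
  by rewrite zy path_lt_last.
by have /andP[h1 ->] := IH y ys xs; rewrite (lt_trans zy).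
Qed.

Lemma itv_partition_pos s (x : R) : itv_partition 0 1 s -> x \in s -> 0 < x <= 1.
Proof. by case=> ps /eqP <-; exact: path_lt_bounds. Qed.

(** Both subdivisions are refined to their union, one point at a time; a strictly increasing list is
    determined by its members. *)
Lemma lk_inscribed c r s s' F : c 0 = c 1 -> itv_partition 0 1 s -> itv_partition 0 1 s' ->
  small_arcs c r s -> small_arcs c r s' -> closed_chain F -> far c r F ->
  lk (inscribed c s) F = lk (inscribed c s') F.
Proof.
move=> c01 ps ps' fine fine' cF cfar.
have [q [pq _ qE ->]] := inscribed_merge c01 ps fine cF cfar (fun x => itv_partition_pos ps').
have [q' [pq' _ qE' ->]] := inscribed_merge c01 ps' fine' cF cfar (fun x => itv_partition_pos ps).
suff -> : q = q' by [].
apply: (lt_sorted_eq (path_sorted pq.1) (path_sorted pq'.1)) => x.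
by rewrite qE qE' !mem_cat orbC.
Qed.

(** The inscribed segments stray less than r from d, which leaves r of the distance [2 * r]. *)
Lemma far_inscribed c d r s : itv_partition 0 1 s -> small_arcs d r s ->
  (forall a b, 0 <= a <= 1 -> 0 <= b <= 1 -> 2 * r <= `|c a - d b|) ->
  far c r (inscribed d s).
Proof.
move=> ps fine sep a t _ ha /mapP[e es ->] ht.
have [e0 e12 e1] := steps_bounds ps.1 es; case: (ps) => _ /eqP s1; rewrite s1 in e1.
have : `|on_segment (d e.1, d e.2) t - d e.1| < r.
  by apply: near_segment => //=; apply: (fine e) => //; rewrite ?lexx ?(ltW e12).
have : 2 * r <= `|c a - d e.1| by apply: sep => //; rewrite e0 (le_trans (ltW e12)).
have := ler_distD (on_segment (d e.1, d e.2) t) (c a) (d e.1).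
by clear; lra.
Qed.

Lemma lk_curves c d r s s' t t' : c 0 = c 1 -> d 0 = d 1 ->
  (forall a b, 0 <= a <= 1 -> 0 <= b <= 1 -> 2 * r <= `|c a - d b|) ->
  itv_partition 0 1 s -> itv_partition 0 1 s' -> itv_partition 0 1 t -> itv_partition 0 1 t' ->
  small_arcs c r s -> small_arcs c r s' -> small_arcs d r t -> small_arcs d r t' ->
  lk (inscribed c s) (inscribed d t) = lk (inscribed c s') (inscribed d t').
Proof.
move=> c01 d01 sep ps ps' pt pt' fs fs' ft ft'.
have sep' a b : 0 <= a <= 1 -> 0 <= b <= 1 -> 2 * r <= `|d a - c b|.
  by move=> ha hb; rewrite distrC; exact: sep.
rewrite (lk_inscribed c01 ps ps' fs fs' (inscribed_closed d01 pt) (far_inscribed pt ft sep)).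
rewrite lkC; [|exact: inscribed_closed|exact: inscribed_closed|]; last first.
  exact: (inscribed_apart ps' fs' (far_inscribed pt ft sep)).
rewrite (lk_inscribed d01 pt pt' ft ft' (inscribed_closed c01 ps') (far_inscribed ps' fs' sep')).
rewrite lkC; [by []|exact: inscribed_closed|exact: inscribed_closed|].
exact: (inscribed_apart pt' ft' (far_inscribed ps' fs' sep')).
Qed.

(** [sides] puts the closing side, from c 1 to the first vertex, at the end; [inscribed] starts with
    it, as c 0 = c 1. *)
Lemma sides_inscribed c s : c 0 = c 1 -> itv_partition 0 1 s ->
  perm_eq (sides (map c s)) (inscribed c s).
Proof.
move=> c01 [_ /eqP]; case: s => [/= /esym/eqP|x s /= l1]; first by rewrite oner_eq0.
have mapE y (q : seq R) : pairmap pair (c y) (map c q) = [seq (c e.1, c e.2) | e <- pairmap pair y q].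
  by elim: q y => //= z q IH y; rewrite IH.
rewrite /sides zip_rot1 -cats1 pairmap_cat /= last_map l1 /inscribed /= -mapE c01.
by rewrite perm_catC.
Qed.

Lemma regular_direction_regular u c d s t : c 0 = c 1 -> d 0 = d 1 ->
  itv_partition 0 1 s -> itv_partition 0 1 t ->
  regular_direction u (map c s) (map d t) -> regular u (sides (map c s)) (sides (map d t)).
Proof.
move=> c01 d01 ps pt [u0 h1 h2]; split=> // e f eP fQ a l ha.
have vert (P : seq V) g : g \in sides P -> g.1 \in P /\ g.2 \in P.
  case: P => // x P; rewrite /sides zip_rot1 => /mem_steps; rewrite !inE !mem_rcons !inE.
  by rewrite orbA orbb.
have [e1 e2] := vert _ _ eP; have [f1 f2] := vert _ _ fQ.
have on g : closed_segment g (on_segment g a) by exists a => //=; rewrite in_itv.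
split=> h.
- by apply: (h1 _ _ _ e1 fQ (on f)); exists l.
- by apply: (h1 _ _ _ e2 fQ (on f)); exists l.
- by apply: (h2 _ _ _ f1 eP (on e)); exists l.
- by apply: (h2 _ _ _ f2 eP (on e)); exists l.
Qed.

Lemma regular_regular_direction u c d s t :
  regular u (sides (map c s)) (sides (map d t)) -> regular_direction u (map c s) (map d t).
Proof.
move=> [u0 r].
have vert (P : seq V) x : x \in P -> exists2 g, g \in sides P & g.1 = x.
  move=> xP; exists (x, nth x (rot 1 P) (index x P)) => //.
  rewrite /sides -{1}(nth_index x xP) -nth_zip ?size_rot // mem_nth //.
  by rewrite size_zip size_rot minnn index_mem.
split=> // [x f y /vert[e eP <-] fQ|x e y /vert[f fQ <-] eP] [a]; rewrite /= in_itv /= => ha <- [l].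
- by have [] := r e f eP fQ a l ha.
- by have [] := r e f eP fQ a l ha.
Qed.

Lemma crossing_sum_curves u c d r s t : c 0 = c 1 -> d 0 = d 1 ->
  (forall a b, 0 <= a <= 1 -> 0 <= b <= 1 -> 2 * r <= `|c a - d b|) ->
  itv_partition 0 1 s -> itv_partition 0 1 t ->
  small_arcs c r s -> small_arcs d r t ->
  regular_direction u (map c s) (map d t) ->
  crossing_sum u (map c s) (map d t) = lk (inscribed c s) (inscribed d t) *+ 2.
Proof.
move=> c01 d01 sep ps pt fs ft /(regular_direction_regular c01 d01 ps pt) ru.
have pc := sides_inscribed c01 ps; have pd := sides_inscribed d01 pt.
have cl (E E' : seq (V * V)) : perm_eq E E' -> closed_chain E' -> closed_chain E.
  by move=> p cE g; rewrite !(perm_big _ p) /= cE.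
have cc := cl _ _ pc (inscribed_closed c01 ps).
have cd := cl _ _ pd (inscribed_closed d01 pt).
have ap : apart (sides (map c s)) (sides (map d t)).
  apply: (@apart_sub _ (inscribed c s) _ (inscribed d t)).
  - by move=> e; rewrite (perm_mem pc).
  - by move=> e; rewrite (perm_mem pd).
  - exact: (inscribed_apart ps fs (far_inscribed pt ft sep)).
rewrite crossing_sumE // (perm_lk pc cc cd ap).
have ap' : apart (inscribed c s) (sides (map d t)).
  by apply: apart_sub ap => // e; rewrite (perm_mem pc).
have cc' := inscribed_closed c01 ps.
rewrite lkC // (perm_lk pd cd cc' (apartC ap')) lkC //; first exact: inscribed_closed.
by apply: apart_sub (apartC ap') => // e; rewrite (perm_mem pd).
Qed.

(** Existence of the linking number, for the curves of G. *)
Lemma linking_number_inscribed c d r s t : c 0 = c 1 -> d 0 = d 1 ->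
  (forall a b, 0 <= a <= 1 -> 0 <= b <= 1 -> 2 * r <= `|c a - d b|) ->
  (exists2 eps, 0 < eps & forall s, fine_subdivision eps s -> small_arcs c r s /\ small_arcs d r s) ->
  itv_partition 0 1 s -> itv_partition 0 1 t -> small_arcs c r s -> small_arcs d r t ->
  linking_number c d (lk (inscribed c s) (inscribed d t)).
Proof.
move=> c01 d01 sep [eps eps0 fine] ps pt fs ft; exists eps => // s' t' fs' ft' u ru.
have [[ps' _] [pt' _]] := (fs', ft').
have [fs1 _] := fine _ fs'; have [_ ft1] := fine _ ft'.
rewrite (crossing_sum_curves c01 d01 sep ps' pt' fs1 ft1 ru).
by rewrite (lk_curves c01 d01 sep ps' ps pt' pt fs1 fs ft1 ft).
Qed.

(** Uniqueness, for the curves of H. The fine subdivisions of the hypotheses and a regular direction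
    for their polygons keep [linking_number] from being vacuous. *)
Lemma linking_number_uniq c d r s t k : c 0 = c 1 -> d 0 = d 1 ->
  (forall a b, 0 <= a <= 1 -> 0 <= b <= 1 -> 2 * r <= `|c a - d b|) ->
  (forall eps, 0 < eps -> exists2 s, fine_subdivision eps s & small_arcs c r s) ->
  (forall eps, 0 < eps -> exists2 t, fine_subdivision eps t & small_arcs d r t) ->
  itv_partition 0 1 s -> itv_partition 0 1 t -> small_arcs c r s -> small_arcs d r t ->
  linking_number c d k -> k = lk (inscribed c s) (inscribed d t).
Proof.
move=> c01 d01 sep finec fined ps pt fs ft [eps eps0 h].
have [q fq fcq] := finec eps eps0; have [pq _] := fq.
have [q' fq' fdq] := fined eps eps0; have [pq' _] := fq'.
have ap : apart (sides (map c q)) (sides (map d q')).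
  apply: (@apart_sub _ (inscribed c q) _ (inscribed d q')).
  - by move=> e; rewrite (perm_mem (sides_inscribed c01 pq)).
  - by move=> e; rewrite (perm_mem (sides_inscribed d01 pq')).
  - exact: (inscribed_apart pq fcq (far_inscribed pq' fdq sep)).
have [u /regular_regular_direction ru] := regular_exists ap.
have := h q q' fq fq' u ru; rewrite (crossing_sum_curves c01 d01 sep pq pq' fcq fdq ru).
by rewrite (lk_curves c01 d01 sep pq ps pq' pt fcq fs fdq ft); lia.
Qed.
End Curves.

Lemma path_steps (T : eqType) (r : rel T) x s : path r x s <->
  (forall e, e \in pairmap pair x s -> r e.1 e.2).
Proof.
elim: s x => //= y s IH x; split=> [/andP[xy /IH ys] e|h].
  by rewrite inE => /predU1P[->|/ys].
rewrite (h (x, y)) ?inE ?eqxx //=; apply/IH => e es.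
by apply: h; rewrite inE es orbT.
Qed.

Section Uniform.
Variable R : realType.

Definition uniform (K : nat) : seq R := [seq k.+1%:R / K%:R | k <- iota 0 K].

Lemma steps_iota (T : Type) (g : nat -> T) m K :
  pairmap pair (g m) [seq g k.+1 | k <- iota m K] = [seq (g k, g k.+1) | k <- iota m K].
Proof. by elim: K m => //= K IH m; rewrite IH. Qed.

Lemma steps_uniform K :
  pairmap pair 0 (uniform K) = [seq (k%:R / K%:R, k.+1%:R / K%:R) | k <- iota 0 K].
Proof. by rewrite -(steps_iota (fun k => k%:R / K%:R)) mul0r. Qed.

(** Groups the steps of a subdivision by the arc to which they belong. *)
Lemma iota_blocks N m n : iota (m * N) (n * N) =
  flatten [seq [seq (i * N + j)%N | j <- iota 0 N] | i <- iota m n].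
Proof.
elim: n m => //= n IH m.
by rewrite mulSn iotaD -mulSnr IH -[X in iota X N]addn0 iotaDl.
Qed.

Lemma uniform_partition K : (0 < K)%N -> itv_partition 0 1 (uniform K).
Proof.
move=> K0; have K0' : 0 < K%:R :> R by rewrite ltr0n.
split; last first.
  rewrite /uniform -[K in iota _ K](prednK K0) -addn1 iotaD map_cat last_cat /=.
  by rewrite add0n prednK // divff // gt_eqF.
apply/path_steps => e; rewrite steps_uniform => /mapP[k _ ->] /=.
by rewrite ltr_pM2r ?invr_gt0 // ltr_nat.
Qed.

Lemma uniform_fine K (eps : R) : (0 < K)%N -> K%:R^-1 < eps -> fine_subdivision eps (uniform K).
Proof.
move=> K0 Ke; split; first exact: uniform_partition.
apply/path_steps => e; rewrite steps_uniform => /mapP[k _ ->] /=.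
by rewrite -mulrBl -addn1 natrD addrAC subrr add0r mul1r.
Qed.

Lemma grid n (a : R) : (0 < n)%N -> 0 <= a <= 1 ->
  exists i t, [/\ (i < n)%N, 0 <= t <= 1 & a = (i%:R + t) / n%:R].
Proof.
move=> n0 /andP[a0 a1]; have n0' : 0 < n%:R :> R by rewrite ltr0n.
have an : 0 <= a * n%:R by rewrite mulr_ge0 ?ler0n.
have [a1'|] := ltP a 1; last first.
  move=> a1'; have -> : a = 1 by apply/eqP; rewrite eq_le a1.
  (* The point 1 is put in the last cell, with t = 1, so that the index stays below n. *)
  exists n.-1, 1; split; [by rewrite prednK|by rewrite ler01 lexx|].
  by rewrite natr1 prednK // divff // gt_eqF.
have /andP[h1 h2] := truncn_itv an.
exists (Num.truncn (a * n%:R)), (a * n%:R - (Num.truncn (a * n%:R))%:R); split.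
- by rewrite -(ltr_nat R) (le_lt_trans h1) // gtr_pMl.
- by move: h2; rewrite -natr1 => h2; clear -h1 h2; lra.
- by rewrite addrC subrK mulfK // gt_eqF.
Qed.
End Uniform.

Definition cycle_steps (T : Type) (c : seq T) : seq (T * T) := zip c (rot 1 c).

Lemma mem_cycle_steps (T : eqType) (c : seq T) x0 i : (i < size c)%N ->
  (nth x0 c i, nth x0 (rot 1 c) i) \in cycle_steps c.
Proof.
move=> ic; rewrite /cycle_steps -nth_zip ?size_rot // mem_nth //.
by rewrite size_zip size_rot minnn.
Qed.

(** * The curve of a cycle, cut into its arcs *)

Section CycleCurve.
Variables (R : realType) (G : digraph) (phi : embedding R G).
Implicit Types (c : seq G) (x y : G).

Definition arc_steps N x y : seq (space3 R * space3 R) :=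
  [seq (arc phi x y (k%:R / N%:R), arc phi x y (k.+1%:R / N%:R)) | k <- iota 0 N].

Definition cycle_chain N c : seq (space3 R * space3 R) :=
  flatten [seq arc_steps N e.1 e.2 | e <- cycle_steps c].

Lemma cycle_step_next c e : dicycle c -> e \in cycle_steps c ->
  [/\ edge e.1 e.2, e.1 \in c, e.2 \in c & e.2 = next c e.1].
Proof.
case/and3P; case: c => // x p _ u cyc; rewrite /cycle_steps zip_rot1 => es.
have h : e.1 \in x :: p /\ e.2 \in x :: p.
  by have := mem_steps es; rewrite !inE !mem_rcons !inE orbA orbb.
have [h1 h2] := h.
have ee : edge e.1 e.2.
  move: cyc es {u h h1 h2} => /=; move: (rcons p x) => q.
  elim: q x => //= y q IH x /andP[xy yq].
  by rewrite inE => /predU1P[-> //|]; exact: IH.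
split=> //.
move: es; rewrite -zip_rot1.
case/(nthP (x, x)) => i; rewrite size_zip size_rot minnn => ilt.
rewrite nth_zip ?size_rot // => ei; rewrite -ei; cbn [fst snd].
rewrite next_nth mem_nth //.
rewrite index_uniq // rot1_cons nth_rcons; case: ltnP => // pi.
by rewrite nth_default // if_same.
Qed.

Lemma cycle_curveE c x0 i (t : R) : dicycle c -> (i < size c)%N -> 0 <= t <= 1 ->
  cycle_curve phi c ((i%:R + t) / (size c)%:R) =
  arc phi (nth x0 c i) (nth x0 (rot 1 c) i) t.
Proof.
move=> dc ic /andP[t0 t1].
have n0 : 0 < (size c)%:R :> R by rewrite ltr0n (leq_ltn_trans _ ic).
have stepP j : (j < size c)%N -> (nth x0 c j, nth x0 (rot 1 c) j) \in cycle_steps c.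
  exact: mem_cycle_steps.
have nextE j : (j < size c)%N -> next c (nth x0 c j) = nth x0 (rot 1 c) j.
  by move=> jc; have [_ _ _ e] := cycle_step_next dc (stepP j jc); exact: esym e.
have rotE j : (j < size c)%N -> nth x0 (rot 1 c) j = nth x0 c (j.+1 %% size c).
  case: (c) => // y p jc; rewrite rot1_cons nth_rcons /=.
  have [jp|pj] := ltnP j (size p); first by rewrite modn_small.
  have -> : j = size p by apply/eqP; rewrite eqn_leq pj andbT.
  by rewrite eqxx modnn.
(* The index [size c] is allowed and wraps to 0: at the end of an arc, truncation already selects
   the beginning of the next one, and both are the same vertex. *)
have curveE j (s : R) : 0 <= s < 1 -> (j <= size c)%N ->
    cycle_curve phi c ((j%:R + s) / (size c)%:R) =
    arc phi (nth x0 c (j %% size c)) (nth x0 (rot 1 c) (j %% size c)) s.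
  move=> /andP[s0 s1] jc; rewrite /cycle_curve.
  case: (c) dc ic n0 jc nextE {stepP rotE} => // y p dc ic n0 jc nextE.
  have tr : Num.truncn ((j%:R + s) / (size (y :: p))%:R * (size (y :: p))%:R) = j.
    rewrite divfK ?gt_eqF //; apply/eqP; rewrite truncn_eq ?addr_ge0 ?ler0n //.
    by rewrite lerDl s0 -natr1 ltrD2l.
  rewrite tr divfK ?gt_eqF // addrAC subrr add0r.
  have jm : (j %% size (y :: p) < size (y :: p))%N by rewrite ltn_mod.
  by rewrite (set_nth_default x0 y jm) nextE.
have [t1'|] := ltP t 1.
  by rewrite curveE ?t0 // ?modn_small // ltnW.
move=> t1'; have -> : t = 1 by apply/eqP; rewrite eq_le t1.
rewrite natr1 -[i.+1%:R]addr0 curveE ?lexx ?ltr01 //.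
have im : (i.+1 %% size c < size c)%N by rewrite ltn_mod (leq_ltn_trans _ ic).
have [e1 _ _ _] := cycle_step_next dc (stepP _ im).
have [e2 _ _ _] := cycle_step_next dc (stepP _ ic).
by rewrite arc0 // arc1 // rotE.
Qed.

Lemma cycle_curve01 c : dicycle c -> cycle_curve phi c 0 = cycle_curve phi c 1.
Proof.
move=> dc; have n0 : (0 < size c)%N by case/and3P: dc; case: c.
case: (c) dc n0 => // x p dc n0.
have z : 0 = (0%:R + 0) / (size (x :: p))%:R :> R by rewrite addr0 mul0r.
have o : 1 = ((size p)%:R + 1) / (size (x :: p))%:R :> R.
  by rewrite natr1 divff // pnatr_eq0.
have st i : (i < size (x :: p))%N ->
    (nth x (x :: p) i, nth x (rot 1 (x :: p)) i) \in cycle_steps (x :: p).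
  exact: mem_cycle_steps.
have e0 := @cycle_curveE _ x 0%N 0 dc isT; rewrite -z lexx ler01 in e0.
have e1 := @cycle_curveE _ x (size p) 1 dc (ltnSn _); rewrite -o lexx ler01 in e1.
rewrite e0 // e1 // arc0 ?arc1; first by rewrite rot1_cons nth_rcons ltnn eqxx.
- by have [] := cycle_step_next dc (st _ (ltnSn (size p))).
- by have [] := cycle_step_next dc (st 0%N isT).
Qed.

Lemma cycle_curve_arc c (a : R) : dicycle c -> 0 <= a <= 1 ->
  exists e t, [/\ e \in cycle_steps c, 0 <= t <= 1 & cycle_curve phi c a = arc phi e.1 e.2 t].
Proof.
move=> dc ha; have n0 : (0 < size c)%N by case/and3P: dc; case: c.
have [i [t [ic ht ->]]] := grid n0 ha.
have x0 : G by case: c n0 {dc ic}.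
exists (nth x0 c i, nth x0 (rot 1 c) i), t; split=> //; last exact: cycle_curveE.
exact: mem_cycle_steps.
Qed.

(** With [size c * N] equal steps all vertices are subdivision points, and each arc is sampled in
    the same way whatever cycle it belongs to. Hence chains of different cycles can be compared edge
    by edge. *)
Lemma inscribed_cycle_curve N c : (0 < N)%N -> dicycle c ->
  inscribed (cycle_curve phi c) (uniform R (size c * N)) = cycle_chain N c.
Proof.
move=> N0 dc; have n0 : (0 < size c)%N by case/and3P: dc; case: c.
have [x0 _] : exists x0 : G, true by case: (c) n0 => // x p _; exists x.
have N0' : N%:R != 0 :> R by rewrite pnatr_eq0 -lt0n.
have n0' : (size c)%:R != 0 :> R by rewrite pnatr_eq0 -lt0n.
have -> : cycle_chain N c = flatten [seq arc_steps N (nth x0 c i) (nth x0 (rot 1 c) i)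
    | i <- iota 0 (size c)].
  rewrite /cycle_chain; congr flatten.
  have -> : cycle_steps c = [seq (nth x0 c i, nth x0 (rot 1 c) i) | i <- iota 0 (size c)].
    apply: (@eq_from_nth _ (x0, x0)).
      by rewrite size_zip size_rot minnn size_map size_iota.
    move=> i; rewrite size_zip size_rot minnn => ic.
    by rewrite nth_zip ?size_rot // (nth_map 0%N) ?size_iota // nth_iota.
  by rewrite -map_comp.
rewrite /inscribed steps_uniform -map_comp.
rewrite (iota_blocks N 0).
rewrite map_flatten -map_comp; congr flatten; apply/eq_in_map => i /=.
rewrite mem_iota add0n => /andP[_ ic]; rewrite /arc_steps -map_comp.
apply/eq_in_map => j /=; rewrite mem_iota add0n => /andP[_ jN].
have val (k : nat) : (k <= N)%N ->
    cycle_curve phi c ((i * N + k)%:R / (size c * N)%:R) =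
    arc phi (nth x0 c i) (nth x0 (rot 1 c) i) (k%:R / N%:R).
  move=> kN; rewrite -cycle_curveE //.
    congr (cycle_curve phi c _); rewrite natrD !natrM; field.
    by rewrite n0' N0'.
  rewrite divr_ge0 ?ler0n //= ler_pdivrMr ?ltr0n // mul1r ler_nat //.
by rewrite -addnS !val // ltnW.
Qed.
End CycleCurve.

(** * Uniform subdivisions of embedded cycles *)

Section Compactness.
Variable R : realType.
Notation V := (space3 R).
Implicit Types (f g : R -> V) (r : R).

Lemma within_itv_cvg f (x : R) : {within `[0, 1], continuous f} -> 0 <= x <= 1 ->
  forall r, 0 < r -> exists2 d, 0 < d & forall y, 0 <= y <= 1 -> `|x - y| < d -> `|f x - f y| < r.
Proof.
move=> /subspace_continuousP fc hx r r0.
have /cvgrPdist_lt /(_ r r0) : f @ within `[0, 1]%classic (nbhs x) --> f x.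
  by apply: fc; rewrite /= in_itv.
rewrite near_withinE => /nbhs_ballP[d /= d0 h]; exists d => // y hy xy.
by apply: h => //=; rewrite in_itv.
Qed.

Lemma uniformly_continuous f : {within `[0, 1], continuous f} -> forall r, 0 < r ->
  exists2 d, 0 < d & forall x y, 0 <= x <= 1 -> 0 <= y <= 1 -> `|x - y| < d -> `|f x - f y| < r.
Proof.
move=> fc r r0.
(* Near each x the bound holds for all small positive d; compactness makes d uniform in x. *)
have /near_covering_withinP/(_ R (0^'+)
  (fun d x => forall y, 0 <= y <= 1 -> `|x - y| < d -> `|f x - f y| < r) _) :=
  (compact_near_coveringP _).1 (@segment_compact R 0 1).
case.
  move=> x; rewrite /= in_itv /= => hx.
  have r20 : 0 < r / 2 by rewrite divr_gt0.
  have [d d0 h] := within_itv_cvg fc hx r20.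
  have d20 : 0 < d / 2 by rewrite divr_gt0.
  exists (ball x (d / 2), [set e | 0 < e < d / 2]) => /=.
    split; first exact: nbhsx_ballx.
    by near=> e; rewrite /=; apply/andP; split; near: e; [exact: nbhs_right_gt|exact: nbhs_right_lt].
  move=> [x' e] [/= xx' /andP[e0 e2]]; rewrite in_itv /= => hx' y hy x'y.
  have h1 : `|f x - f x'| < r / 2.
    by apply: h => //; apply: lt_trans xx' _; rewrite ltr_pdivrMr // mulr2n mulrDr mulr1 ltrDl.
  have h2 : `|f x - f y| < r / 2.
    apply: h => //; apply: le_lt_trans (ler_distD x' _ _) _.
    have xx2 : `|x - x'| < d / 2 := xx'.
    by rewrite [d](splitr) ltrD // (lt_trans x'y).
  apply: le_lt_trans (ler_distD (f x) _ _) _.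
  by rewrite distrC [r]splitr ltrD.
move=> d /= d0 h; exists (d / 2); first by rewrite divr_gt0.
move=> x y hx hy xy; apply: (h (d / 2)) => //=.
- by rewrite sub0r normrN gtr0_norm ?divr_gt0 // ltr_pdivrMr // mulr2n mulrDr mulr1 ltrDl.
- by rewrite divr_gt0.
Unshelve. all: by end_near. Qed.

(** For fixed x the distance to the second curve has a positive minimum m and stays above m / 2 for
    nearby points of the first; compactness gives a uniform bound. *)
Lemma curve_distance f g : {within `[0, 1], continuous f} -> {within `[0, 1], continuous g} ->
  (forall x y, 0 <= x <= 1 -> 0 <= y <= 1 -> f x <> g y) ->
  exists2 r, 0 < r & forall x y, 0 <= x <= 1 -> 0 <= y <= 1 -> r <= `|f x - g y|.
Proof.
move=> fc gc fg.
have pt x : 0 <= x <= 1 -> exists2 r, 0 < r & forall y, 0 <= y <= 1 -> r <= `|f x - g y|.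
  move=> hx.
  have [||c] := @compact_EVT_min R R (fun y => `|f x - g y|) `[0, 1]%classic _ (@segment_compact R 0 1).
  - by exists 0; rewrite /= in_itv /= lexx ler01.
  - move=> y; apply: cvg_norm; apply: cvgB; first exact: cvg_cst.
    exact: gc.
  rewrite inE /= in_itv /= => hc h; exists `|f x - g c|.
    by rewrite normr_gt0 subr_eq0; apply/eqP; exact: fg.
  by move=> y hy; apply: h; rewrite inE /= in_itv.
have /near_covering_withinP/(_ R (0^'+)
  (fun d x => forall y, 0 <= y <= 1 -> d <= `|f x - g y|) _) :=
  (compact_near_coveringP _).1 (@segment_compact R 0 1).
case.
  move=> x; rewrite /= in_itv /= => hx.
  have [m m0 hm] := pt x hx.
  have m20 : 0 < m / 2 by rewrite divr_gt0.
  have [d d0 h] := within_itv_cvg fc hx m20.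
  exists (ball x d, [set e | e < m / 2]) => /=.
    split; first exact: nbhsx_ballx.
    by near=> e; near: e; exact: nbhs_right_lt.
  move=> [x' e] [/= xx' e2]; rewrite in_itv /= => hx' y hy.
  have h1 : `|f x - f x'| < m / 2 by exact: h.
  have := hm y hy; have := ler_distD (f x') (f x) (g y).
  by clear -h1 e2; lra.
move=> d /= d0 h; exists (d / 2); first by rewrite divr_gt0.
move=> x y hx hy; apply: (h (d / 2)) => //=.
- by rewrite sub0r normrN gtr0_norm ?divr_gt0 // ltr_pdivrMr // mulr2n mulrDr mulr1 ltrDl.
- by rewrite divr_gt0.
Unshelve. all: by end_near. Qed.
End Compactness.

(** * From linked curves to sampled polygons and back *)

Section NoLinks.
Variables (R : realType) (G : digraph) (phi : embedding R G).
Implicit Types (c : seq G) (x y : G) (r d : R).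

Definition short_arc_steps r N : Prop := forall x y j (s t : R), edge x y -> (j < N)%N ->
  j%:R / N%:R <= s <= j.+1%:R / N%:R -> j%:R / N%:R <= t <= j.+1%:R / N%:R ->
  `|arc phi x y s - arc phi x y t| < r.

Definition arcs_apart r : Prop := forall x y x' y' (s t : R), edge x y -> edge x' y' ->
  x != x' -> x != y' -> y != x' -> y != y' -> 0 <= s <= 1 -> 0 <= t <= 1 ->
  r <= `|arc phi x y s - arc phi x' y' t|.

Definition arc_modulus r (d : R) : Prop := forall x y (s t : R), edge x y ->
  0 <= s <= 1 -> 0 <= t <= 1 -> `|s - t| < d -> `|arc phi x y s - arc phi x y t| < r.

Lemma dicycle_size c : dicycle c -> (0 < size c)%N.
Proof. by case/and3P; case: c. Qed.

Lemma small_arcs_uniform r N c : (0 < N)%N -> short_arc_steps r N -> dicycle c ->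
  small_arcs (cycle_curve phi c) r (uniform R (size c * N)).
Proof.
move=> N0 sh dc e; rewrite steps_uniform => /mapP[k]; rewrite mem_iota add0n => /andP[_ kn] -> /=.
have n0 := dicycle_size dc.
have [x0 _] : exists x0 : G, true by case: (c) n0 => // x p _; exists x.
have Np : 0 < N%:R :> R by rewrite ltr0n.
have np : 0 < (size c)%:R :> R by rewrite ltr0n.
(* Step k of the subdivision is step [k %% N] of arc number [k %/ N]. *)
have ic : (k %/ N < size c)%N by rewrite ltn_divLR.
have jN : (k %% N < N)%N by rewrite ltn_mod.
pose e' := (nth x0 c (k %/ N), nth x0 (rot 1 c) (k %/ N)).
have ee : edge e'.1 e'.2.
  have [] // := @cycle_step_next _ c e' dc _.
  exact: mem_cycle_steps.
have kE : k%:R = (k %/ N)%:R * N%:R + (k %% N)%:R :> R by rewrite -natrM -natrD -divn_eq.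
have par (a : R) : k%:R / (size c * N)%:R <= a <= k.+1%:R / (size c * N)%:R ->
    exists t, (k %% N)%:R / N%:R <= t <= (k %% N).+1%:R / N%:R /\
      cycle_curve phi c a = arc phi e'.1 e'.2 t.
  move=> /andP[a1 a2]; exists (a * (size c)%:R - (k %/ N)%:R).
  have ht : (k %% N)%:R / N%:R <= a * (size c)%:R - (k %/ N)%:R <= (k %% N).+1%:R / N%:R.
    move: a1 a2; rewrite natrM ler_pdivrMr ?mulr_gt0 // ler_pdivlMr ?mulr_gt0 //.
    rewrite !ler_pdivrMr // !ler_pdivlMr // -!natr1 kE mulrBl -mulrA.
    by clear; lra.
  split=> //; rewrite -cycle_curveE //.
    by congr (cycle_curve phi c _); rewrite addrC subrK mulfK // gt_eqF.
  have /andP[t1 t2] := ht; rewrite (le_trans _ t1) ?divr_ge0 ?ler0n //=.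
  by rewrite (le_trans t2) // ler_pdivrMr // mul1r ler_nat.
move=> a b /par[s [hs ->]] /par[t [ht ->]]; exact: (sh _ _ _ _ _ ee jN hs ht).
Qed.

(** A step may pass a vertex and touch two arcs, each contributing less than r / 2. *)
Lemma cycle_curve_modulus r d c : 0 < r -> 0 < d -> arc_modulus (r / 2) d -> dicycle c ->
  exists2 eps, 0 < eps & forall s, fine_subdivision eps s -> small_arcs (cycle_curve phi c) r s.
Proof.
move=> r0 d0 mod dc; have n0 := dicycle_size dc.
have np : 0 < (size c)%:R :> R by rewrite ltr0n.
have [x0 _] : exists x0 : G, true by case: (c) n0 => // x p _; exists x.
have r20 : 0 < r / 2 by rewrite divr_gt0.
have st i : (i < size c)%N -> (nth x0 c i, nth x0 (rot 1 c) i) \in cycle_steps c.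
  exact: mem_cycle_steps.
have ed i (ic : (i < size c)%N) := let: And4 h _ _ _ := cycle_step_next dc (st i ic) in h.
have half (s t : R) i : (i < size c)%N -> 0 <= s <= 1 -> 0 <= t <= 1 -> `|s - t| < d ->
    `|cycle_curve phi c ((i%:R + s) / (size c)%:R) - cycle_curve phi c ((i%:R + t) / (size c)%:R)| < r / 2.
  by move=> ic hs ht sd; rewrite !(cycle_curveE phi x0) //; apply: mod => //; exact: (ed i ic).
(* The bound by 1 keeps both parameters on one arc or on two consecutive ones; the bound by d
   controls each piece. *)
pose m := Num.min d 1.
have m0 : 0 < m by rewrite lt_min d0 ltr01.
have [md m1] : m <= d /\ m <= 1 by rewrite !ge_min !lexx orbT.
have close (a b : R) : 0 <= a -> a < b -> b <= 1 -> b - a < m / (size c)%:R ->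
    `|cycle_curve phi c a - cycle_curve phi c b| < r.
  move=> a0 ab b1; rewrite ltr_pdivlMr // => abm.
  have [i [s [ic hs aE]]] := @grid R _ a n0 ltac:(by rewrite a0 (le_trans (ltW ab))).
  have [j [t [jc ht bE]]] := @grid R _ b n0 ltac:(by rewrite b1 (le_trans a0 (ltW ab))).
  have aE' : a * (size c)%:R = i%:R + s by rewrite aE divfK // gt_eqF.
  have bE' : b * (size c)%:R = j%:R + t by rewrite bE divfK // gt_eqF.
  have abn : a * (size c)%:R < b * (size c)%:R by rewrite ltr_pM2r.
  rewrite mulrBl aE' bE' in abm; rewrite aE' bE' in abn.
  have ij : (i <= j)%N.
    rewrite leqNgt; apply/negP => ji; have : j%:R + 1 <= i%:R :> R by rewrite natr1 ler_nat.
    by clear -abn hs ht; lra.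
  have ji : (j <= i.+1)%N.
    rewrite leqNgt; apply/negP => ji; have : i%:R + 1 + 1 <= j%:R :> R by rewrite !natr1 ler_nat.
    by clear -abm hs ht m1; lra.
  rewrite aE bE; have [jE|ji'] := eqVneq j i.
    subst j; apply: lt_trans (half _ _ _ ic hs ht _) _.
      by rewrite distrC ger0_norm; clear -abn abm md; lra.
    by rewrite ltr_pdivrMr // mulr2n mulrDr mulr1 ltrDl.
  have jE : j = i.+1 by apply/eqP; rewrite eqn_leq ji ltn_neqAle eq_sym ji' ij.
  subst j; rewrite -natr1 in abm abn *.
  have mid : (i%:R + 1) / (size c)%:R = (i.+1%:R + 0) / (size c)%:R :> R by rewrite addr0 natr1.
  have h1 := half s 1 i ic hs ltac:(by rewrite ler01 lexx) _.
  have h2 := half 0 t i.+1 jc ltac:(by rewrite ler01 lexx) ht _.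
  rewrite -mid -natr1 in h2.
  apply: le_lt_trans (ler_distD (cycle_curve phi c ((i%:R + 1) / (size c)%:R)) _ _) _.
  rewrite [r]splitr ltrD ?h1 ?h2 //.
    by rewrite distrC ger0_norm; clear -abm hs ht md; lra.
  by rewrite sub0r normrN ger0_norm; clear -abm hs ht md; lra.
exists (m / (size c)%:R); first by rewrite divr_gt0.
move=> s [ps fine] e es a b ha hb.
have [e0 e12 e1] := steps_bounds ps.1 es; case: (ps) => _ /eqP s1; rewrite s1 in e1.
have fe := (path_steps (fun a b : R => b - a < m / (size c)%:R) 0 s).1 fine e es.
have [ab|ba|->] := ltgtP a b; last by rewrite subrr normr0.
  by apply: close => //; clear -ha hb ab fe e0 e1; lra.
by rewrite distrC; apply: close => //; clear -ha hb ba fe e0 e1; lra.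
Qed.

Lemma cycle_curves_apart r c (d : seq G) : arcs_apart r -> dicycle c -> dicycle d -> disjoint_cycles c d ->
  forall a b, 0 <= a <= 1 -> 0 <= b <= 1 -> r <= `|cycle_curve phi c a - cycle_curve phi d b|.
Proof.
move=> ap dc dd cd a b ha hb.
have [e [s [es hs ->]]] := cycle_curve_arc phi dc ha.
have [f [t [fs ht ->]]] := cycle_curve_arc phi dd hb.
have [ee e1 e2 _] := cycle_step_next dc es; have [ff f1 f2 _] := cycle_step_next dd fs.
have ne x y : x \in c -> y \in d -> x != y.
  by move=> xc yd; apply: contraTneq xc => ->; rewrite (disjointFl cd yd).
by apply: ap; rewrite // ne.
Qed.

Lemma lk_cycle_chain_eq0 r d N : 0 < r -> 0 < d -> (0 < N)%N -> no_linked_dicycles phi ->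
  arcs_apart (2 * r) -> arc_modulus (r / 2) d -> short_arc_steps r N ->
  forall c c', dicycle c -> dicycle c' -> disjoint_cycles c c' ->
  lk (cycle_chain phi N c) (cycle_chain phi N c') = 0.
Proof.
move=> r0 d0 N0 nl ap mod sh c c' dc dc' cc'.
apply: contrapT => /eqP k0; apply: (nl c c' dc dc' cc'); eexists; first exact: k0.
rewrite -!inscribed_cycle_curve //; apply: (@linking_number_inscribed R _ _ r).
- exact: cycle_curve01.
- exact: cycle_curve01.
- exact: cycle_curves_apart.
- have [e1 e10 h1] := cycle_curve_modulus r0 d0 mod dc.
  have [e2 e20 h2] := cycle_curve_modulus r0 d0 mod dc'.
  exists (Num.min e1 e2); first by rewrite lt_min e10.
  have mono (e e' : R) s : e <= e' -> fine_subdivision e s -> fine_subdivision e' s.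
    move=> ee' [ps fs]; split=> //; apply: sub_path fs => a b h; exact: lt_le_trans ee'.
  move=> s fs; split; [apply: h1|apply: h2]; apply: mono fs; by rewrite ge_min lexx ?orbT.
- by apply: uniform_partition; rewrite muln_gt0 N0 dicycle_size.
- by apply: uniform_partition; rewrite muln_gt0 N0 dicycle_size.
- exact: small_arcs_uniform.
- exact: small_arcs_uniform.
Qed.

(** The count is known at M, but [linking_number] only constrains subdivisions below an unknown eps.
    All multiples of M are therefore required to have small steps, and the count at M is compared
    with that of a finer polygon. *)
Lemma no_linked_of_lk r M : (0 < M)%N -> arcs_apart (2 * r) ->
  (forall L, (0 < L)%N -> short_arc_steps r (M * L)) ->
  (forall c c', dicycle c -> dicycle c' -> disjoint_cycles c c' ->
     lk (cycle_chain phi M c) (cycle_chain phi M c') = 0) ->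
  no_linked_dicycles phi.
Proof.
move=> M0 ap sh lk0 c c' dc dc' cc' [k k0 lkk]; move/eqP: k0; apply.
have sh1 : short_arc_steps r M by rewrite -[M]muln1; exact: sh.
have finer b : dicycle b -> forall eps, 0 < eps ->
    exists2 s, fine_subdivision eps s & small_arcs (cycle_curve phi b) r s.
  move=> db eps eps0; have b0 := dicycle_size db.
  (* Any L above 1 / eps works, as the number of steps is a multiple of L. *)
  pose L := (Num.truncn eps^-1).+1.
  exists (uniform R (size b * (M * L))); last by apply: small_arcs_uniform; rewrite ?muln_gt0 ?M0 //; exact: sh.
  apply: uniform_fine; first by rewrite !muln_gt0 b0 M0.
  have Le : eps^-1 < L%:R by have /andP[] := truncn_itv (ltW (etrans (invr_gt0 _) eps0)).
  rewrite -[eps]invrK ltf_pV2 ?posrE ?invr_gt0 // ?ltr0n ?muln_gt0 ?b0 ?M0 //.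
  apply: lt_le_trans Le _; rewrite ler_nat mulnA leq_pmull // muln_gt0 b0 //.
rewrite -(lk0 c c' dc dc' cc') -!inscribed_cycle_curve //.
apply: (linking_number_uniq (r := r)) lkk.
- exact: cycle_curve01.
- exact: cycle_curve01.
- exact: cycle_curves_apart.
- exact: finer.
- exact: finer.
- by apply: uniform_partition; rewrite muln_gt0 M0 dicycle_size.
- by apply: uniform_partition; rewrite muln_gt0 M0 dicycle_size.
- exact: small_arcs_uniform.
- exact: small_arcs_uniform.
Qed.
End NoLinks.

(** * Lifting the cycles of H *)

Section Pieces.
Variable T : eqType.
Implicit Types (x y z : T) (s t : seq T).

(** As for [pairmap], a walk is the list of its vertices after the first. *)
Definition walk_from z t x : seq T := take (index x (z :: t)) t.

(** For y = z the general formula would give a full turn instead of staying at z. *)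
Definition walk_to z t y : seq T :=
  if y == z then [::] else rcons (drop (index y (z :: t)) t) z.

Lemma walk_from_pivot z t1 x t2 : uniq (z :: t1 ++ x :: t2) ->
  walk_from z (t1 ++ x :: t2) x = rcons t1 x.
Proof.
rewrite /= mem_cat cat_uniq !inE !negb_or => /andP[/and3P[_ zx _] /and3P[_ /andP[xt1 _] _]].
rewrite /walk_from /= (negbTE zx) index_pivot // -cat_rcons take_size_cat //.
by rewrite size_rcons.
Qed.

Lemma walk_to_pivot z t1 y t2 : uniq (z :: t1 ++ y :: t2) ->
  walk_to z (t1 ++ y :: t2) y = rcons t2 z.
Proof.
rewrite /= mem_cat cat_uniq !inE !negb_or => /andP[/and3P[_ zy _] /and3P[_ /andP[yt1 _] _]].
rewrite /walk_to eq_sym (negbTE zy) /= (negbTE zy) index_pivot // -cat_rcons drop_size_cat //.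
by rewrite size_rcons.
Qed.

Lemma walk_from_split z t x : uniq (z :: t) -> x \in z :: t ->
  exists t2, t = walk_from z t x ++ t2 /\ last z (walk_from z t x) = x.
Proof.
move=> u; rewrite inE => /predU1P[->|xt].
  by exists t; rewrite /walk_from /= eqxx take0.
case/splitPr: xt u => t1 t2 u; rewrite walk_from_pivot //.
by exists t2; rewrite cat_rcons last_rcons.
Qed.

(* Entering the cycle z :: t at y, going on to z, and then from z to the exit x
   amounts to a path from y to x, plus one full turn if x does not precede y. *)
Lemma through_cycle z t y x : uniq (z :: t) -> y \in z :: t -> x \in z :: t ->
  exists q (turn : bool), [/\ uniq (y :: q), {subset y :: q <= z :: t}, last y q = x,
    turn -> t != [::] &
    perm_eq (pairmap pair y (walk_to z t y) ++ pairmap pair z (walk_from z t x))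
      (pairmap pair y q ++ if turn then pairmap pair z (rcons t z) else [::])].
Proof.
move=> u yt xt; have [yz|yz] := eqVneq y z.
  subst y; have [t2 [tE lx]] := walk_from_split u xt.
  exists (walk_from z t x), false; split=> //.
  - by move: u; rewrite [in uniq _]tE /= mem_cat cat_uniq negb_or => /andP[/andP[-> _] /andP[->]].
  - by move=> v; rewrite [in z :: t]tE !inE mem_cat => /orP[->//|->]; rewrite orbT.
  - by rewrite /walk_to eqxx cats0.
move: yt; rewrite inE (negbTE yz) /= => yt.
case/splitPr: yt u xt => t1 t2 u; rewrite walk_to_pivot //.
(* If x precedes y, going from y to z and on to x repeats no vertex. *)
rewrite -cat_cons mem_cat => /orP[] xt.
  have [t3 [tE lx]] : exists t3, t1 = walk_from z t1 x ++ t3 /\ last z (walk_from z t1 x) = x.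
    by apply: walk_from_split => //; move: u; rewrite -cat_cons cat_uniq => /andP[].
  have -> : walk_from z (t1 ++ y :: t2) x = walk_from z t1 x.
    rewrite /walk_from -cat_cons index_cat xt take_cat; case: ltnP => // h.
    have e : index x (z :: t1) = size t1 by apply/eqP; rewrite eqn_leq h -ltnS index_mem xt.
    by rewrite e subnn take0 cats0 take_size.
  exists (rcons t2 z ++ walk_from z t1 x), false; split=> //.
  - have p : perm_eq ((z :: t1) ++ (y :: t2)) ((y :: t2) ++ (z :: t1)) by rewrite perm_catC.
    move: u; rewrite -cat_cons (perm_uniq p) [in uniq _]tE -cat_cons catA cat_uniq.
    by rewrite cat_rcons => /andP[].
  - move=> v; rewrite [in (z :: t1) ++ _]tE !(inE, mem_cat, mem_rcons).
    by case: eqP => //=; case: eqP => //= _ _; case: (v \in t2) => /=; rewrite ?orbT // => ->.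
  - by rewrite last_cat last_rcons.
  - by rewrite cats0 pairmap_cat last_rcons.
(* Otherwise x is y or follows it: the walk comes back to y and then covers the stretch from y to x
   a second time. *)
have [q [t3 [tE lx fE]]] : exists q t3, [/\ t2 = q ++ t3, last y q = x &
    walk_from z (t1 ++ y :: t2) x = t1 ++ y :: q].
  move: xt; rewrite inE => /predU1P[->|xt].
    by exists [::], t2; rewrite walk_from_pivot // cats1.
  case/splitPr: xt u => p1 p2 u; exists (rcons p1 x), p2; rewrite cat_rcons last_rcons; split=> //.
  by rewrite -cat_cons catA walk_from_pivot -?catA // rcons_cat.
exists q, true; split=> //.
- by move: u; rewrite tE -cat_cons cat_uniq -cat_cons cat_uniq => /and3P[_ _ /andP[]].
- by move=> v; rewrite tE !(inE, mem_cat) => /orP[->|->]; rewrite ?orbT.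
- by case: (t1).
rewrite fE tE !rcons_cat /= !rcons_cat !pairmap_cat /= !pairmap_cat lx.
set A := pairmap _ y q; set B := pairmap _ x _; set C := pairmap _ z t1.
by rewrite -catA perm_cat2l perm_catC -!catA perm_cat2l /=.
Qed.

Lemma walk_to_steps z t y : uniq (z :: t) -> y \in z :: t ->
  last y (walk_to z t y) = z /\
  {subset pairmap pair y (walk_to z t y) <= pairmap pair z (rcons t z)}.
Proof.
move=> u; rewrite inE => /predU1P[->|yt]; first by rewrite /walk_to eqxx.
case/splitPr: yt u => t1 t2 u; rewrite walk_to_pivot // last_rcons; split=> // e.
by rewrite rcons_cat /= pairmap_cat mem_cat /= inE => ->; rewrite !orbT.
Qed.

Lemma walk_from_steps z t x : uniq (z :: t) -> x \in z :: t ->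
  {subset pairmap pair z (walk_from z t x) <= pairmap pair z (rcons t z)}.
Proof.
move=> u xt e; have [t2 [tE _]] := walk_from_split u xt.
by rewrite [in rcons t z]tE rcons_cat pairmap_cat mem_cat => ->.
Qed.
End Pieces.

(** * Cycles obtained by concatenating paths *)

Section ConcatenatedCycle.
Variables (T U : eqType) (hd : T -> U) (tl : T -> seq U).
Implicit Types (i : T) (p c : seq T).

Let block i := hd i :: tl i.

Lemma last_blocks i p :
  last (last (hd i) (tl i)) (flatten (map block p)) = last (hd (last i p)) (tl (last i p)).
Proof. by elim: p i => //= j p IH i; rewrite last_cat IH. Qed.

Lemma steps_blocks i p :
  perm_eq (pairmap pair (last (hd i) (tl i)) (flatten (map block p)))
    (flatten [seq pairmap pair (hd j) (tl j) | j <- p] ++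
     [seq (last (hd e.1) (tl e.1), hd e.2) | e <- pairmap pair i p]).
Proof.
elim: p i => //= j p IH i; apply/permP => f.
by rewrite pairmap_cat /= !count_cat (permP (IH j)) !count_cat /=; lia.
Qed.

Lemma cycle_steps_blocks c : c != [::] ->
  perm_eq (cycle_steps (flatten (map block c)))
    (flatten [seq pairmap pair (hd j) (tl j) | j <- c] ++
     [seq (last (hd e.1) (tl e.1), hd e.2) | e <- cycle_steps c]).
Proof.
case: c => // i p _; rewrite /cycle_steps [flatten _]/= !zip_rot1 /=.
rewrite rcons_cat pairmap_cat -catA perm_cat2l -!cats1 !pairmap_cat last_blocks map_cat /= catA.
by rewrite perm_cat2r steps_blocks.
Qed.

Lemma uniq_blocks c : uniq c -> (forall i, i \in c -> uniq (block i)) ->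
  (forall i j u, i \in c -> j \in c -> u \in block i -> u \in block j -> i = j) ->
  uniq (flatten (map block c)).
Proof.
elim: c => // i c IH /andP[ic uc] ub disj.
rewrite [flatten _]/= -cat_cons cat_uniq ub ?inE ?eqxx //= IH ?andbT //.
- apply/hasPn => u /flatten_mapP[j jc uj]; apply/negP => ui.
  by move: ic; rewrite (disj i j u) ?inE ?eqxx ?jc ?orbT.
- by move=> j jc; apply: ub; rewrite inE jc orbT.
- by move=> j k u jc kc; apply: disj; rewrite inE ?jc ?kc orbT.
Qed.
End ConcatenatedCycle.

Lemma sum_cycle_steps1 (T : eqType) (F : T -> int) c :
  \sum_(e <- cycle_steps c) F e.1 = \sum_(i <- c) F i.
Proof.
have -> : \sum_(i <- c) F i = \sum_(i <- unzip1 (cycle_steps c)) F i.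
  by rewrite unzip1_zip ?size_rot.
by rewrite big_map.
Qed.

Lemma sum_cycle_steps2 (T : eqType) (F : T -> int) c :
  \sum_(e <- cycle_steps c) F e.2 = \sum_(i <- c) F i.
Proof.
have -> : \sum_(i <- c) F i = \sum_(i <- unzip2 (cycle_steps c)) F i.
  by rewrite unzip2_zip ?size_rot //; apply: perm_big; rewrite perm_sym perm_rot.
by rewrite big_map.
Qed.

Section Lift.
Variables (G H : digraph) (V : H -> {set G}).
Variables (root : H -> G) (rest : H -> seq G) (exit entry : H -> H -> G).
Hypothesis V_disj : forall i j v, v \in V i -> v \in V j -> i = j.
Hypothesis rest_V : forall i v, v \in root i :: rest i -> v \in V i.
Hypothesis rest_uniq : forall i, uniq (root i :: rest i).
Hypothesis rest_cycle : forall i, rest i != [::] -> cycle (@edge G) (root i :: rest i).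
Hypothesis exit_rest : forall i j, edge i j -> exit i j \in root i :: rest i.
Hypothesis entry_rest : forall i j, edge i j -> entry i j \in root j :: rest j.
Hypothesis edge_link : forall i j, edge i j -> edge (exit i j) (entry i j).

(* The walk representing the edge ij runs forward on both Hamiltonian cycles. *)
Definition walk i j : seq G := walk_from (root i) (rest i) (exit i j) ++
  entry i j :: walk_to (root j) (rest j) (entry i j).

Lemma last_walk i j : edge i j -> last (root i) (walk i j) = root j.
Proof.
move=> ij; rewrite last_cat /=.
by have [] := walk_to_steps (rest_uniq j) (entry_rest ij).
Qed.

Lemma steps_walk i j : edge i j -> pairmap pair (root i) (walk i j) =
  pairmap pair (root i) (walk_from (root i) (rest i) (exit i j)) ++
  (exit i j, entry i j) :: pairmap pair (entry i j) (walk_to (root j) (rest j) (entry i j)).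
Proof.
move=> ij; rewrite pairmap_cat /=.
by have [_ [_ ->]] := walk_from_split (rest_uniq i) (exit_rest ij).
Qed.

Lemma dicycle_rest i : rest i != [::] -> dicycle (root i :: rest i).
Proof. by move=> ri; apply/and3P; split=> //; exact: rest_cycle. Qed.

Lemma cycle_steps_cons (T : Type) (x : T) p : cycle_steps (x :: p) = pairmap pair x (rcons p x).
Proof. exact: zip_rot1. Qed.

Lemma steps_rest_edge i e : e \in cycle_steps (root i :: rest i) -> rest i != [::] ->
  edge e.1 e.2.
Proof. by move=> es /dicycle_rest dr; have [] := cycle_step_next dr es. Qed.

Lemma steps_walk_edge i j e : edge i j -> e \in pairmap pair (root i) (walk i j) ->
  edge e.1 e.2 /\ forall v, v = e.1 \/ v = e.2 -> v \in V i \/ v \in V j.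
Proof.
move=> ij.
have inR k f : f \in cycle_steps (root k :: rest k) -> forall v, v = f.1 \/ v = f.2 -> v \in V k.
  rewrite cycle_steps_cons => /mem_steps[h1 h2] v; rewrite inE mem_rcons orbA orbb in h1.
  by rewrite mem_rcons in h2; case=> ->; exact: rest_V.
rewrite steps_walk // mem_cat inE => /or3P[es|/eqP ->|es].
- have es' : e \in cycle_steps (root i :: rest i).
    by rewrite cycle_steps_cons; apply: walk_from_steps es => //; exact: exit_rest.
  split; last by move=> v /(inR i e es'); left.
  by apply: (steps_rest_edge es'); apply: contraTneq es => ->.
- split; first exact: edge_link.
  by move=> v [] ->; [left; apply/rest_V/exit_rest|right; apply/rest_V/entry_rest].
- have [_ sub] := walk_to_steps (rest_uniq j) (entry_rest ij).
  have es' : e \in cycle_steps (root j :: rest j) by rewrite cycle_steps_cons; exact: sub.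
  split; last by move=> v /(inR j e es'); right.
  apply: (steps_rest_edge es'); apply: contraTneq es => r0.
  by have := entry_rest ij; rewrite r0 inE => /eqP ->; rewrite /walk_to eqxx.
Qed.

(* The closed walk covering c splits into one dicycle and full turns around some V i. *)
Lemma lift_dicycle c : dicycle c -> exists L : seq (seq G),
  (forall z, z \in L -> dicycle z /\ forall v, v \in z -> exists2 i, i \in c & v \in V i) /\
  forall g : G * G -> int,
    \sum_(e <- cycle_steps c) \sum_(s <- pairmap pair (root e.1) (walk e.1 e.2)) g s =
    \sum_(z <- L) \sum_(s <- cycle_steps z) g s.
Proof.
move=> dc; have /and3P[c0 uc cyc] := dc.
(* The vertices at which the closed walk leaves and enters each class. *)
pose X i := exit i (next c i); pose Y j := entry (prev c j) j.
have en i : i \in c -> edge i (next c i) by exact: next_cycle.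
have ep i : i \in c -> edge (prev c i) i by exact: prev_cycle.
have XR i : i \in c -> X i \in root i :: rest i by move=> ic; apply/exit_rest/en.
have YR i : i \in c -> Y i \in root i :: rest i by move=> ic; apply/entry_rest/ep.
have : forall i, exists qb : seq G * bool, i \in c ->
    [/\ uniq (Y i :: qb.1), {subset Y i :: qb.1 <= root i :: rest i}, last (Y i) qb.1 = X i,
    qb.2 -> rest i != [::] &
    perm_eq (pairmap pair (Y i) (walk_to (root i) (rest i) (Y i)) ++
        pairmap pair (root i) (walk_from (root i) (rest i) (X i)))
      (pairmap pair (Y i) qb.1 ++ if qb.2 then cycle_steps (root i :: rest i) else [::])].
  move=> i; have [ic|_] := boolP (i \in c); last by exists ([::], false).
  have [q [b h]] := through_cycle (rest_uniq i) (YR i ic) (XR i ic).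
  by exists (q, b); rewrite cycle_steps_cons.
case/choice => qb qbP; pose q i := (qb i).1; pose b i := (qb i).2.
pose z0 := flatten [seq Y i :: q i | i <- c].
have z0steps : perm_eq (cycle_steps z0) (flatten [seq pairmap pair (Y j) (q j) | j <- c] ++
     [seq (last (Y e.1) (q e.1), Y e.2) | e <- cycle_steps c]).
  exact: cycle_steps_blocks.
have z0V v : v \in z0 -> exists2 i, i \in c & v \in V i.
  move=> /flatten_mapP[i ic vi]; exists i => //; have [_ sub _ _ _] := qbP i ic.
  exact/rest_V/sub.
have linkE e : e \in cycle_steps c -> [/\ edge e.1 e.2, e.1 \in c, e.2 \in c,
    X e.1 = exit e.1 e.2 & Y e.2 = entry e.1 e.2].
  move=> es; have [h1 h2 h3 h4] := cycle_step_next dc es.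
  by split=> //; rewrite /X /Y -?h4 // h4 prev_next.
have dz0 : dicycle z0.
  apply/and3P; split.
  - by rewrite /z0; case: (c) c0.
  - have : forall i j u, i \in c -> j \in c -> u \in Y i :: q i -> u \in Y j :: q j -> i = j.
      move=> i j u ic jc ui uj; have [_ si _ _ _] := qbP i ic; have [_ sj _ _ _] := qbP j jc.
      exact: (V_disj (rest_V (si _ ui)) (rest_V (sj _ uj))).
    by move=> disj; apply: uniq_blocks => // i ic; have [] := qbP i ic.
  - have steps_edge s : s \in cycle_steps z0 -> edge s.1 s.2.
      rewrite (perm_mem z0steps) mem_cat => /orP[/flatten_mapP[i ic si]|/mapP[e es ->]].
        have [_ _ _ _ p] := qbP i ic.
        have : s \in pairmap pair (Y i) (walk_to (root i) (rest i) (Y i)) ++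
            pairmap pair (root i) (walk_from (root i) (rest i) (X i)).
          by rewrite (perm_mem p) mem_cat si.
        rewrite mem_cat => /orP[] h.
          have [_ sub] := walk_to_steps (rest_uniq i) (YR i ic).
          apply: (@steps_rest_edge i); first by rewrite cycle_steps_cons; exact: sub.
          apply: contraTneq h => r0.
          by have := YR i ic; rewrite r0 inE => /eqP ->; rewrite /walk_to eqxx.
        apply: (@steps_rest_edge i).
          by rewrite cycle_steps_cons; apply: walk_from_steps h => //; exact: XR.
        by apply: contraTneq h => ->.
      have [ee e1 e2 XE YE] := linkE e es; have [_ _ lq _ _] := qbP _ e1.
      by rewrite /= lq XE YE; exact: edge_link.
    case: (z0) steps_edge => // x p; rewrite cycle_steps_cons => h.
    by apply/path_steps.
(* [z0] crosses each class from entry to exit; a full turn is added where [through_cycle] yields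
   one, which never happens in a class with a single vertex. *)
exists (z0 :: [seq root i :: rest i | i <- c & b i]); split.
  move=> z; rewrite inE => /predU1P[->|/mapP[i]]; first by split.
  rewrite mem_filter => /andP[bi ic] ->; have [_ _ _ /(_ bi) ri _] := qbP i ic.
  by split; [exact: dicycle_rest|move=> v /rest_V; exists i].
move=> g; rewrite big_cons (perm_big _ z0steps) big_cat big_flatten !big_map /= big_filter.
pose outs i := \sum_(s <- pairmap pair (root i) (walk_from (root i) (rest i) (X i))) g s.
pose ins i := \sum_(s <- pairmap pair (Y i) (walk_to (root i) (rest i) (Y i))) g s.
transitivity (\sum_(e <- cycle_steps c) (outs e.1 + g (X e.1, Y e.2) + ins e.2)).
  rewrite big_seq [RHS]big_seq; apply: eq_bigr => e es.
  have [ee e1 e2 XE YE] := linkE e es.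
  by rewrite steps_walk // big_cat big_cons /= /outs /ins XE YE addrA.
(* Regrouping by vertices: the end of one walk and the beginning of the next lie in the same class,
   and [through_cycle] rearranges their union. *)
rewrite !big_split /= (sum_cycle_steps1 outs) (sum_cycle_steps2 ins) addrAC -big_split /=.
have -> : \sum_(i <- c) (outs i + ins i) = \sum_(i <- c)
    (\sum_(s <- pairmap pair (Y i) (q i)) g s +
     (if b i then \sum_(s <- cycle_steps (root i :: rest i)) g s else 0)).
  rewrite big_seq [RHS]big_seq; apply: eq_bigr => i ic; have [_ _ _ _ p] := qbP i ic.
  rewrite addrC /outs /ins -big_cat (perm_big _ p) big_cat /=; congr (_ + _).
  by rewrite -/(b i); case: (b i) => //; rewrite big_nil.
rewrite big_split /= -big_mkcond /= -!addrA; congr (_ + _); rewrite addrC; congr (_ + _).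
rewrite big_seq [RHS]big_seq; apply: eq_bigr => e es.
by have [_ e1 _ _ _] := linkE e es; have [_ _ -> _ _] := qbP _ e1.
Qed.
End Lift.

(** * Polygonal embeddings *)

Section GeneralPosition.
Variables (R : realType) (K : finType).
Notation V := (space3 R).
Implicit Types (p q : K -> V) (l : K -> R).

(** Any four points are affinely independent; four is the number of ends of two segments.
    Coefficients on indices let coinciding ends be merged by addition. *)
Definition general_position p : Prop := forall l, (#|[pred k | l k != 0%R]| <= 4)%N ->
  \sum_k l k = 0 -> \sum_k l k *: p k = 0 -> forall k, l k = 0.

Let param (k : K) : R := (enum_rank k)%:R.

Let moment (k : K) : V := \row_(j < 3) param k ^+ j.+1.

(** Homogeneous coordinates, with the additional one in column 0: the rows of
    [base p s + d *: vander s] consist of d and a moved point, so affine dependencies become row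
    relations. *)
Let base p (s : {ffun 'I_4 -> K}) : 'M[R]_4 := \matrix_(i < 4, j < 4)
  if unlift ord0 j is Some j' then p (s i) ord0 j' else 0.

Let vander (s : {ffun 'I_4 -> K}) : 'M[R]_4 := \matrix_(i < 4, j < 4) param (s i) ^+ j.

Let vander_unit (s : {ffun 'I_4 -> K}) : injective s -> vander s \in unitmx.
Proof.
move=> sinj; rewrite -unitmx_tr (_ : (vander s)^T = Vandermonde 4 (\row_i param (s i))).
  rewrite unitmxE det_Vandermonde unitfE; apply/prodf_neq0 => i _; apply/prodf_neq0 => j ij.
  rewrite !mxE subr_eq0 eqr_nat; apply: contraTneq ij => /ord_inj/enum_rank_inj/sinj ->.
  by rewrite ltnn.
by apply/matrixP => i j; rewrite !mxE.
Qed.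

(* Moving p k by d times a point of the moment curve: a dependency among four of
   the moved points makes d an eigenvalue of a matrix independent of d. *)
Lemma general_position_exists p (eta : R) : (3 < #|K|)%N -> 0 < eta ->
  exists2 q, general_position q & forall k, `|q k - p k| < eta.
Proof.
move=> K4 eta0.
(* The roots of each factor include all d for which one quadruple of moved points is dependent. *)
pose P := \prod_(s : {ffun 'I_4 -> K} | injectiveb s) char_poly (- (base p s *m invmx (vander s))).
have P0 : P != 0.
  by apply/prodf_neq0 => s _; rewrite monic_neq0 ?char_poly_monic.
pose C := 1 + \sum_k `|moment k|.
have C0 : 0 < C by rewrite ltr_pwDl // sumr_ge0.
have mC k : `|moment k| < C.
  by rewrite /C (bigD1 k) //= addrCA ltrDl ltr_pwDl // sumr_ge0.
(* Infinitely many candidates for d, and n + 2 > 1 keeps the displacement strictly below eta. *)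
pose g (n : nat) := eta / (C * n.+2%:R).
have ginj : injective g.
  move=> m n /(mulfI (lt0r_neq0 eta0)) /invr_inj /(mulfI (lt0r_neq0 C0)) /eqP.
  by rewrite eqr_nat => /eqP[].
have [n /negP nroot] := nonroot ginj P0; pose d := g n.
have d0 : 0 < d by rewrite divr_gt0 ?mulr_gt0.
exists (fun k => p k + d *: moment k); last first.
  move=> k; rewrite addrC addrA addNr add0r normrZ gtr0_norm //.
  apply: (@le_lt_trans _ _ (d * C)); first by rewrite ler_pM2l // ltW.
  have -> : d * C = eta / n.+2%:R by rewrite /d /g invfM [C^-1 * _]mulrC mulrA mulfVK ?lt0r_neq0.
  by rewrite ltr_pdivrMr // ltr_pMr // ltr1n.
move=> l supp l0 lp0.
set S := [pred k | l k != 0] in supp.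
(* The support is padded to exactly four indices to get a square matrix. *)
pose s := take 4 (enum S ++ enum (predC S)).
have us : uniq s.
  apply: take_uniq; rewrite cat_uniq !enum_uniq andbT /=; apply/hasPn => k.
  by rewrite !mem_enum.
have ss : size s = 4%N.
  rewrite size_take size_cat -!cardE cardC; case: ltnP => // h.
  by apply/eqP; rewrite eqn_leq h K4.
have Ss k : l k != 0 -> k \in s.
  move=> lk; rewrite /s take_cat -cardE; case: ltnP => h.
    have e : #|S| = 4%N by apply/eqP; rewrite eqn_leq supp ltnW.
    by rewrite e ltnn in h.
  by rewrite mem_cat mem_enum inE lk.
have [k0 _] : exists k0 : K, true by case: (s) ss => // k1 ? _; exists k1.
pose t : {ffun 'I_4 -> K} := [ffun i : 'I_4 => nth k0 s i].
have tinj : injective t.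
  move=> i j; rewrite !ffunE => /eqP; rewrite nth_uniq ?ss // => /eqP; exact: val_inj.
have sumE (W : lmodType R) (f : K -> W) : (forall k, l k = 0 -> f k = 0) ->
    \sum_k f k = \sum_(i < 4) f (t i).
  move=> f0; rewrite (bigID (mem s)) /= [X in _ + X]big1 ?addr0; last first.
    by move=> k ks; apply: f0; apply/eqP; apply: contraNT ks; exact: Ss.
  rewrite -big_uniq // (big_nth k0) ss big_mkord.
  by apply: eq_bigr => i _; rewrite ffunE.
pose c : 'rV[R]_4 := \row_i l (t i).
have c0 : c *m (base p t + d *: vander t) = 0.
  apply/rowP => j; rewrite !mxE.
  have [j' jE|jE] := unliftP ord0 j.
    have := congr1 (fun v : V => v ord0 j') lp0; rewrite (sumE V (fun k => l k *: (p k + d *: moment k))).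
      rewrite summxE [RHS]mxE => e; rewrite -[RHS]e; apply: eq_bigr => i _.
      by rewrite !mxE jE liftK.
    by move=> k ->; rewrite scale0r.
  transitivity (\sum_(i < 4) l (t i) * d).
    by apply: eq_bigr => i _; rewrite !mxE jE unlift_none add0r expr0 mulr1.
  by rewrite -mulr_suml -(sumE R^o l) ?l0 ?mul0r.
have cz : c = 0.
  apply: contrapT => /eqP cn0; apply: nroot.
  rewrite /root horner_prod; apply/prodf_eq0; exists t; first exact/injectiveP.
  rewrite -/(root _ _) -eigenvalue_root_char; apply/eigenvalueP; exists c => //.
  rewrite mulmxN mulmxA; move/eqP: c0; rewrite mulmxDr addr_eq0 => /eqP ->.
  by rewrite mulNmx opprK -scalemxAr -scalemxAl mulmxK ?vander_unit.
move=> k; apply/eqP; apply: contraT => lk; have ks := Ss k lk.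
have i4 : (index k s < 4)%N by rewrite -ss index_mem.
have := congr1 (fun v : 'rV[R]_4 => v ord0 (Ordinal i4)) cz.
by rewrite !mxE ffunE /= nth_index // => e; rewrite e eqxx in lk.
Qed.

(** The equation is an affine dependency on at most four indices, so its coefficients vanish and
    both sides agree under any weight f. Indicators as weights recover the arc, and step numbers
    recover the parameter. *)
Lemma general_position_segments q a b a' b' (s s' : R) (f : K -> R) :
  general_position q -> on_segment (q a, q b) s = on_segment (q a', q b') s' ->
  (1 - s) * f a + s * f b = (1 - s') * f a' + s' * f b'.
Proof.
move=> gq e.
pose l k := (k == a)%:R * (1 - s) + (k == b)%:R * s - (k == a')%:R * (1 - s') - (k == b')%:R * s'.
have sumE (W : lmodType R) (g : K -> W) :
    \sum_k l k *: g k = ((1 - s) *: g a + s *: g b) - ((1 - s') *: g a' + s' *: g b').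
  have one x (r : R) : \sum_k ((k == x)%:R * r) *: g k = r *: g x.
    rewrite (bigD1 x) //= eqxx mul1r big1 ?addr0 // => k /negbTE ->.
    by rewrite mul0r scale0r.
  rewrite opprD !addrA -!one -!sumrN -!big_split /=; apply: eq_bigr => k _.
  by rewrite /l !scalerBl !scalerDl.
have lz : forall k, l k = 0.
  apply: gq.
  - apply: leq_trans (card_size [:: a; b; a'; b']); apply: subset_leq_card.
    apply/fintype.subsetP => k; rewrite !inE; apply: contraR; rewrite !negb_or => /and4P[h1 h2 h3 h4].
    by rewrite /l (negbTE h1) (negbTE h2) (negbTE h3) (negbTE h4) !mul0r !subr0 addr0.
  - have := sumE R^o (fun=> 1); rewrite (eq_bigr l); last by move=> k _; exact: mulr1.
    move=> ->; rewrite /GRing.scale /=; ring.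
  - by rewrite sumE; apply/eqP; rewrite subr_eq0; apply/eqP.
have := sumE R^o f; rewrite big1; last by move=> k _; rewrite lz scale0r.
by move/esym/eqP; rewrite subr_eq0 => /eqP.
Qed.
End GeneralPosition.

Section Polyline.
Variable R : realType.
Notation V := (space3 R).
Implicit Types (x : nat -> V) (t : R).

Definition clamp t : R := Num.max 0 (Num.min 1 t).

(* The k-th summand grows from 0 to x k.+1 - x k while t crosses [k/M, (k+1)/M]. *)
Definition polyline x M t : V :=
  x 0%N + \sum_(k < M) clamp (t * M%:R - k%:R) *: (x k.+1 - x k).

Lemma continuous_clamp : continuous clamp.
Proof.
move=> t; apply: continuous_max; first exact: cvg_cst.
by apply: continuous_min; [exact: cvg_cst|exact: cvg_id].
Qed.

Lemma continuous_polyline x M : continuous (polyline x M).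
Proof.
have csum n : continuous (fun t : R => \sum_(k < n) clamp (t * M%:R - k%:R) *: (x k.+1 - x k)).
  elim: n => [|n IH].
    under [X in continuous X]eq_fun do rewrite big_ord0.
    by move=> t; exact: cvg_cst.
  under [X in continuous X]eq_fun do rewrite big_ord_recr /=.
  move=> t; apply: cvgD; first exact: IH.
  apply: cvgZr_tmp.
  apply: (@continuous_comp _ _ _ (fun t => t * M%:R - n%:R) clamp); last exact: continuous_clamp.
  by apply: cvgB; [apply: cvgMr_tmp; exact: cvg_id|exact: cvg_cst].
by move=> t; apply: cvgD; [exact: cvg_cst|exact: csum].
Qed.

Lemma polylineE x M k t : (k < M)%N -> 0 <= t <= 1 ->
  polyline x M ((k%:R + t) / M%:R) = on_segment (x k, x k.+1) t.
Proof.
move=> kM /andP[t0 t1]; have M0 : M%:R != 0 :> R by rewrite pnatr_eq0 -lt0n (leq_ltn_trans _ kM).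
rewrite /polyline divfK //.
rewrite -(big_mkord xpredT (fun j => clamp (k%:R + t - j%:R) *: (x j.+1 - x j))).
rewrite (big_cat_nat (n := k)) //=; last exact: ltnW.
rewrite [X in _ + (_ + X)]big_ltn // [X in _ + (_ + (_ + X))]big_nat_cond.
rewrite [X in _ + (_ + (_ + X))]big1 ?addr0; last first.
  move=> j /andP[/andP[kj _] _]; rewrite /clamp.
  have : k%:R + 1 <= j%:R :> R by rewrite natr1 ler_nat.
  move=> h; have h' : k%:R + t - j%:R <= 0 by clear -h t1; lra.
  by rewrite (min_idPr _) ?(le_trans h') // (max_idPl _) ?scale0r.
rewrite big_nat_cond (eq_bigr (fun j => x j.+1 - x j)); last first.
  move=> j /andP[/andP[_ jk] _]; rewrite /clamp.
  have : j%:R + 1 <= k%:R :> R by rewrite natr1 ler_nat.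
  move=> h; have h' : 1 <= k%:R + t - j%:R by clear -h t0; lra.
  by rewrite (min_idPl _) // (max_idPr _) ?scale1r // ler01.
rewrite -big_nat_cond telescope_sumr // /clamp (_ : k%:R + t - k%:R = t); last by ring.
rewrite (min_idPr _) // (max_idPr _) // /on_segment /=.
by apply/space3P; split; rewrite !mxE; ring.
Qed.
End Polyline.

Lemma interpolate_succ (R : realType) (k t : R) : (1 - t) * k + t * (k + 1) = k + t.
Proof. ring. Qed.

(** * Points in general position give an embedding by broken lines *)

Section PolygonalEmbedding.
Variables (R : realType) (H : digraph) (M : nat).
Notation V := (space3 R).

(* Vertices of H, inner breakpoints of its edges, and four unused indices that
   make the type large enough for general_position_exists. *)
Definition node_type : finType := (H + (H * H * 'I_M.+1 + 'I_4))%type.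

Definition node (i j : H) (k : nat) : node_type :=
  if k == 0%N then inl i else if (k < M)%N then inr (inl (i, j, inord k)) else inl j.

Lemma node0 i j : node i j 0 = inl i. Proof. by []. Qed.

Variable q : node_type -> V.
Hypotheses (M1 : (1 < M)%N) (gq : general_position q).

Lemma nodeM i j : node i j M = inl j.
Proof. by rewrite /node ltnn gtn_eqF // ltnW. Qed.

Lemma node_inner i j k : (0 < k < M)%N -> node i j k = inr (inl (i, j, inord k)).
Proof. by rewrite /node => /andP[]; case: k => // k _ ->. Qed.

Definition broken_arc i j : R -> V := polyline (q \o node i j) M.

Let M0 : (0 < M)%N. Proof. exact: ltnW. Qed.

Let Mp : 0 < M%:R :> R. Proof. by rewrite ltr0n. Qed.

Lemma broken_arcP i j (t : R) : 0 <= t <= 1 -> exists k s, [/\ (k < M)%N, 0 <= s <= 1,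
  t = (k%:R + s) / M%:R & broken_arc i j t = on_segment (q (node i j k), q (node i j k.+1)) s].
Proof.
move=> ht; have [k [s [kM hs tE]]] := grid M0 ht.
by exists k, s; split=> //; rewrite tE /broken_arc polylineE.
Qed.

Lemma broken_arc_node i j k : (k <= M)%N -> broken_arc i j (k%:R / M%:R) = q (node i j k).
Proof.
have i0 : 0 <= (0 : R) <= 1 by rewrite lexx ler01.
have i1 : 0 <= (1 : R) <= 1 by rewrite lexx ler01.
rewrite leq_eqVlt => /predU1P[->|kM]; last first.
  by rewrite -[k%:R]addr0 /broken_arc polylineE // on_segment0.
have e : M%:R = M.-1%:R + 1 :> R by rewrite natr1 prednK.
by rewrite {1}e /broken_arc polylineE ?prednK // on_segment1.
Qed.

(** As 1 < M, each segment of the arc has an inner breakpoint as an end, and a point of zero weight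
    could only be an end of the arc. *)
Lemma inner_weight i j k (s : R) (f : node_type -> R) : (k < M)%N -> 0 <= s <= 1 ->
  0 < (k%:R + s) / M%:R < 1 -> (forall x, 0 <= f x) ->
  (forall l, (0 < l < M)%N -> f (node i j l) = 1) ->
  0 < (1 - s) * f (node i j k) + s * f (node i j k.+1).
Proof.
move=> kM /andP[s0 s1] /andP[]; rewrite pmulr_lgt0 ?invr_gt0 // ltr_pdivrMr // mul1r => ks1 ks2 f0 f1.
have [k0|k0] := posnP k.
  subst k; rewrite (f1 1%N) // mulr1 ltr_wpDl //; last by rewrite add0r in ks1.
  by rewrite mulr_ge0 ?subr_ge0.
rewrite f1 ?k0 // mulr1; have [kM'|kM'] := ltnP k.+1 M.
  by rewrite f1 // mulr1 subrK.
have e : k.+1 = M by apply/eqP; rewrite eqn_leq kM.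
rewrite ltr_pwDl ?mulr_ge0 // subr_gt0 lt_neqAle s1 andbT; apply/eqP => se.
by move: ks2; rewrite se natr1 e ltxx.
Qed.

Lemma itv01 (t : R) : 0 < t < 1 -> 0 <= t <= 1.
Proof. by move=> /andP[? ?]; rewrite !ltW. Qed.

Lemma broken_continuous i j : edge i j -> {within `[0, 1], continuous (broken_arc i j)}.
Proof. by move=> _; apply: continuous_subspaceT; exact: continuous_polyline. Qed.

Lemma broken0 i j : edge i j -> broken_arc i j 0 = q (inl i).
Proof. by rewrite -(broken_arc_node i j (leq0n _)) mul0r. Qed.

Lemma broken1 i j : edge i j -> broken_arc i j 1 = q (inl j).
Proof. by rewrite -(nodeM i) -broken_arc_node // divff ?gt_eqF. Qed.

Lemma broken_pos_inj : injective (fun i : H => q (inl i)).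
Proof.
move=> i j e; have := @general_position_segments R node_type q (inl i) (inl i) (inl j) (inl j) 0 0
  (fun x => (x == inl i)%:R) gq.
rewrite !on_segment0 => /(_ e); rewrite eqxx subr0 !mul0r !addr0 !mul1r.
by case: eqP => [[->]//|_ /eqP]; rewrite oner_eq0.
Qed.

Lemma broken_arc_pos i j w (s : R) : edge i j -> 0 < s < 1 -> broken_arc i j s <> q (inl w).
Proof.
move=> ij hs e; have [k [t [kM ht sE aE]]] := broken_arcP i j (itv01 hs).
(* Interpolating the indicator of inner breakpoints gives a positive value inside an arc and 0 at a
   vertex. *)
pose f (x : node_type) : R := if x is inr (inl _) then 1 else 0.
have := @general_position_segments R node_type q (node i j k) (node i j k.+1) (inl w) (inl w) t 0 f gq.
rewrite -aE on_segment0 => /(_ e); rewrite /f !mulr0 !addr0 -/f => fe.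
have := @inner_weight i j k t f kM ht; rewrite -sE => /(_ hs).
rewrite /f fe ltxx => h; apply: notF; apply: h.
  by case=> [|[]].
by move=> l hl; rewrite node_inner.
Qed.

Lemma broken_arc_inj i j i' j' (s s' : R) : edge i j -> edge i' j' ->
  0 < s < 1 -> 0 < s' < 1 -> broken_arc i j s = broken_arc i' j' s' ->
  [/\ i = i', j = j' & s = s'].
Proof.
move=> ij ij' hs hs' e; have [k [t [kM ht sE aE]]] := broken_arcP i j (itv01 hs).
have [k' [t' [kM' ht' sE' aE']]] := broken_arcP i' j' (itv01 hs').
have key f := @general_position_segments R node_type q (node i j k) (node i j k.+1)
  (node i' j' k') (node i' j' k'.+1) t t' f gq (etrans (esym aE) (etrans e aE')).
(* The indicator of the inner breakpoints of the edge ij identifies the edge. *)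
pose f (x : node_type) : R := if x is inr (inl (a, b, _)) then ((a == i) && (b == j))%:R else 0.
have [ii' jj'] : i' = i /\ j' = j.
  have := @inner_weight i j k t f kM ht; rewrite -sE key => /(_ hs) h.
  have : 0 < (1 - t') * f (node i' j' k') + t' * f (node i' j' k'.+1).
    apply: h; first by case=> [|[[[a b] c]|]] //=.
    by move=> l hl; rewrite node_inner //= !eqxx.
  have fn l : f (node i' j' l) != 0 -> i' = i /\ j' = j.
    rewrite /node; case: ifP => _ /=; first by rewrite eqxx.
    case: ifP => _ /=; last by rewrite eqxx.
    by have [->|ne] := eqVneq i' i; have [->|ne'] := eqVneq j' j; rewrite //= ?eqxx.
  have [z|/fn //] := eqVneq (f (node i' j' k')) 0.
  have [z'|/fn //] := eqVneq (f (node i' j' k'.+1)) 0.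
  by rewrite z z' !mulr0 addr0 ltxx.
subst i' j'; split=> //.
(* g numbers the nodes of the arc from 0 to M, consistently since i and j differ; interpolated at
   parameter s it gives s M. *)
pose g (x : node_type) : R := match x with
  | inl a => if a == j then M%:R else 0 | inr (inl (_, c)) => c%:R | _ => 0 end.
have ij_ne : i != j by apply: contraTneq ij => ->; rewrite edge_irr.
have gn l : (l <= M)%N -> g (node i j l) = l%:R.
  move=> lM; rewrite /node; case: eqP => [->|l0] /=; first by rewrite (negbTE ij_ne).
  case: ltnP => lM' /=; first by rewrite inordK // ltnS.
  by rewrite eqxx; congr (_%:R); apply/eqP; rewrite eqn_leq lM lM'.
have := key g; rewrite !gn //; try exact: ltnW.
by rewrite sE sE' -!natr1 !interpolate_succ => ->.
Qed.

Definition polygonal_embedding : embedding R H := Embedding broken_continuous broken0 broken1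
  broken_pos_inj broken_arc_pos broken_arc_inj.

Lemma polygonal_tame : tame polygonal_embedding.
Proof.
exists id, id; split=> //; [by move=> x; exact: cvg_id|by move=> x; exact: cvg_id|].
pose ij := [seq e : H * H | e <- enum [pred e : H * H | edge e.1 e.2]].
(* Degenerate segments account for isolated vertices. *)
exists ([seq (q (inl v), q (inl v)) | v <- enum H] ++
  flatten [seq [seq (q (node e.1 e.2 k), q (node e.1 e.2 k.+1)) | k <- iota 0 M] | e <- ij]).
rewrite image_id; apply/seteqP; split=> x /=.
  case=> [[v ->]|[u [v [uv [t]]]]].
    exists (q (inl v), q (inl v)).
      by rewrite mem_cat; apply/orP; left; apply/mapP; exists v => //; rewrite mem_enum.
    by exists 0; rewrite ?on_segment0 //= in_itv /= lexx ler01.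
  rewrite /= in_itv /= => ht <-; have [k [s [kM hs _ ->]]] := broken_arcP u v ht.
  exists (q (node u v k), q (node u v k.+1)); last by exists s => //=; rewrite in_itv.
  rewrite mem_cat; apply/orP; right; apply/flatten_mapP; exists (u, v).
    by rewrite /ij map_id mem_enum inE.
  by apply/mapP; exists k => //; rewrite mem_iota.
case=> e; rewrite mem_cat => /orP[/mapP[v _ ->]|/flatten_mapP[[u v]]].
  case=> s _ <-; left; exists v; rewrite /on_segment /= -scalerDl subrK scale1r //.
rewrite /ij map_id mem_enum inE /= => uv /mapP[k]; rewrite mem_iota add0n => /andP[_ kM] ->.
case=> s /=; rewrite in_itv /= => hs <-; right; exists u, v; split=> //.
exists ((k%:R + s) / M%:R); last exact: (polylineE _ kM hs).
rewrite /= in_itv /=; have /andP[s0 s1] := hs.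
rewrite divr_ge0 ?addr_ge0 //= ler_pdivrMr // mul1r.
have : k%:R + 1 <= M%:R :> R by rewrite natr1 ler_nat.
by apply: le_trans; rewrite lerD2l.
Qed.

Definition node_chain (c : seq H) : seq (node_type * node_type) :=
  flatten [seq [seq (node e.1 e.2 k, node e.1 e.2 k.+1) | k <- iota 0 M] | e <- cycle_steps c].

Lemma cycle_chain_polygonal c : cycle_chain polygonal_embedding M c =
  [seq (q n.1, q n.2) | n <- node_chain c].
Proof.
rewrite /cycle_chain /node_chain map_flatten -map_comp; congr flatten; apply/eq_in_map => e _.
rewrite /= -map_comp; apply/eq_in_map => k; rewrite mem_iota add0n => /andP[_ kM] /=.
by rewrite !broken_arc_node // ltnW.
Qed.

Lemma node_chain_closed c : closed_chain (node_chain c).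
Proof.
move=> g; rewrite !big_flatten !big_map /=.
have arcE (e : H * H) : \sum_(n <- [seq (node e.1 e.2 k, node e.1 e.2 k.+1) | k <- iota 0 M]) g n.1 -
    \sum_(n <- [seq (node e.1 e.2 k, node e.1 e.2 k.+1) | k <- iota 0 M]) g n.2 =
    g (inl e.1) - g (inl e.2).
  have := telescope_sumr (fun k => g (node e.1 e.2 k)) (leq0n M).
  rewrite /index_iota subn0 nodeM node0 => tel.
  by rewrite !big_map /= -sumrB -[RHS]opprB -tel -sumrN; apply: eq_bigr => k _; rewrite opprB.
apply/eqP; rewrite -subr_eq0 -sumrB; apply/eqP.
under eq_bigr => e _ do rewrite arcE.
by rewrite sumrB (sum_cycle_steps1 (fun i => g (inl i))) (sum_cycle_steps2 (fun i => g (inl i))) subrr.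
Qed.
End PolygonalEmbedding.

Lemma le20_le2 (R : realType) (r x : R) : 0 < r -> 20 * r <= x -> 2 * r <= x.
Proof. lra. Qed.

Lemma le20_le4 (R : realType) (r x : R) : 0 < r -> 20 * r <= x -> 2 * (2 * r) <= x.
Proof. lra. Qed.

Lemma sub_step (R : realType) (M L k m l x : R) : 0 < M -> 0 < L -> l = k * L + m ->
  m + 1 <= L -> l / (M * L) <= x -> x <= (l + 1) / (M * L) -> 0 <= m -> 0 <= x * M - k <= 1.
Proof.
move=> M0 L0 lE mL; rewrite ler_pdivrMr ?mulr_gt0 // ler_pdivlMr ?mulr_gt0 // lE => x1 x2 m0.
rewrite -(pmulr_lge0 _ L0) -[X in _ && X](ler_pM2r L0); lra.
Qed.

Section FarApart.
Variable R : realType.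
Notation V := (space3 R).
Implicit Types (a b x y z : V) (e f : V * V) (r : R).

Lemma far_segments a b r e f : `|e.1 - a| < r -> `|e.2 - a| < r ->
  `|f.1 - b| < r -> `|f.2 - b| < r -> 2 * r <= `|a - b| -> seg_disjoint e f.
Proof.
move=> e1 e2 f1 f2 ab s t hs ht est.
have h1 := near_segment hs e1 e2; have := near_segment ht f1 f2; rewrite -est => h2.
have := ler_distD (on_segment e s) a b; rewrite distrC in h1.
by clear est; lra.
Qed.

Lemma far_triangle a b r x y z f : `|x - a| < r -> `|y - a| < r -> `|z - a| < r ->
  `|f.1 - b| < r -> `|f.2 - b| < r -> 2 * r <= `|a - b| -> triangle_disjoint x y z f.
Proof.
move=> xa ya za f1 f2 ab s t l s0 t0 st hl est.
have h1 := near_triangle s0 t0 st xa ya za; have := near_segment hl f1 f2; rewrite -est => h2.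
have := ler_distD (triangle_point x y z s t) a b; rewrite distrC in h1.
by clear est; lra.
Qed.

Lemma far_points a b r x y : 0 < r -> `|x - a| < 2 * r -> `|y - b| < 2 * r ->
  20 * r <= `|a - b| -> 2 * (4 * r) <= `|x - y|.
Proof.
move=> r0 xa yb ab; have := ler_distD x a b; have := ler_distD y x b.
by rewrite [`|a - x|]distrC; lra.
Qed.
End FarApart.

(** * The embedding of H *)

Section Traces.
Variables (R : realType) (G : digraph) (phi : embedding R G) (N : nat).
Hypothesis N0 : (0 < N)%N.

Definition walk_points (a : G) (w : seq G) : seq (space3 R) :=
  flatten [seq [seq arc phi s.1 s.2 (k.+1%:R / N%:R) | k <- iota 0 N] | s <- pairmap pair a w].

Lemma last_iota (T : Type) (g : nat -> T) n : last (g 0%N) [seq g k.+1 | k <- iota 0 n] = g n.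
Proof.
elim: n => // n IH; rewrite -addn1 iotaD map_cat last_cat /= add0n addn1; by [].
Qed.

Lemma walk_points_steps a w : (forall s, s \in pairmap pair a w -> edge s.1 s.2) ->
  pairmap pair (pos phi a) (walk_points a w) =
    flatten [seq arc_steps phi N s.1 s.2 | s <- pairmap pair a w] /\
  last (pos phi a) (walk_points a w) = pos phi (last a w).
Proof.
elim: w a => // b w IH a ew; have ab : edge a b by apply: (ew (a, b)); rewrite inE eqxx.
have [|IH1 IH2] := IH b; first by move=> s sw; apply: ew; rewrite inE sw orbT.
pose g k := arc phi a b (k%:R / N%:R).
have g0 : g 0%N = pos phi a by rewrite /g mul0r arc0.
have gN : g N = pos phi b by rewrite /g divff ?arc1 // pnatr_eq0 -lt0n.
rewrite /walk_points /= pairmap_cat last_cat -g0 last_iota gN; split; last exact: IH2.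
by rewrite (steps_iota g) IH1.
Qed.

(** Repeating the last point lets walks of different lengths be indexed by a common M. *)
Lemma steps_nth (T : Type) (d x : T) s M : (size s <= M)%N -> last x s = d ->
  [seq (nth d (x :: s) k, nth d (x :: s) k.+1) | k <- iota 0 M] =
  pairmap pair x s ++ nseq (M - size s) (d, d).
Proof.
elim: s x M => [|y s IH] x M /=.
  move=> _ ->; rewrite subn0; apply: (@eq_from_nth _ (d, d)); rewrite size_map size_iota ?size_nseq //.
  move=> k kM; rewrite nth_nseq kM (nth_map 0%N) ?size_iota // nth_iota // add0n.
  by case: k {kM} => //= k; rewrite !nth_nil.
case: M => // M sM ld; rewrite /= subSS; congr (_ :: _).
by rewrite -(IH y M sM ld) -[1%N]addn0 iotaDl -map_comp.
Qed.

Lemma over_sum_nseq u n (d : space3 R) F : over_sum u (nseq n (d, d)) F = 0.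
Proof.
rewrite /over_sum big_nseq; elim: n => //= n ->; rewrite addr0.
by rewrite big1 // => f _; exact: over_diag.
Qed.
End Traces.

(** * The traced polygons, their perturbation and their linking numbers *)

Section Assembly.
Variables (R : realType) (G H : digraph) (phi : embedding R G) (V : H -> {set G}).
Variables (root : H -> G) (rest : H -> seq G) (exit entry : H -> H -> G).
Hypothesis V_disj : forall i j v, v \in V i -> v \in V j -> i = j.
Hypothesis rest_V : forall i v, v \in root i :: rest i -> v \in V i.
Hypothesis rest_uniq : forall i, uniq (root i :: rest i).
Hypothesis rest_cycle : forall i, rest i != [::] -> cycle (@edge G) (root i :: rest i).
Hypothesis exit_rest : forall i j, edge i j -> exit i j \in root i :: rest i.
Hypothesis entry_rest : forall i j, edge i j -> entry i j \in root j :: rest j.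
Hypothesis edge_link : forall i j, edge i j -> edge (exit i j) (entry i j).
Variables (r : R) (N : nat).
Hypotheses (r0 : 0 < r) (N0 : (0 < N)%N) (short : short_arc_steps phi r N).
Hypothesis phi_apart : arcs_apart phi (20 * r).
Hypothesis phi_lk : forall c c', dicycle c -> dicycle c' -> disjoint_cycles c c' ->
  lk (cycle_chain phi N c) (cycle_chain phi N c') = 0.

Let W := walk root rest exit entry.
Let pts i j := walk_points phi N (root i) (W i j).
Variable M : nat.
Hypotheses (M1 : (1 < M)%N) (pts_M : forall i j, (size (pts i j) < M)%N).

Variable p : node_type H M -> space3 R.
Hypothesis p_node : forall i j k, edge i j ->
  p (node M i j k) = nth (pos phi (root j)) (pos phi (root i) :: pts i j) k.

Let W_edge i j s : edge i j -> s \in pairmap pair (root i) (W i j) ->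
  edge s.1 s.2 /\ forall v, v = s.1 \/ v = s.2 -> v \in V i \/ v \in V j.
Proof. exact: steps_walk_edge. Qed.

Let p_steps i j : edge i j ->
  [seq (p (node M i j k), p (node M i j k.+1)) | k <- iota 0 M] =
  flatten [seq arc_steps phi N s.1 s.2 | s <- pairmap pair (root i) (W i j)] ++
  nseq (M - size (pts i j)) (pos phi (root j), pos phi (root j)).
Proof.
move=> ij.
have [s1 s2] := walk_points_steps phi N0 (fun s sW => (W_edge ij sW).1).
rewrite -s1 -steps_nth.
- by apply/eq_in_map => k _; rewrite !p_node.
- exact/ltnW/pts_M.
- by rewrite s2 last_walk.
Qed.

(** Reference points on the arcs of G: each piece of polygon for the edge ij has one nearby, and the
    separation of disjoint arcs is applied to them. *)
Definition anchor i j (a : space3 R) : Prop := exists x y t, [/\ edge x y, 0 <= t <= 1,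
  (forall v, v = x \/ v = y -> v \in V i \/ v \in V j) & a = arc phi x y t].

Let arc_steps_anchor x y e i j : edge x y -> e \in arc_steps phi N x y ->
  (forall v, v = x \/ v = y -> v \in V i \/ v \in V j) ->
  exists2 a, anchor i j a & `|e.1 - a| < r /\ `|e.2 - a| < r.
Proof.
move=> xy /mapP[k]; rewrite mem_iota add0n => /andP[_ kN] -> vV.
have Np : 0 < N%:R :> R by rewrite ltr0n.
have kk : k%:R / N%:R <= k.+1%:R / N%:R :> R by rewrite ler_pM2r ?invr_gt0 // ler_nat.
exists (arc phi x y (k%:R / N%:R)).
  exists x, y, (k%:R / N%:R); split=> //.
  by rewrite divr_ge0 ?ler0n //= ler_pdivrMr // mul1r ler_nat ltnW.
by split; apply: (short xy kN); rewrite ?lexx ?kk.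
Qed.

Let p_anchor i j k : edge i j -> (k < M)%N -> exists2 a, anchor i j a &
  `|p (node M i j k) - a| < r /\ `|p (node M i j k.+1) - a| < r.
Proof.
move=> ij kM.
have : (p (node M i j k), p (node M i j k.+1)) \in
    [seq (p (node M i j k), p (node M i j k.+1)) | k <- iota 0 M].
  by apply/mapP; exists k => //; rewrite mem_iota.
rewrite p_steps // mem_cat => /orP[/flatten_mapP[s sW es]|].
  have [ss sV] := W_edge ij sW.
  exact: arc_steps_anchor ss es sV.
rewrite mem_nseq => /andP[_ /eqP[-> ->]].
(* A padded side sits at [root j], and is anchored at the far end of the last arc of the walk; a
   walk has at least the step from exit to entry. *)
have [x xW] : exists x, (x, root j) \in pairmap pair (root i) (W i j).
  have : last (root i) (W i j) = root j by exact: last_walk.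
  have : W i j != [::] by rewrite /W /walk; case: (walk_from _ _ _).
  elim: (W i j) (root i) => // y w IH z _ /=; case: w IH => [_ <-|y' w IH l].
    by exists z; rewrite inE.
  by have [x xw] := IH y isT l; exists x; rewrite inE xw orbT.
have [ss sV] := W_edge ij xW.
exists (arc phi x (root j) 1); last by rewrite arc1 // subrr normr0.
by exists x, (root j), 1; split=> //; rewrite lexx ler01.
Qed.

Let anchors_apart i j i' j' a b : i != i' -> i != j' -> j != i' -> j != j' ->
  anchor i j a -> anchor i' j' b -> 20 * r <= `|a - b|.
Proof.
move=> n1 n2 n3 n4 [x [y [t [xy ht h ->]]]] [x' [y' [t' [xy' ht' h' ->]]]].
have ne v v' : v = x \/ v = y -> v' = x' \/ v' = y' -> v != v'.
  move=> /h hv /h' hv'; apply/eqP => e; subst v'.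
  case: hv hv' => hv [] hv'; have := V_disj hv hv'; exact/eqP.
by apply: phi_apart => //; apply: ne; auto.
Qed.

Variable q : node_type H M -> space3 R.
Hypotheses (gq : general_position q) (qp : forall x, `|q x - p x| < r).

Let psi := polygonal_embedding M1 gq.

Let near_q x a : `|p x - a| < r -> `|q x - a| < 2 * r.
Proof.
by move=> h; apply: le_lt_trans (ler_distD (p x) _ _) _; rewrite mulr_natl mulr2n ltrD.
Qed.

Let near_p x a : `|p x - a| < r -> `|p x - a| < 2 * r.
Proof. by move/lt_trans; apply; rewrite ltr_pMl // ltr1n. Qed.

Let node_chain_anchor c n : dicycle c -> n \in node_chain M c ->
  exists i j a, [/\ i \in c, j \in c, anchor i j a & `|p n.1 - a| < r /\ `|p n.2 - a| < r].
Proof.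
move=> dc /flatten_mapP[e es /mapP[k]]; rewrite mem_iota add0n => /andP[_ kM] ->.
have [ee e1 e2 _] := cycle_step_next dc es.
have [a aP h] := p_anchor ee kM; by exists e.1, e.2, a.
Qed.

Let cycles_ne (c d : seq H) i j : disjoint_cycles c d -> i \in c -> j \in d -> i != j.
Proof.
by move=> cd ic; apply: contraTneq => <-; rewrite (disjointFr cd ic).
Qed.

Let node_chains_apart c d n m : dicycle c -> dicycle d -> disjoint_cycles c d ->
  n \in node_chain M c -> m \in node_chain M d -> exists a b,
  [/\ `|p n.1 - a| < r /\ `|p n.2 - a| < r, `|p m.1 - b| < r /\ `|p m.2 - b| < r &
      20 * r <= `|a - b|].
Proof.
move=> dc dd cd nc md.
have [i [j [a [ic jc ha na]]]] := node_chain_anchor dc nc.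
have [i' [j' [b [ic' jc' hb nb]]]] := node_chain_anchor dd md.
exists a, b; split=> //; apply: anchors_apart ha hb; exact: cycles_ne cd _ _.
Qed.

Let pchain c := [seq (p n.1, p n.2) | n <- node_chain M c].
Let qchain c := [seq (q n.1, q n.2) | n <- node_chain M c].

Let closed_map (f : node_type H M -> space3 R) c : closed_chain [seq (f n.1, f n.2) | n <- node_chain M c].
Proof. by move=> g; rewrite !big_map; exact: (node_chain_closed M1 c (g \o f)). Qed.

(** One chain is moved at a time; the swept triangles and the other chain stay within 2 r of
    anchors. *)
Let lk_pq c d : dicycle c -> dicycle d -> disjoint_cycles c d ->
  lk (qchain c) (qchain d) = lk (pchain c) (pchain d).
Proof.
move=> dc dd cd; have dc' : disjoint_cycles d c by rewrite /disjoint_cycles disjoint_sym.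
transitivity (lk (pchain c) (qchain d)).
  apply/esym/lk_homotopy; [exact: node_chain_closed|exact: closed_map|].
  move=> n _ nc /mapP[m md ->].
  have [a [b [[n1 n2] [m1 m2] /(le20_le4 r0) ab]]] := node_chains_apart dc dd cd nc md.
  by split; [exact: (far_triangle (f := (q m.1, q m.2)) (near_p n1) (near_p n2) (near_q n2) (near_q m1) (near_q m2) ab)
            |exact: (far_triangle (f := (q m.1, q m.2)) (near_p n1) (near_q n2) (near_q n1) (near_q m1) (near_q m2) ab)].
rewrite lkC; [|exact: closed_map|exact: closed_map|]; last first.
  move=> _ _ /mapP[n nc ->] /mapP[m md ->].
  have [a [b [[n1 n2] [m1 m2] /(le20_le4 r0) ab]]] := node_chains_apart dc dd cd nc md.
  exact: (far_segments (e := (p n.1, p n.2)) (f := (q m.1, q m.2)) (near_p n1) (near_p n2) (near_q m1) (near_q m2) ab).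
transitivity (lk (pchain d) (pchain c)).
  apply/esym/lk_homotopy; [exact: node_chain_closed|exact: closed_map|].
  move=> n _ nc /mapP[m md ->].
  have [a [b [[n1 n2] [m1 m2] /(le20_le4 r0) ab]]] := node_chains_apart dd dc dc' nc md.
  by split; [exact: (far_triangle (f := (p m.1, p m.2)) (near_p n1) (near_p n2) (near_q n2) (near_p m1) (near_p m2) ab)
            |exact: (far_triangle (f := (p m.1, p m.2)) (near_p n1) (near_q n2) (near_q n1) (near_p m1) (near_p m2) ab)].
rewrite lkC; [by []|exact: closed_map|exact: closed_map|].
move=> _ _ /mapP[n nc ->] /mapP[m md ->].
have [a [b [[n1 n2] [m1 m2] /(le20_le4 r0) ab]]] := node_chains_apart dd dc dc' nc md.
exact: (far_segments (e := (p n.1, p n.2)) (f := (p m.1, p m.2)) (near_p n1) (near_p n2) (near_p m1) (near_p m2) ab).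
Qed.

(** Crossing counts are additive over the steps of the walks and the padding counts 0, so the
    decomposition of the closed walk transfers to them. *)
Let over_sum_pchain u c F (L : seq (seq G)) : dicycle c ->
  (forall g : G * G -> int,
    \sum_(e <- cycle_steps c) \sum_(s <- pairmap pair (root e.1) (W e.1 e.2)) g s =
    \sum_(z <- L) \sum_(s <- cycle_steps z) g s) ->
  over_sum u (pchain c) F = \sum_(z <- L) over_sum u (cycle_chain phi N z) F.
Proof.
move=> dc LE.
transitivity (\sum_(e <- cycle_steps c) \sum_(s <- pairmap pair (root e.1) (W e.1 e.2))
    over_sum u (arc_steps phi N s.1 s.2) F).
  rewrite /over_sum /pchain /node_chain map_flatten big_flatten -map_comp big_map.
  rewrite big_seq [RHS]big_seq; apply: eq_bigr => e es.
  have [ee _ _ _] := cycle_step_next dc es.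
  rewrite /= -map_comp (p_steps ee) big_cat /=.
  rewrite [X in _ + X](over_sum_nseq u _ (pos phi (root e.2)) F) addr0.
  by rewrite big_flatten big_map.
rewrite LE; apply: eq_bigr => z _.
by rewrite /over_sum /cycle_chain big_flatten big_map.
Qed.

Let lk_pchain c d : dicycle c -> dicycle d -> disjoint_cycles c d ->
  lk (pchain c) (pchain d) = 0.
Proof.
move=> dc dd cd.
have lift := lift_dicycle V_disj rest_V rest_uniq rest_cycle exit_rest entry_rest edge_link.
have [Lc [LcP LcE]] := lift c dc; have [Ld [LdP LdE]] := lift d dd.
pose Ec := flatten [seq cycle_chain phi N z | z <- Lc].
pose Ed := flatten [seq cycle_chain phi N z | z <- Ld].
have chain_anchor b (Lb : seq (seq G)) :
    (forall z, z \in Lb -> dicycle z /\ forall v, v \in z -> exists2 i, i \in b & v \in V i) ->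
    dicycle b -> forall e, e \in pchain b ++ flatten [seq cycle_chain phi N z | z <- Lb] ->
    exists i j a, [/\ i \in b, j \in b, anchor i j a & `|e.1 - a| < r /\ `|e.2 - a| < r].
  move=> LbP db e; rewrite mem_cat => /orP[/mapP[n nb ->]|]; first exact: node_chain_anchor.
  move=> /flatten_mapP[z zL /flatten_mapP[s sz es]].
  have [dz zV] := LbP z zL; have [ss s1 s2 _] := cycle_step_next dz sz.
  have [i ib iV] := zV _ s1; have [j jb jV] := zV _ s2.
  have [|a aP h] := @arc_steps_anchor s.1 s.2 e i j ss es.
    by move=> v [->|->]; auto.
  by exists i, j, a.
(* Adding the lifted cycles to both chains provides one direction regular for all of them, so
   bilinearity is used on [over_sum], where it is immediate. *)
have ap : apart (pchain c ++ Ec) (pchain d ++ Ed).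
  move=> e f /(chain_anchor _ _ LcP dc)[i [j [a [ic jc aP [e1 e2]]]]].
  move=> /(chain_anchor _ _ LdP dd)[i' [j' [b [ic' jc' bP [f1 f2]]]]].
  apply: (far_segments e1 e2 f1 f2); apply: le20_le2 => //.
  by apply: anchors_apart aP bP; exact: cycles_ne cd _ _.
have [u ru] := regular_exists ap.
have sub1 (E F : seq (space3 R * space3 R)) : {subset E <= E ++ F}.
  by move=> e eE; rewrite mem_cat eE.
have sub2 (E F : seq (space3 R * space3 R)) : {subset F <= E ++ F}.
  by move=> e eF; rewrite mem_cat eF orbT.
have chain_closed z : dicycle z -> closed_chain (cycle_chain phi N z).
  move=> dz; rewrite -inscribed_cycle_curve //; apply: inscribed_closed.
    exact: cycle_curve01.
  by apply: uniform_partition; rewrite muln_gt0 N0 dicycle_size.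
have sub_c z : z \in Lc -> {subset cycle_chain phi N z <= pchain c ++ Ec}.
  by move=> zL e ez; apply: sub2; apply/flatten_mapP; exists z.
have sub_d z : z \in Ld -> {subset cycle_chain phi N z <= pchain d ++ Ed}.
  by move=> zL e ez; apply: sub2; apply/flatten_mapP; exists z.
rewrite (lkE (closed_map _ _) (closed_map _ _) (apart_sub (sub1 _ _) (sub1 _ _) ap)
  (regular_sub (sub1 _ _) (sub1 _ _) ru)).
rewrite (over_sum_pchain u _ dc LcE) big_seq big1 // => z zL.
(* Reversing u exchanges the arguments, so the second one is expanded like the first. *)
rewrite -over_sumC (over_sum_pchain (- u) _ dd LdE) big_seq big1 // => w wL.
have [dz zV] := LcP z zL; have [dw wV] := LdP w wL.
rewrite over_sumC -(lkE (chain_closed z dz) (chain_closed w dw) (apart_sub (sub_c z zL) (sub_d w wL) ap)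
  (regular_sub (sub_c z zL) (sub_d w wL) ru)).
apply: phi_lk => //; rewrite /disjoint_cycles disjoint_has; apply/hasPn => v /zV[i ic vi].
apply/negP => /wV[j jd vj]; have := cycles_ne cd ic jd.
by rewrite (V_disj vi vj) eqxx.
Qed.

(** A step of length 1 / (M L) stays in one segment of the broken arc, all within 2 r of one
    anchor. *)
Let psi_short L : (0 < L)%N -> short_arc_steps psi (4 * r) (M * L).
Proof.
move=> L0 i j l s t ij lML hs ht.
have M0 : (0 < M)%N by exact: ltnW.
have Mp : 0 < M%:R :> R by rewrite ltr0n.
have Lp : 0 < L%:R :> R by rewrite ltr0n.
have kM : (l %/ L < M)%N by rewrite ltn_divLR.
have lE : l%:R = (l %/ L)%:R * L%:R + (l %% L)%:R :> R by rewrite -natrM -natrD -divn_eq.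
have lL : (l %% L)%:R + 1 <= L%:R :> R by rewrite natr1 ler_nat ltn_mod.
have m0 : 0 <= (l %% L)%:R :> R by [].
have par x : l%:R / (M * L)%:R <= x <= l.+1%:R / (M * L)%:R -> exists2 y, 0 <= y <= 1 &
    arc psi i j x = on_segment (q (node M i j (l %/ L)), q (node M i j (l %/ L).+1)) y.
  rewrite -natr1 natrM => /andP[x1 x2]; exists (x * M%:R - (l %/ L)%:R); last first.
    rewrite /= -(polylineE (q \o node M i j) kM).
      by rewrite addrC subrK mulfK ?gt_eqF.
    exact: (sub_step Mp Lp lE lL x1 x2 m0).
  exact: (sub_step Mp Lp lE lL x1 x2 m0).
have [y hy ->] := par s hs; have [y' hy' ->] := par t ht.
have [a _ [a1 a2]] := p_anchor ij kM.
have h1 := near_segment (e := (_, _)) hy (near_q a1) (near_q a2).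
have h2 := near_segment (e := (_, _)) hy' (near_q a1) (near_q a2).
apply: le_lt_trans (ler_distD a _ _) _; rewrite [X in _ + X]distrC.
by rewrite (_ : 4 * r = 2 * r + 2 * r) ?ltrD //; ring.
Qed.

Let psi_apart : arcs_apart psi (2 * (4 * r)).
Proof.
move=> i j i' j' s t ij ij' n1 n2 n3 n4 hs ht.
have [k [y [kM hy _ aE]]] := broken_arcP q M1 i j hs.
have [k' [y' [kM' hy' _ aE']]] := broken_arcP q M1 i' j' ht.
have [a aP [a1 a2]] := p_anchor ij kM; have [b bP [b1 b2]] := p_anchor ij' kM'.
have h1 := near_segment (e := (_, _)) hy (near_q a1) (near_q a2).
have h2 := near_segment (e := (_, _)) hy' (near_q b1) (near_q b2).
have ab := anchors_apart n1 n2 n3 n4 aP bP.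
have -> : arc psi i j s = on_segment (q (node M i j k), q (node M i j k.+1)) y by exact: aE.
have -> : arc psi i' j' t = on_segment (q (node M i' j' k'), q (node M i' j' k'.+1)) y' by exact: aE'.
exact: far_points r0 h1 h2 ab.
Qed.

Lemma contraction_no_links : no_linked_dicycles psi.
Proof.
apply: (no_linked_of_lk (M := M) (r := 4 * r)).
- exact: ltnW.
- exact: psi_apart.
- exact: psi_short.
by move=> c d dc dd cd; rewrite !cycle_chain_polygonal // lk_pq // lk_pchain.
Qed.
End Assembly.

(** * Constants of the given embedding and conclusion *)

Lemma uniform_positive (R : realType) (I : finType) (P : I -> R -> Prop) :
  (forall i r s, 0 < s -> s <= r -> P i r -> P i s) -> (forall i, exists2 r, 0 < r & P i r) ->
  exists2 r, 0 < r & forall i, P i r.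
Proof.
move=> mono ex.
suff [r r0 h] : exists2 r, 0 < r & forall i, i \in enum I -> P i r.
  by exists r => // i; apply: h; rewrite mem_enum.
elim: (enum I) => [|i s [r r0 IH]]; first by exists 1.
have [ri ri0 h] := ex i; exists (Num.min ri r); first by rewrite lt_min ri0.
move=> j; rewrite inE => /predU1P[->|js].
  by apply: mono h; rewrite ?lt_min ?ri0 // ge_min lexx.
by apply: mono (IH j js); rewrite ?lt_min ?ri0 // ge_min lexx orbT.
Qed.

Section EmbeddingModuli.
Variables (R : realType) (G : digraph) (phi : embedding R G).

Lemma arc_disjoint x y x' y' (s t : R) : edge x y -> edge x' y' ->
  x != x' -> x != y' -> y != x' -> y != y' -> 0 <= s <= 1 -> 0 <= t <= 1 ->
  arc phi x y s <> arc phi x' y' t.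
Proof.
move=> xy xy' n1 n2 n3 n4 hs ht.
have ends (a : R) : 0 <= a <= 1 -> [\/ a = 0, a = 1 | 0 < a < 1].
  move=> /andP[a0 a1]; have [->|a0'] := eqVneq a 0; first exact: Or31.
  have [->|a1'] := eqVneq a 1; first exact: Or32.
  by apply: Or33; rewrite !lt_neqAle a0 a1 eq_sym a0' a1'.
have pos_ne a b : a != b -> pos phi a <> pos phi b by move=> /eqP ab /pos_inj.
have [->|->|hs'] := ends s hs; have [->|->|ht'] := ends t ht; rewrite ?arc0 ?arc1 //.
- exact: pos_ne.
- exact: pos_ne.
- by move/esym; exact: arc_pos.
- exact: pos_ne.
- exact: pos_ne.
- by move/esym; exact: arc_pos.
- exact: arc_pos.
- exact: arc_pos.
by move=> /(arc_inj xy xy' hs' ht')[xx' _ _]; rewrite xx' eqxx in n1.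
Qed.

Lemma arcs_apart_exists : exists2 r, 0 < r & arcs_apart phi r.
Proof.
have [|[[x y] [x' y']]|r r0 h] := @uniform_positive R ((G * G) * (G * G))%type (fun e r =>
    edge e.1.1 e.1.2 -> edge e.2.1 e.2.2 -> e.1.1 != e.2.1 -> e.1.1 != e.2.2 ->
    e.1.2 != e.2.1 -> e.1.2 != e.2.2 -> forall s t, 0 <= s <= 1 -> 0 <= t <= 1 ->
    r <= `|arc phi e.1.1 e.1.2 s - arc phi e.2.1 e.2.2 t|).
- by move=> e r s _ sr h *; apply: le_trans sr _; exact: h.
- have [/and5P[xy xy' n1 n2 /andP[n3 n4]]|no] := boolP [&& edge x y, edge x' y', x != x', x != y' & (y != x') && (y != y')].
    have [r r0 h] := curve_distance (@arc_continuous _ _ phi _ _ xy) (@arc_continuous _ _ phi _ _ xy')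
      (fun s t => arc_disjoint xy xy' n1 n2 n3 n4).
    by exists r.
  exists 1 => //= xy xy' n1 n2 n3 n4; by rewrite xy xy' n1 n2 n3 n4 in no.
- by exists r => // x y x' y' s t xy xy' n1 n2 n3 n4; exact: (h ((x, y), (x', y'))).
Qed.

Lemma arc_modulus_exists r : 0 < r -> exists2 d, 0 < d & arc_modulus phi r d.
Proof.
move=> r0.
have [|[x y]|d d0 h] := @uniform_positive R (G * G)%type (fun e d =>
    edge e.1 e.2 -> forall s t, 0 <= s <= 1 -> 0 <= t <= 1 -> `|s - t| < d ->
    `|arc phi e.1 e.2 s - arc phi e.1 e.2 t| < r).
- by move=> e d d' _ dd' h xy s t hs ht st; apply: h => //; exact: lt_le_trans dd'.
- have [xy|no] := boolP (edge x y); last by exists 1 => //= xy; rewrite xy in no.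
  by have [d d0 h] := uniformly_continuous (@arc_continuous _ _ phi _ _ xy) r0; exists d.
- by exists d => // x y s t xy; exact: (h (x, y)).
Qed.

Lemma short_arc_steps_exists r d : 0 < d -> arc_modulus phi r d ->
  exists2 N, (0 < N)%N & short_arc_steps phi r N.
Proof.
move=> d0 mod; pose N := (Num.truncn d^-1).+1; exists N => // x y j s t xy jN.
have Np : 0 < N%:R :> R by rewrite ltr0n.
have dN : N%:R^-1 < d.
  rewrite -[d]invrK ltf_pV2 ?posrE ?invr_gt0 //.
  by have /andP[] := truncn_itv (ltW (etrans (invr_gt0 d) d0)).
have j0 : 0 <= j%:R / N%:R :> R by rewrite divr_ge0.
have jE : j.+1%:R / N%:R = j%:R / N%:R + N%:R^-1 :> R by rewrite -natr1 mulrDl mul1r.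
have j1 : j.+1%:R / N%:R <= 1 :> R by rewrite ler_pdivrMr // mul1r ler_nat.
rewrite jE in j1 *; move: j0 j1 dN; move: (N%:R^-1) (j%:R / N%:R) => b a a0 ab bd hs ht.
apply: mod => //; [lra|lra|]; rewrite ltr_norml; lra.
Qed.
End EmbeddingModuli.

(** The single-vertex convention becomes an empty list s, for which no cycle is claimed. *)
Lemma hamiltonian_order (G : digraph) (A : {set G}) :
  #|A| = 1%N \/ hamiltonian (induced A) -> A != finset.set0 ->
  exists x s, [/\ uniq (x :: s), x :: s =i A & s != [::] -> cycle (@edge G) (x :: s)].
Proof.
case=> [/eqP/cards1P[x ->] _|[c [/and3P[c0 uc cyc] cA]] _].
  by exists x, [::]; split=> // v; rewrite !inE.
case: c c0 uc cyc cA => // x s _ uc cyc cA; exists (val x), (map val s).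
have e : val x :: map val s = map val (x :: s) by [].
rewrite e; split.
- by rewrite map_inj_uniq //; exact: val_inj.
- move=> v; apply/mapP/idP => [[w _ ->]|vA]; first exact: (valP w).
  by exists (Sub v vA) => //; rewrite SubK.
- by move=> _; rewrite cycle_map.
Qed.

Theorem proposition2p3 (R : realType) (G H : digraph)
    (hHG : Hcyclic_minor H G)
    (hG : exists phi : embedding R G, tame phi /\ no_linked_dicycles phi) :
  exists psi : embedding R H, tame psi /\ no_linked_dicycles psi.
Proof.
have [V [Vinj /and3P[_ Vtriv V0] Vedge Vham]] := hHG.
have [phi [_ nl]] := hG.
have V_disj i j v : v \in V i -> v \in V j -> i = j.
  move=> vi vj; apply: contrapT => ij.
  have := finset.trivIsetP Vtriv (V i) (V j) (finset.imset_f _ isT) (finset.imset_f _ isT).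
  have -> : V i != V j by apply/eqP => /Vinj.
  by move=> /(_ isT) /disjointFr /(_ vi); rewrite vj.
have Vn0 i : V i != finset.set0.
  by apply: contraNneq V0 => <-; exact: finset.imset_f.
have /choice[f fP] : forall i, exists f : G * seq G, [/\ uniq (f.1 :: f.2), f.1 :: f.2 =i V i &
    f.2 != [::] -> cycle (@edge G) (f.1 :: f.2)].
  by move=> i; have [x [s h]] := hamiltonian_order (Vham i) (Vn0 i); exists (x, s).
pose root i := (f i).1; pose rest i := (f i).2.
have /choice[g gP] : forall e : H * H, exists g : G * G, edge e.1 e.2 ->
    [/\ g.1 \in V e.1, g.2 \in V e.2 & edge g.1 g.2].
  move=> e; have [ee|_] := boolP (edge e.1 e.2); last by exists (root e.1, root e.1).
  by have [x [y h]] := Vedge _ _ ee; exists (x, y).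
pose exit i j := (g (i, j)).1; pose entry i j := (g (i, j)).2.
have restE i : root i :: rest i =i V i by have [] := fP i.
have rest_V i v : v \in root i :: rest i -> v \in V i by rewrite restE.
have rest_uniq i : uniq (root i :: rest i) by have [] := fP i.
have rest_cycle i : rest i != [::] -> cycle (@edge G) (root i :: rest i) by have [] := fP i.
have exit_rest i j : edge i j -> exit i j \in root i :: rest i.
  by move=> ij; have [h _ _] := gP (i, j) ij; rewrite restE.
have entry_rest i j : edge i j -> entry i j \in root j :: rest j.
  by move=> ij; have [_ h _] := gP (i, j) ij; rewrite restE.
have edge_link i j : edge i j -> edge (exit i j) (entry i j).
  by move=> ij; have [_ _ h] := gP (i, j) ij.
have [r20 r200 ap20] := arcs_apart_exists phi.
pose r := r20 / 20; have r0 : 0 < r by rewrite divr_gt0.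
have ap : arcs_apart phi (20 * r) by rewrite /r mulrC divfK.
have r20' : 0 < r / 2 by rewrite divr_gt0.
(* Half of r, because a short step of a cycle may touch two arcs. *)
have [d d0 mod] := arc_modulus_exists phi r20'.
have [N N0 short2] := short_arc_steps_exists d0 mod.
have short : short_arc_steps phi r N.
  move=> x y j s t xy jN hs ht; apply: lt_trans (short2 x y j s t xy jN hs ht) _.
  by rewrite ltr_pdivrMr // ltr_pMr // ltr1n.
have ap2 : arcs_apart phi (2 * r).
  by move=> *; apply: le20_le2 => //; exact: ap.
have phi_lk := lk_cycle_chain_eq0 r0 d0 N0 nl ap2 mod short.
pose pts i j := walk_points phi N (root i) (walk root rest exit entry i j).
have [M [M1 pts_M]] : exists M, (1 < M)%N /\ forall i j, (size (pts i j) < M)%N.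
  (* Strictly above all sizes, and at least 2 so that every edge has an inner breakpoint. *)
  exists (\max_(e : H * H) size (pts e.1 e.2)).+2; split=> // i j.
  by rewrite !ltnS ltnW // ltnS; exact: (leq_bigmax (i, j)).
(* A walk with fewer than M points rests at the root of its target, the default value of [nth]. *)
pose p (x : node_type H M) : space3 R := match x with
  | inl i => pos phi (root i)
  | inr (inl (i, j, k)) => nth (pos phi (root j)) (pos phi (root i) :: pts i j) k
  | inr (inr _) => 0 end.
have p_node i j k : edge i j ->
    p (node M i j k) = nth (pos phi (root j)) (pos phi (root i) :: pts i j) k.
  move=> ij; rewrite /node; case: eqP => [->|/eqP k0] //=.
  case: ltnP => kM /=; first by rewrite inordK // ltnS ltnW.
  by rewrite nth_default //=; exact: leq_trans (pts_M i j) kM.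
(* The four spare indices give more than three nodes even when H is empty. *)
have [|q gq qp] := general_position_exists p _ r0.
  by rewrite !card_sum card_ord; lia.
exists (polygonal_embedding M1 gq); split; first exact: polygonal_tame.
exact: (contraction_no_links V_disj rest_V rest_uniq rest_cycle exit_rest entry_rest edge_link
  r0 N0 short ap phi_lk pts_M p_node qp).
Qed.
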